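(* Let $N\ge 0$ be an integer and let $f$ be a meromorphic function in $\mathbb{C}$, holomorphic at $0$ with $f(0)\neq 0$. Let $\{t_n\}$ and $\{s_n\}$ be the families of poles and of zeros of $f$ in $\mathbb{C}$, respectively, each listed according to multiplicity. Suppose that $$\sum_{n}\frac{1}{|t_n|^{N+1}}<+\infty,\qquad \sum_{n}\frac{1}{|s_n|^{N+1}}<+\infty,\qquad \limsup_{r\to\infty}\frac{T(r,f)}{r^{N+1}}=0 .$$ Then $$\sum_{n}\frac{1}{s_n^{N+1}}=\sum_{n}\frac{1}{t_n^{N+1}}-\frac{1}{N!}\left(\frac{f'}{f}\right)^{(N)}(0).$$
   Context: The families of zeros and poles are countable (finite or empty families are allowed; an empty sum is $0$). Here $T(r,f)$ is the Nevanlinna characteristic: $T(r,f)=m(r,f)+N(r,f)$, where $m(r,f)=\frac{1}{2\pi}\int_0^{2\pi}\ln^+|f(re^{i\varphi})|\,d\varphi$ with $\ln^+x=\max(0,\ln x)$ (and $\ln^+ 0=0$), and, for $f$ without a pole at $0$, $N(r,f)=\sum_{|t_k|<r}\ln\frac{r}{|t_k|}$, the sum being over the poles $t_k$ of $f$ in $|z|<r$ counted with multiplicity. $g^{(N)}$ denotes the $N$-th derivative. *)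

(* Defs.v *)
(* MathComp-Analysis, over an arbitrary R : realType. *)
From HB Require Import structures.
From mathcomp Require Import all_boot all_order all_algebra.
From mathcomp Require Import complex.
From mathcomp Require Import all_classical all_reals all_analysis.

Set Implicit Arguments.
Unset Strict Implicit.
Unset Printing Implicit Defensive.

Import Order.TTheory GRing.Theory Num.Theory numFieldNormedType.Exports.

Local Open Scope ring_scope.
Local Open Scope complex_scope.
Local Open Scope classical_set_scope.

(* As a numFieldType, R[i] has the topological and normed-module structures that
   every numFieldType has over itself, so that derivable, derive1 and derive1n
   are about complex derivatives. *)
Definition Cplx (R : realType) : numFieldType := R[i].

(* The norm `|z| of z : R[i] lives in R[i]; this is the same norm, in R. *)
Definition modulus (R : realType) (z : Cplx R) : R := Normc.normc z.

Section MeromorphicFunctions.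
Variable R : realType.
Local Notation C := (Cplx R).
Implicit Types (f : C -> C) (a : C).

Definition holomorphic_at f a : Prop :=
  \forall z \near a, derivable f z 1.

Definition zero_of_order f a (m : nat) : Prop :=
  exists g : C -> C, [/\ holomorphic_at g a, g a != 0 &
    \forall z \near a, f z = (z - a) ^+ m * g z].

(* Meromorphic functions are represented by total functions, whose values at
   the poles are irrelevant: \near (a^') only ranges over z != a. *)
Definition pole_of_order f a (m : nat) : Prop :=
  (0 < m)%N /\ exists g : C -> C, [/\ holomorphic_at g a, g a != 0 &
    \forall z \near a^', f z = g z / (z - a) ^+ m].

Definition meromorphic f : Prop :=
  forall a, holomorphic_at f a \/ exists m, pole_of_order f a m.

(* The order of a as a zero (resp. pole) of f; it is 0 if a is not a zero
   (resp. not a pole) of f.  There is at most one order. *)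
Definition zero_mult f a : nat := xget 0%N [set m | zero_of_order f a m].
Definition pole_mult f a : nat := xget 0%N [set m | pole_of_order f a m].

(* A countable (possibly finite or empty) family of complex numbers is given by
   its index set D : set nat and by s : nat -> C, whose values outside of D are
   irrelevant.  The family lists each a exactly mult a times. *)
Definition lists_with_mult (D : set nat) (s : nat -> C) (mult : C -> nat) :
  Prop := forall a, ([set n | D n /\ s n = a] #= `I_(mult a))%card.

(* The sum of the u n, n in D; only used for absolutely convergent sums. *)
Definition family_sum (D : set nat) (u : nat -> C) : C :=
  limn (series (fun n => if n \in D then u n else 0)).

Definition proximity f (r : R) : \bar R :=
  (((2 * pi)^-1)%:E * \int[lebesgue_measure]_(phi in `[0%R, (2 * pi)%R])
     (Num.max 0 (ln (modulus (f ((r * cos phi) +i* (r * sin phi))))))%:E)%E.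

(* The integrated counting function of the poles of f, for f without a pole at
   0; points a which are not poles of f contribute 0. *)
Definition counting f (r : R) : \bar R :=
  \esum_(a in [set a : C | modulus a < r])
     ((pole_mult f a)%:R * ln (r / modulus a))%:E.

Definition characteristic f (r : R) : \bar R :=
  (proximity f r + counting f r)%E.

End MeromorphicFunctions.

(* Main.v *)
Require Import Defs.
From HB Require Import structures.
From mathcomp Require Import all_boot all_order all_algebra.
From mathcomp Require Import complex ring lra.
From mathcomp Require Import all_classical all_reals all_analysis.
Set Implicit Arguments.
Unset Strict Implicit.
Unset Printing Implicit Defensive.
Import Order.TTheory GRing.Theory Num.Theory numFieldNormedType.Exports.
Local Open Scope ring_scope.
Local Open Scope complex_scope.
Local Open Scope classical_set_scope.

(* For R > 0 such that f has no zero or pole on |z| = R, let H be the product of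
   f with inverse Blaschke factors removing its zeros s and poles t in |z| < R.
   H is holomorphic without zeros near |z| <= R and |H| = |f| on |z| = R, hence
   log|H| = log|H(0)| + Re L with L a primitive of H'/H.  The mean value of
   log|H| on the circle gives Jensen's formula for f, and with k = N+1 its k-th
   Fourier coefficient gives
     sum_s 1/s^k - sum_t 1/t^k + (f'/f)^(N)(0) / N!
       = sum_s (conj s / R^2)^k - sum_t (conj t / R^2)^k
         + (k / pi) int_0^(2 pi) log|f(R e^(i phi))| (R e^(i phi))^(-k) dphi.
   By Jensen, int |log|f|| <= 4 pi T(R, f) + O(1), so the integral term is
   o(1) when T(R, f) = o(R^k); the other two sums are o(1) because
   |conj s / R^2| <= 1/|s| for |s| < R (dominated convergence).
   The underlying facts on holomorphic functions are derived from Goursat's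
   theorem for triangles: it yields primitives F, Cauchy's formula holds for the
   C^1 function F, hence F and then F' = f are smooth. *)

(** * Complex numbers, curves and integrals *)

(** The characteristic controls only the positive part of log|f| and the poles, whereas the Fourier
    coefficient needs the integral of |log|f||. Since |u| = 2 max(0, u) - u, Jensen's formula
    supplies the missing half, the zeros entering with the favourable sign. The radius has to be
    generic: an open disc of slightly larger radius r0 must contain no further zero or pole and none
    of the reflected points R^2 / conj s, so that H is holomorphic and zero-free on an open disc
    around the circle. The coefficient of log|H| = log|H(0)| + (L + conj L) / 2 sees only L: on the
    circle conj z = R^2 / z turns conj L into a series in negative powers of z. The factor 1/2 is
    why pi appears and not 2 pi. The limit is taken as an estimate: for each e > 0 one radius makes
    the defect of the identity at most (4 + 12 k) e, and e is arbitrary. *)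

Section Modulus.
Variable R : realType.
Local Notation C := (Cplx R).
Implicit Types (z w : C) (x : R).

Lemma normE z : `|z| = (modulus z)%:C :> C.
Proof. by case: z. Qed.

Lemma modulus_ge0 z : 0 <= modulus z.
Proof. by case: z => a b; exact: sqrtr_ge0. Qed.

Lemma modulus0 : modulus (0 : C) = 0.
Proof. exact: Normc.normc0. Qed.

Lemma modulus1 : modulus (1 : C) = 1.
Proof. exact: Normc.normc1. Qed.

Lemma modulusM z w : modulus (z * w) = modulus z * modulus w.
Proof. exact: Normc.normcM. Qed.

Lemma modulusV z : modulus z^-1 = (modulus z)^-1.
Proof. exact: Normc.normcV. Qed.

Lemma modulus_eq0 z : (modulus z == 0) = (z == 0).
Proof.
apply/eqP/eqP => [|->]; last exact: modulus0.
exact: Normc.eq0_normc.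
Qed.

Lemma modulus_gt0 z : (0 < modulus z) = (z != 0).
Proof. by rewrite lt_neqAle modulus_ge0 andbT eq_sym modulus_eq0. Qed.

Lemma modulusX z n : modulus (z ^+ n) = modulus z ^+ n.
Proof. by elim: n => [|n IH]; rewrite ?expr0 ?modulus1// !exprS modulusM IH. Qed.

Lemma modulusR x : modulus (x%:C : C) = `|x|.
Proof. by rewrite /modulus/= expr0n addr0 sqrtr_sqr. Qed.

Lemma modulusD z w : modulus (z + w) <= modulus z + modulus w.
Proof.
have := ler_normD z w; rewrite !normE.
by rewrite -[X in _ <= X](rmorphD (real_complex R)) lecR.
Qed.

Lemma modulusN z : modulus (- z) = modulus z.
Proof. by have := normrN z; rewrite !normE => /complexI. Qed.

Lemma modulus_distC z w : modulus (z - w) = modulus (w - z).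
Proof. by rewrite -modulusN opprB. Qed.

Lemma modulus_sum (I : Type) (s : seq I) (P : pred I) (F : I -> C) :
  modulus (\sum_(i <- s | P i) F i) <= \sum_(i <- s | P i) modulus (F i).
Proof.
elim/big_ind2: _ => [|a b c d ab cd|//]; first by rewrite modulus0.
by rewrite (le_trans (modulusD _ _))// lerD.
Qed.

Lemma re_le z : `|complex.Re z| <= modulus z.
Proof. by case: z => a b /=; rewrite -[leLHS]sqrtr_sqr ler_wsqrtr// lerDl sqr_ge0. Qed.

Lemma im_le z : `|complex.Im z| <= modulus z.
Proof. by case: z => a b /=; rewrite -[leLHS]sqrtr_sqr ler_wsqrtr// lerDr sqr_ge0. Qed.

Lemma modulus_le z : modulus z <= `|complex.Re z| + `|complex.Im z|.
Proof.
case: z => a b; rewrite [leRHS]/=.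
have -> : (a +i* b : C) = a%:C + b%:C * 'i by simpc.
apply: (le_trans (modulusD _ _)); rewrite modulusM !modulusR.
by rewrite /modulus /= expr0n expr1n add0r sqrtr1 mulr1.
Qed.

Lemma reD z w : complex.Re (z + w) = complex.Re z + complex.Re w.
Proof. by case: z w => a b []. Qed.
Lemma imD z w : complex.Im (z + w) = complex.Im z + complex.Im w.
Proof. by case: z w => a b []. Qed.
Lemma reN z : complex.Re (- z) = - complex.Re z. Proof. by case: z. Qed.
Lemma imN z : complex.Im (- z) = - complex.Im z. Proof. by case: z. Qed.
Lemma reB z w : complex.Re (z - w) = complex.Re z - complex.Re w. Proof. by rewrite reD reN. Qed.
Lemma imB z w : complex.Im (z - w) = complex.Im z - complex.Im w. Proof. by rewrite imD imN. Qed.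
Lemma reM z w : complex.Re (z * w) = complex.Re z * complex.Re w - complex.Im z * complex.Im w.
Proof. by case: z w => a b []. Qed.
Lemma imM z w : complex.Im (z * w) = complex.Re z * complex.Im w + complex.Im z * complex.Re w.
Proof. by case: z w => a b []. Qed.

(** Balls of [Cplx R] have complex radii. Positivity in [R[i]] forces the imaginary part to vanish,
    so real radii suffice. *)
Lemma nbhs_modulusP (a : C) (P : C -> Prop) :
  (\forall z \near a, P z) <->
  exists2 d : R, 0 < d & forall z, modulus (z - a) < d -> P z.
Proof.
split=> [/nbhs_ballP[[d e] /=]|[d d0 H]].
  rewrite ltcE/= => /andP[/eqP e0 d0] H; exists d => // z zd.
  by apply: H; rewrite /ball/= e0 modulus_distC in zd *; rewrite normE ltcR.
apply/nbhs_ballP; exists d%:C => /=; first by rewrite ltcR.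
by move=> z; rewrite /ball/= normE ltcR => zd; apply: H; rewrite modulus_distC.
Qed.

Lemma dnbhs_modulusP (a : C) (P : C -> Prop) :
  (\forall z \near a^', P z) <->
  exists2 d : R, 0 < d & forall z, modulus (z - a) < d -> z != a -> P z.
Proof.
by rewrite -(nbhs_modulusP a (fun z => z != a -> P z)) near_withinE.
Qed.

Lemma cvg_modulusP (T : Type) (F : set_system T) {FF : Filter F} (f : T -> C) (l : C) :
  f @ F --> l <-> forall e : R, 0 < e -> \forall t \near F, modulus (f t - l) < e.
Proof.
split=> [H e e0|H].
  have /H : nbhs l [set z | modulus (z - l) < e] by apply/nbhs_modulusP; exists e.
  exact.
apply/cvgrPdist_lt => -[e e']; rewrite ltcE/= => /andP[/eqP -> e0].
by apply: filterS (H _ e0) => t; rewrite normE ltcR modulus_distC.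
Qed.

Lemma continuous_modulus (a : C) : {for a, continuous (@modulus R)}.
Proof.
apply/(@cvgrPdist_lt _ _ _ (nbhs a)) => e e0; apply/nbhs_modulusP; exists e => // z za.
apply: le_lt_trans za; rewrite ler_norml; apply/andP; split.
- rewrite lerBrDl; apply: le_trans (_ : modulus (z - a) + modulus a - modulus (z-a) <= _).
    rewrite lerD2r; apply: le_trans (modulusD _ _); by rewrite subrK.
  by rewrite addrAC subrr add0r.
rewrite lerBlDr modulus_distC; apply: le_trans (modulusD _ _); by rewrite subrK.
Qed.

Lemma continuous_Re (a : C) : {for a, continuous (fun z : C => complex.Re z)}.
Proof.
apply/(@cvgrPdist_lt _ _ _ (nbhs a)) => e e0; apply/nbhs_modulusP; exists e => // z za.
by apply: le_lt_trans za; rewrite -reB modulus_distC re_le.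
Qed.

Lemma continuous_Im (a : C) : {for a, continuous (fun z : C => complex.Im z)}.
Proof.
apply/(@cvgrPdist_lt _ _ _ (nbhs a)) => e e0; apply/nbhs_modulusP; exists e => // z za.
by apply: le_lt_trans za; rewrite -imB modulus_distC im_le.
Qed.

Lemma cvg_complex (T : Type) (F : set_system T) {FF : Filter F}
    (f g : T -> R) (a b : R) :
  f @ F --> a -> g @ F --> b -> (f t +i* g t : C) @[t --> F] --> (a +i* b : C).
Proof.
move=> fa gb; apply/cvg_modulusP => e e0.
have e2 : 0 < e / 2 by rewrite divr_gt0.
move/cvgrPdist_lt : fa => /(_ _ e2) fa; move/cvgrPdist_lt : gb => /(_ _ e2) gb.
near=> t; apply: le_lt_trans (modulus_le _) _; rewrite /= [ltRHS]splitr.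
apply: ltrD; rewrite distrC; [near: t; exact: fa|near: t; exact: gb].
Unshelve. all: by end_near. Qed.

End Modulus.

(** * Complex derivatives and derivatives along curves *)

Section Derivatives.

(** A form of differentiability without division, trivially true at [w = x]; such bounds can be
    added and composed. *)
Lemma is_derive1P (K : numFieldType) (f : K -> K) (x d : K) :
  is_derive x 1 f d <-> forall e : K, 0 < e ->
    \forall w \near x, `|f w - f x - d * (w - x)| <= e * `|w - x|.
Proof.
have HP : is_derive x 1 f d <-> (h^-1 *: (f (h *: 1 + x) - f x) @[h --> 0^'] --> d).
  split=> [[df <-]|H]; first exact: df.
  have df : derivable f x 1 by apply/cvg_ex; exists d.
  by apply: DeriveDef => //; apply: cvg_lim => //; exact: norm_hausdorff.
rewrite HP; split=> [/cvgrPdist_le H e e0|H].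
  move/nbhs_ballP : (H e e0) => [r /= r0 Hr]; apply/nbhs_ballP; exists r => // w.
  rewrite /ball/= distrC => xw; have [->|wx] := eqVneq w x.
    by rewrite !subrr mulr0 subrr normr0 mulr0.
  have wx0 : w - x != 0 by rewrite subr_eq0.
  have := Hr (w - x); rewrite /ball/= sub0r normrN => /(_ xw wx0).
  rewrite scaler1 subrK => Hw.
  have -> : f w - f x - d * (w - x) = - ((w - x) * (d - (w - x)^-1 *: (f w - f x))).
    by rewrite [in RHS]mulrBr -[_ *: _]/(_ * _) mulrA mulfV// mul1r opprB (mulrC d).
  by rewrite normrN normrM mulrC ler_wpM2r.
apply/cvgrPdist_le => e e0; move/nbhs_ballP : (H e e0) => [r /= r0 Hr].
apply/nbhs_ballP; exists r => //= h; rewrite /ball/= sub0r normrN => hr h0.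
have := Hr (h + x); rewrite /ball/= opprD addrCA subrr addr0 normrN => /(_ hr).
rewrite addrK scaler1 => Hw.
have -> : d - h^-1 *: (f (h + x) - f x) = - h^-1 * (f (h + x) - f x - d * h).
  by rewrite -[_ *: _]/(_ * _); field.
rewrite normrM normrN normfV mulrC ler_pdivrMr ?normr_gt0//.
Qed.

Variable R : realType.
Local Notation C := (Cplx R).
Local Notation re := (@complex.Re R).
Local Notation im := (@complex.Im R).

Lemma is_deriveC (f : C -> C) (z d : C) :
  is_derive z 1 f d <-> forall e : R, 0 < e ->
    \forall w \near z, modulus (f w - f z - d * (w - z)) <= e * modulus (w - z).
Proof.
rewrite is_derive1P; split=> H e e0.
  have : 0 < e%:C :> C by rewrite ltcR.
  move/H; apply: filterS => w; rewrite !normE.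
  by rewrite -[X in _ <= X](rmorphM (real_complex R)) lecR.
case: e e0 => e e'; rewrite ltcE/= => /andP[/eqP -> e0].
move: (H e e0); apply: filterS => w; rewrite !normE.
by rewrite -[X in _ -> _ <= X](rmorphM (real_complex R)) lecR.
Qed.

Lemma derivable_is_derive (f : C -> C) (z : C) : derivable f z 1 -> is_derive z 1 f (derive1 f z).
Proof. by move=> df; rewrite derive1E; exact: derivableP. Qed.

Lemma is_derive_derive1 (f : C -> C) (z d : C) : is_derive z 1 f d -> derive1 f z = d.
Proof. by move=> df; rewrite derive1E derive_val. Qed.

(** [Cplx R] is normed over itself only, so a derivative in a real variable is taken on the two
    components. *)
Definition curve_derive (g : R -> C) (t : R) (v : C) : Prop :=
  is_derive t 1 (re \o g) (re v) /\ is_derive t 1 (im \o g) (im v).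

Lemma curve_deriveP (g : R -> C) (t : R) (v : C) :
  curve_derive g t v <-> forall e : R, 0 < e ->
    \forall s \near t, modulus (g s - g t - v * (s - t)%:C) <= e * `|s - t|.
Proof.
have reE s : re (g s - g t - v * (s - t)%:C) = re (g s) - re (g t) - re v * (s - t).
  by rewrite reB reB reM/= mulr0 subr0.
have imE s : im (g s - g t - v * (s - t)%:C) = im (g s) - im (g t) - im v * (s - t).
  by rewrite imB imB imM/= mulr0 add0r.
split=> [[/is_derive1P dr /is_derive1P di] e e0|H].
  have e2 : 0 < e / 2 by rewrite divr_gt0.
  near=> s; apply: (le_trans (modulus_le _)).
  rewrite reE imE (splitr e) mulrDl lerD//.
    by near: s; exact: dr.
  by near: s; exact: di.
split; apply/is_derive1P => e /H; apply: filterS => s; apply: le_trans.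
  by rewrite /= -reE re_le.
by rewrite /= -imE im_le.
Unshelve. all: by end_near. Qed.

Lemma curve_continuous g t v : curve_derive g t v -> {for t, continuous g}.
Proof.
case=> [[+ _] [+ _]].
move=> /derivable1_diffP/differentiable_continuous cr.
move=> /derivable1_diffP/differentiable_continuous ci.
have -> : g = (fun s => re (g s) +i* im (g s)) by apply/funext => s; case: (g s).
exact: cvg_complex cr ci.
Qed.

Lemma derivable_continuous (f : C -> C) (z : C) :
  derivable f z 1 -> {for z, continuous f}.
Proof. by move=> /derivable1_diffP/differentiable_continuous. Qed.

Lemma is_derive_continuous (f : C -> C) (z d : C) :
  is_derive z 1 f d -> {for z, continuous f}.
Proof. by case=> /derivable_continuous. Qed.

Lemma curve_derive_comp (f : C -> C) (g : R -> C) (t : R) (v d : C) :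
  is_derive (g t) 1 f d -> curve_derive g t v ->
  curve_derive (f \o g) t (d * v).
Proof.
move=> /is_deriveC df dg; have gc := curve_continuous dg.
move/curve_deriveP : dg => dg; apply/curve_deriveP => e e0.
(* Each of the two error terms of the chain rule receives [e / 2]; the [+ 1] keeps the divisors
   positive when [d] or [v] vanishes. *)
pose M := modulus d + 1; pose e1 := e / 2 / M; pose e2 := e / 2 / (modulus v + 1).
have M0 : 0 < M by rewrite /M ltr_wpDl// modulus_ge0.
have v0 : 0 < modulus v + 1 by rewrite ltr_wpDl// modulus_ge0.
have e10 : 0 < e1 by rewrite !divr_gt0.
have e20 : 0 < e2 by rewrite !divr_gt0.
have H1 := dg _ e10; have H2 := gc _ (df _ e20); have H3 := dg _ (ltr01 : 0 < (1 : R)).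
near=> s.
have A1 : modulus (g s - g t - v * (s - t)%:C) <= e1 * `|s - t| by near: s.
have A2 : modulus (f (g s) - f (g t) - d * (g s - g t)) <= e2 * modulus (g s - g t).
  by near: s; exact: H2.
have A3 : modulus (g s - g t - v * (s - t)%:C) <= 1 * `|s - t| by near: s.
have A4 : modulus (g s - g t) <= (modulus v + 1) * `|s - t|.
  rewrite mulrDl -(subrK (v * (s - t)%:C) (g s - g t)) addrC.
  by apply: (le_trans (modulusD _ _)); rewrite lerD// modulusM modulusR.
have -> : (f \o g) s - (f \o g) t - d * v * (s - t)%:C =
    (f (g s) - f (g t) - d * (g s - g t)) + d * (g s - g t - v * (s - t)%:C).
  by rewrite /=; ring.
apply: (le_trans (modulusD _ _)); rewrite (splitr e) mulrDl lerD//.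
  apply: (le_trans A2); rewrite /e2 -mulrA ler_wpM2l//.
    by rewrite divr_ge0 ?ltW.
  by rewrite mulrC ler_pdivrMr// mulrC.
rewrite modulusM; apply: le_trans (_ : M * (e1 * `|s - t|) <= _).
  by rewrite ler_pM// ?modulus_ge0// /M lerDl.
by rewrite mulrA /e1 mulrCA mulfV ?mulr1// gt_eqF.
Unshelve. all: by end_near. Qed.

Lemma curve_derive_cst (a : C) t : curve_derive (fun=> a) t 0.
Proof. by split; exact: is_derive_cst. Qed.

Lemma curve_deriveD g1 g2 t v1 v2 : curve_derive g1 t v1 -> curve_derive g2 t v2 ->
  curve_derive (fun s => g1 s + g2 s) t (v1 + v2).
Proof.
move=> [a1 b1] [a2 b2]; split.
  rewrite (_ : re \o _ = (re \o g1) + (re \o g2)); last first.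
    by apply/funext => s; rewrite /= reD.
  by rewrite reD; exact: is_deriveD.
rewrite (_ : im \o _ = (im \o g1) + (im \o g2)); last first.
  by apply/funext => s; rewrite /= imD.
by rewrite imD; exact: is_deriveD.
Qed.

Lemma curve_deriveM g1 g2 t v1 v2 : curve_derive g1 t v1 -> curve_derive g2 t v2 ->
  curve_derive (fun s => g1 s * g2 s) t (v1 * g2 t + g1 t * v2).
Proof.
move=> [a1 b1] [a2 b2]; split.
  rewrite (_ : re \o _ = (re \o g1) * (re \o g2) - (im \o g1) * (im \o g2)); last first.
    by apply/funext => s; rewrite /= reM.
  apply: is_derive_eq; rewrite reD !reM /GRing.scale/=; ring.
rewrite (_ : im \o _ = (re \o g1) * (im \o g2) + (im \o g1) * (re \o g2)); last first.
  by apply/funext => s; rewrite /= imM.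
apply: is_derive_eq; rewrite imD !imM /GRing.scale/=; ring.
Qed.

Lemma curve_deriveZ a g t v : curve_derive g t v -> curve_derive (fun s => a * g s) t (a * v).
Proof.
move=> H; have := curve_deriveM (curve_derive_cst a t) H.
by rewrite mul0r add0r.
Qed.

Lemma curve_derive_id t : curve_derive (fun s : R => s%:C) t 1.
Proof.
split.
  rewrite (_ : re \o _ = id)//; exact: is_derive_id.
rewrite (_ : im \o _ = cst 0)//; exact: is_derive_cst.
Qed.

Definition circ (r phi : R) : C := (r * cos phi) +i* (r * sin phi).

Lemma curve_derive_circ r t : curve_derive (circ r) t ('i * circ r t).
Proof.
split.
  rewrite (_ : re \o _ = r *: cos)//.
  apply: is_derive_eq; rewrite reM/= /GRing.scale/=; ring.
rewrite (_ : im \o _ = r *: sin)//.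
apply: is_derive_eq; rewrite imM/= /GRing.scale/=; ring.
Qed.

Lemma modulus_circ r t : 0 <= r -> modulus (circ r t) = r.
Proof.
move=> r0; rewrite /modulus /circ /= !exprMn -mulrDr cos2Dsin2 mulr1.
by rewrite sqrtr_sqr ger0_norm.
Qed.

Lemma circ_neq0 r t : 0 < r -> circ r t != 0.
Proof. by move=> r0; rewrite -modulus_gt0 modulus_circ ?ltW. Qed.

Lemma circ0 r : circ r 0 = r%:C.
Proof. by rewrite /circ cos0 sin0 mulr1 mulr0. Qed.

Lemma circ2pi r : circ r (2 * pi) = r%:C.
Proof.
by rewrite /circ mulr_natl cos2pi sin2pi mulr1 mulr0.
Qed.

End Derivatives.

(** * Integrals of complex-valued functions over a segment *)

Section Integration.
Variable R : realType.
Local Notation C := (Cplx R).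
Local Notation re := (@complex.Re R).
Local Notation im := (@complex.Im R).
Local Notation mu := (@lebesgue_measure R).

(** Two-sided continuity at every point, end points included, rather than continuity of the
    restriction: the rules for limits then apply pointwise. *)
Definition continuous_seg (T : topologicalType) (b : R) (g : R -> T) : Prop :=
  forall t : R, 0 <= t <= b -> {for t, continuous g}.

Lemma continuous_seg_within (T : topologicalType) b (g : R -> T) :
  continuous_seg b g -> {within `[0, b], continuous g}.
Proof.
move=> gc; apply: continuous_in_subspaceT => t; rewrite inE/= in_itv/=; exact: gc.
Qed.

Lemma continuous_seg_integrable b (g : R -> R) :
  continuous_seg b g -> mu.-integrable `[0, b] (EFin \o g).
Proof.
move=> /continuous_seg_within gc.
by apply: continuous_compact_integrable => //; exact: segment_compact.
Qed.

Lemma Rintegral_FTC b (g G : R -> R) : 0 < b -> continuous_seg b g ->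
  (forall t : R, 0 <= t <= b -> is_derive t 1 G (g t)) ->
  \int[mu]_(x in `[0, b]) g x = G b - G 0.
Proof.
move=> b0 gc dG; rewrite /Rintegral (continuous_FTC2 (F := G) b0)//.
- exact: continuous_seg_within.
- have Gc t : 0 <= t <= b -> {for t, continuous G}.
    by move=> /dG[/derivable1_diffP/differentiable_continuous].
  split.
  + by move=> t; rewrite in_itv/= => /andP[t0 tb]; have [] := dG t _; rewrite // !ltW.
  + by apply: cvg_at_right_filter; apply: Gc; rewrite lexx ltW.
  + by apply: cvg_at_left_filter; apply: Gc; rewrite lexx ltW.
- move=> t; rewrite in_itv/= => /andP[t0 tb].
  by rewrite derive1E; have dt := dG t; rewrite (derive_val (is_derive := dt _))// !ltW.
Qed.

Definition cint (b : R) (g : R -> C) : C :=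
  (\int[mu]_(x in `[0, b]) re (g x)) +i* (\int[mu]_(x in `[0, b]) im (g x)).

Lemma continuous_seg_re b (g : R -> C) :
  continuous_seg b g -> continuous_seg b (re \o g).
Proof.
by move=> gc t tb; apply: continuous_comp; [exact: gc|exact: continuous_Re].
Qed.

Lemma continuous_seg_im b (g : R -> C) :
  continuous_seg b g -> continuous_seg b (im \o g).
Proof.
by move=> gc t tb; apply: continuous_comp; [exact: gc|exact: continuous_Im].
Qed.

Let mI (b : R) : measurable (`[0, b] : set (measurableTypeR R)).
Proof. exact: measurable_itv. Qed.

Lemma eq_cint b g1 g2 : (forall t : R, 0 <= t <= b -> g1 t = g2 t) ->
  cint b g1 = cint b g2.
Proof.
move=> g12; congr (_ +i* _); apply: eq_Rintegral => t; rewrite inE/= in_itv/= => tb;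
  by rewrite g12.
Qed.

Lemma cint_FTC b (g G : R -> C) : 0 < b -> continuous_seg b g ->
  (forall t : R, 0 <= t <= b -> curve_derive G t (g t)) ->
  cint b g = G b - G 0.
Proof.
move=> b0 gc dG; rewrite /cint.
have E1 := Rintegral_FTC b0 (continuous_seg_re gc) (fun t tb => (dG t tb).1).
have E2 := Rintegral_FTC b0 (continuous_seg_im gc) (fun t tb => (dG t tb).2).
by rewrite [X in X +i* _]E1 [X in _ +i* X]E2 /=; case: (G b) => ? ?; case: (G 0).
Qed.

Lemma cintD b g1 g2 : continuous_seg b g1 -> continuous_seg b g2 ->
  cint b (fun t => g1 t + g2 t) = cint b g1 + cint b g2.
Proof.
move=> c1 c2.
have i1 := continuous_seg_integrable (continuous_seg_re c1).
have i2 := continuous_seg_integrable (continuous_seg_re c2).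
have i3 := continuous_seg_integrable (continuous_seg_im c1).
have i4 := continuous_seg_integrable (continuous_seg_im c2).
have -> : cint b g1 + cint b g2 = ((re (cint b g1) + re (cint b g2)) +i*
    (im (cint b g1) + im (cint b g2))) by [].
rewrite {1}/cint; congr (_ +i* _).
  under eq_Rintegral do rewrite reD.
  exact: (RintegralD (mI b) i1 i2).
under eq_Rintegral do rewrite imD.
exact: (RintegralD (mI b) i3 i4).
Qed.

Lemma cintZ b (a : C) g : continuous_seg b g ->
  cint b (fun t => a * g t) = a * cint b g.
Proof.
move=> cg; rewrite /cint.
have ir := continuous_seg_integrable (continuous_seg_re cg).
have ii := continuous_seg_integrable (continuous_seg_im cg).
have Z h (x : R) : mu.-integrable `[0, b] (EFin \o h) ->
    mu.-integrable `[0, b] (EFin \o (fun t => x * h t)).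
  by move=> ih; exact: (@integrableZl _ _ _ mu _ (mI b) x _ ih).
have E x h : mu.-integrable `[0, b] (EFin \o h) ->
    \int[mu]_(t in `[0, b]) (x * h t) = x * \int[mu]_(t in `[0, b]) h t.
  by move=> ih; exact: (RintegralZl x (mI b) ih).
have -> : \int[mu]_(x in `[0, b]) re (a * g x) =
    re a * \int[mu]_(x in `[0, b]) re (g x) - im a * \int[mu]_(x in `[0, b]) im (g x).
  under eq_Rintegral do rewrite reM.
  rewrite -(E _ _ ir) -(E _ _ ii).
  exact: (RintegralB (mI b) (Z _ (re a) ir) (Z _ (im a) ii)).
have -> : \int[mu]_(x in `[0, b]) im (a * g x) =
    re a * \int[mu]_(x in `[0, b]) im (g x) + im a * \int[mu]_(x in `[0, b]) re (g x).
  under eq_Rintegral do rewrite imM.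
  rewrite -(E _ _ ir) -(E _ _ ii).
  exact: (RintegralD (mI b) (Z _ (re a) ii) (Z _ (im a) ir)).
by case: a => a1 a2; simpc.
Qed.

Lemma Rintegral_cst_seg b (x : R) : 0 <= b -> \int[mu]_(_ in `[0, b]) x = x * b.
Proof.
move=> b0; have E := lebesgue_measure_itv (Interval (BLeft 0) (BRight b)).
have -> : \int[mu]_(_ in `[0, b]) x = x * fine (mu `[0, b]) by exact: Rintegral_cst.
rewrite {}E /= lte_fin.
by case: ltgtP b0 => [| |<-]//= b0 _; rewrite ?subr0// mulr0.
Qed.

Lemma cint_cst b (a : C) : 0 <= b -> cint b (fun=> a) = a * b%:C.
Proof.
by move=> b0; rewrite /cint !Rintegral_cst_seg//; case: a => ? ?; simpc.
Qed.

Lemma continuous_seg_cst (T : topologicalType) b (a : T) : continuous_seg b (fun=> a).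
Proof. by move=> t _; exact: cvg_cst. Qed.

Lemma continuous_segD b (g1 g2 : R -> C) : continuous_seg b g1 ->
  continuous_seg b g2 -> continuous_seg b (fun t => g1 t + g2 t).
Proof. by move=> c1 c2 t tb; apply: cvgD; [exact: c1|exact: c2]. Qed.

Lemma continuous_segM b (g1 g2 : R -> C) : continuous_seg b g1 ->
  continuous_seg b g2 -> continuous_seg b (fun t => g1 t * g2 t).
Proof. by move=> c1 c2 t tb; apply: cvgM; [exact: c1|exact: c2]. Qed.

Lemma continuous_segZ b (a : C) (g : R -> C) : continuous_seg b g ->
  continuous_seg b (fun t => a * g t).
Proof. by move=> c1 t tb; apply: cvgM; [exact: cvg_cst|exact: c1]. Qed.

Lemma continuous_segV b (g : R -> C) : continuous_seg b g ->
  (forall t : R, 0 <= t <= b -> g t != 0) ->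
  continuous_seg b (fun t => (g t)^-1).
Proof. by move=> c1 g0 t tb; apply: cvgV; [exact: g0|exact: c1]. Qed.

Lemma continuous_segX b (g : R -> C) n : continuous_seg b g ->
  continuous_seg b (fun t => g t ^+ n).
Proof.
move=> c1; elim: n => [|n IH]; first exact: continuous_seg_cst.
under eq_fun do rewrite exprS.
exact: (continuous_segM c1 IH).
Qed.

Lemma Rintegral_le b (g : R -> R) (M : R) : 0 <= b -> continuous_seg b g ->
  (forall t : R, 0 <= t <= b -> `|g t| <= M) ->
  `|\int[mu]_(x in `[0, b]) g x| <= b * M.
Proof.
move=> b0 gc gM; have ig := continuous_seg_integrable gc.
apply: (le_trans (le_normr_Rintegral (mI b) ig)).
have -> : b * M = \int[mu]_(x in `[0, b]) M.
  by rewrite Rintegral_cst_seg// mulrC.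
apply: le_Rintegral => //.
- by have := integrable_norm ig.
- exact/continuous_seg_integrable/continuous_seg_cst.
Qed.

(** The components are estimated separately, whence the factor 2; every use tolerates a constant
    factor. *)
Lemma cint_le b (g : R -> C) (M : R) : 0 <= b -> continuous_seg b g ->
  (forall t : R, 0 <= t <= b -> modulus (g t) <= M) ->
  modulus (cint b g) <= 2 * b * M.
Proof.
move=> b0 gc gM; apply: (le_trans (modulus_le _)).
rewrite -mulrA mulr_natl mulr2n; apply: lerD; apply: Rintegral_le => //.
- exact: continuous_seg_re.
- by move=> t /gM; apply: le_trans; exact: re_le.
- exact: continuous_seg_im.
- by move=> t /gM; apply: le_trans; exact: im_le.
Qed.

End Integration.

(** * Goursat's theorem and Cauchy's formula *)

Section Goursat.
Variable R : realType.
Local Notation C := (Cplx R).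
Local Notation re := (@complex.Re R).
Local Notation im := (@complex.Im R).
Local Notation mu := (@lebesgue_measure R).

(** Clamping the argument to [0, 1] extends [g] continuously to the whole line. Integrating from -1
    up to points below 3 then makes 0 and 1 interior points, where the derivative is two-sided. *)
Lemma real_primitive (g : R -> R) : continuous_seg 1 g ->
  exists G : R -> R, forall t : R, 0 <= t <= 1 -> is_derive t 1 G (g t).
Proof.
move=> gc; pose clamp (t : R) := Num.max 0 (Num.min 1 t).
have clamp01 t : 0 <= clamp t <= 1.
  by rewrite /clamp le_max lexx/= ge_max ler01/= ge_min lexx.
have clampE t : 0 <= t <= 1 -> clamp t = t.
  by case/andP=> t0 t1; rewrite /clamp (min_idPr t1) (max_idPr t0).
have clampc : continuous clamp.
  move=> t; apply: (@continuous_max _ _ (fun=> 0) (fun t : R => Num.min 1 t)).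
    exact: cst_continuous.
  apply: (@continuous_min _ _ (fun=> 1) (fun t : R => t)); first exact: cst_continuous.
  exact: cvg_id.
have hc : continuous (g \o clamp).
  by move=> t; apply: continuous_comp; [exact: clampc|exact: gc].
have hi : mu.-integrable `[-1, 3] (EFin \o (g \o clamp)).
  apply: continuous_compact_integrable; first exact: segment_compact.
  exact: continuous_subspaceT.
exists (fun x => \int[mu]_(t in `[-1, x]) (g \o clamp) t) => t t01.
have /andP[t0 t1] := t01.
have t3 : t < 3 by lra.
have tN1 : -1 < t by lra.
have [dG GE] := continuous_FTC1_closed t3 hi tN1 (hc t).
apply: DeriveDef; first exact dG.
by rewrite -derive1E GE /= clampE.
Qed.

Lemma curve_primitive (g : R -> C) : continuous_seg 1 g ->
  exists G : R -> C, forall t : R, 0 <= t <= 1 -> curve_derive G t (g t).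
Proof.
move=> gc.
have [G1 H1] := real_primitive (continuous_seg_re gc).
have [G2 H2] := real_primitive (continuous_seg_im gc).
by exists (fun t => G1 t +i* G2 t) => t t01; split; [exact: H1|exact: H2].
Qed.

Lemma curve_derive_affine (G : R -> C) (a b t : R) (v : C) :
  curve_derive G (a * t + b) v -> curve_derive (fun s => G (a * s + b)) t (a%:C * v).
Proof.
move=> /curve_deriveP H; apply/curve_deriveP => e e0.
pose e' := e / (`|a| + 1).
have a0 : 0 < `|a| + 1 by rewrite ltr_wpDl.
have e'0 : 0 < e' by rewrite divr_gt0.
have /nbhs_ballP[d /= d0 Hd] := H _ e'0.
apply/nbhs_ballP; exists (d / (`|a| + 1)); first by rewrite /= divr_gt0.
move=> s; rewrite /ball/= ltr_pdivlMr// => ts.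
have E : a * s + b - (a * t + b) = a * (s - t) by ring.
have := Hd (a * s + b); rewrite /ball/= distrC E normrM => Hs.
have -> : G (a * s + b) - G (a * t + b) - a%:C * v * (s - t)%:C =
   G (a * s + b) - G (a * t + b) - v * (a * (s - t))%:C.
  by rewrite [in RHS](rmorphM (real_complex R)); ring.
apply: le_trans (Hs _) _.
  by apply: le_lt_trans ts; rewrite mulrC distrC ler_wpM2l// lerDl.
rewrite mulrA; apply: ler_wpM2r => //; rewrite /e' -mulrA -[leRHS]mulr1.
apply: ler_wpM2l; first exact: ltW.
by rewrite mulrC ler_pdivrMr// mul1r lerDl.
Qed.

Definition line (z w : C) (t : R) : C := z + t%:C * (w - z).

Lemma curve_derive_line z w t : curve_derive (line z w) t (w - z).
Proof.
have := curve_deriveD (curve_derive_cst z t)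
  (curve_deriveM (curve_derive_id t) (curve_derive_cst (w - z) t)).
by rewrite mulr0 addr0 add0r mul1r.
Qed.

Lemma line0 z w : line z w 0 = z. Proof. by rewrite /line mul0r addr0. Qed.
Lemma line1 z w : line z w 1 = w. Proof. by rewrite /line mul1r addrC subrK. Qed.

Lemma line_le z w p t rho : 0 <= t <= 1 -> modulus (z - p) <= rho ->
  modulus (w - p) <= rho -> modulus (line z w t - p) <= rho.
Proof.
move=> /andP[t0 t1] zr wr.
have -> : line z w t - p = (1 - t)%:C * (z - p) + t%:C * (w - p).
  by rewrite /line (rmorphB (real_complex R)) rmorph1; ring.
apply: le_trans (modulusD _ _) _; rewrite !modulusM !modulusR.
rewrite (ger0_norm t0) ger0_norm ?subr_ge0//.
have -> : rho = (1 - t) * rho + t * rho by ring.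
by rewrite lerD// ler_wpM2l// subr_ge0.
Qed.

Lemma line_lt z w t r : 0 <= t <= 1 -> modulus z < r -> modulus w < r ->
  modulus (line z w t) < r.
Proof.
move=> t01 zr wr; rewrite -[line z w t]subr0.
apply: le_lt_trans (_ : Num.max (modulus z) (modulus w) < _); last by rewrite gt_max zr.
by apply: line_le => //; rewrite subr0 le_max lexx// orbT.
Qed.

Definition disc_continuous r (f : C -> C) :=
  forall z, modulus z < r -> {for z, continuous f}.

Definition seg (f : C -> C) (z w : C) : C :=
  (w - z) * cint 1 (fun t => f (line z w t)).

Lemma continuous_seg_curve (f : C -> C) (g : R -> C) b :
  continuous_seg b g -> (forall t : R, 0 <= t <= b -> {for g t, continuous f}) ->
  continuous_seg b (fun t => f (g t)).
Proof. by move=> gc fc t tb; apply: continuous_comp; [exact: gc|exact: fc]. Qed.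

Lemma continuous_seg_line (b : R) z w : continuous_seg b (line z w).
Proof. by move=> t _; exact: curve_continuous (curve_derive_line z w t). Qed.

Lemma disc_continuous_line r f z w : disc_continuous r f ->
  modulus z < r -> modulus w < r -> continuous_seg 1 (fun t => f (line z w t)).
Proof.
move=> fc zr wr; apply: continuous_seg_curve; first exact: continuous_seg_line.
by move=> t t01; apply: fc; exact: line_lt.
Qed.

(** An affine change of variable turns a primitive along the whole segment into one along any
    sub-segment. As [a] and [b] come in any order, this yields both reversal and halving. *)
Lemma seg_sub (f : C -> C) (z w : C) (G : R -> C) (a b : R) :
  continuous_seg 1 (fun t => f (line z w t)) ->
  (forall t : R, 0 <= t <= 1 -> curve_derive G t (f (line z w t))) ->
  0 <= a <= 1 -> 0 <= b <= 1 ->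
  seg f (line z w a) (line z w b) = (w - z) * (G b - G a).
Proof.
move=> fc dG a01 b01; rewrite /seg.
have ab t : 0 <= t <= 1 -> 0 <= (b - a) * t + a <= 1.
  move: a01 b01 => /andP[a0 a1] /andP[b0 b1] /andP[t0 t1].
  have -> : (b - a) * t + a = (1 - t) * a + t * b by ring.
  have t1' : 0 <= 1 - t by rewrite subr_ge0.
  rewrite addr_ge0 ?mulr_ge0//=.
  have H1 := ler_wpM2l t1' a1; have H2 := ler_wpM2l t0 b1; nra.
have lE t : line (line z w a) (line z w b) t = line z w ((b - a) * t + a).
  by rewrite /line (rmorphD (real_complex R)) (rmorphM (real_complex R))
     (rmorphB (real_complex R)); ring.
have -> : line z w b - line z w a = (w - z) * (b - a)%:C.
  by rewrite /line (rmorphB (real_complex R)); ring.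
have gc : continuous_seg 1 (fun t => f (line (line z w a) (line z w b) t)).
  rewrite (_ : (fun t => _) = (fun t => f (line z w t)) \o (fun t => (b - a) * t + a)).
    move=> t t01; apply: continuous_comp; last exact: (fc _ (ab _ t01)).
    by apply: cvgD; [apply: cvgM; [exact: cvg_cst|exact: cvg_id]|exact: cvg_cst].
  by apply/funext => t; rewrite lE.
rewrite -mulrA; congr (_ * _); rewrite -(cintZ _ gc).
have gc' : continuous_seg 1 (fun t => ((b - a)%:C : C) * f (line (line z w a) (line z w b) t)).
  by apply: (continuous_segZ gc).
have dG' t : 0 <= t <= 1 -> curve_derive (fun t => G ((b - a) * t + a)) t
    ((b - a)%:C * f (line (line z w a) (line z w b) t)).
  by move=> t01; rewrite lE; apply: curve_derive_affine; exact: (dG _ (ab _ t01)).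
by rewrite (cint_FTC ltr01 gc' dG') mulr1 subrK mulr0 add0r.
Qed.

Lemma seg_rev r f z w : disc_continuous r f -> modulus z < r -> modulus w < r ->
  seg f w z = - seg f z w.
Proof.
move=> fc zr wr; have gc := disc_continuous_line fc zr wr.
have [G dG] := curve_primitive gc.
have h0 : 0 <= (0 : R) <= 1 by rewrite lexx ler01.
have h1 : 0 <= (1 : R) <= 1 by rewrite ler01 lexx.
have := seg_sub gc dG h0 h1; have := seg_sub gc dG h1 h0.
rewrite line0 line1 => -> ->; ring.
Qed.

Definition mid (z w : C) : C := line z w 2^-1.

Lemma half01 : 0 <= (2^-1 : R) <= 1.
Proof. by apply/andP; split; lra. Qed.

Lemma seg_mid r f z w : disc_continuous r f -> modulus z < r -> modulus w < r ->
  seg f z w = seg f z (mid z w) + seg f (mid z w) w.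
Proof.
move=> fc zr wr; have gc := disc_continuous_line fc zr wr.
have [G dG] := curve_primitive gc.
have h0 : 0 <= (0 : R) <= 1 by rewrite lexx ler01.
have h1 : 0 <= (1 : R) <= 1 by rewrite ler01 lexx.
have := seg_sub gc dG h0 h1; have := seg_sub gc dG h0 half01.
have := seg_sub gc dG half01 h1.
rewrite line0 line1 -/(mid z w) => -> -> ->; ring.
Qed.

(** The affine function [c + d * (x - p)] has the primitive [c * x + d / 2 * (x - p) ^+ 2], so its
    exact integral splits off; these differences cancel around a closed polygon and only the error
    remains. *)
Lemma seg_near (f : C -> C) (c d p z w : C) (M : R) :
  continuous_seg 1 (fun t => f (line z w t)) ->
  (forall t : R, 0 <= t <= 1 ->
     modulus (f (line z w t) - (c + d * (line z w t - p))) <= M) ->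
  modulus (seg f z w - ((c * w + d / 2 * (w - p) ^+ 2) - (c * z + d / 2 * (z - p) ^+ 2)))
    <= 2 * M * modulus (w - z).
Proof.
move=> fc fM.
pose A t := c + d * (line z w t - p).
have lc : continuous_seg 1 (line z w) by exact: continuous_seg_line.
have Ac : continuous_seg 1 A.
  apply: (continuous_segD (@continuous_seg_cst _ _ _ c)); apply: continuous_segZ.
  exact: (continuous_segD lc (@continuous_seg_cst _ _ _ (- p))).
have AE : (w - z) * cint 1 A =
    (c * w + d / 2 * (w - p) ^+ 2) - (c * z + d / 2 * (z - p) ^+ 2).
  have Ac' : continuous_seg 1 (fun t => (w - z) * A t).
    exact: (continuous_segZ Ac).
  rewrite -(cintZ _ Ac).
  have dG t : 0 <= t <= 1 -> curve_derive (fun t => c * line z w t +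
      d / 2 * ((line z w t - p) * (line z w t - p))) t ((w - z) * A t).
    move=> t01; have L := curve_derive_line z w t.
    have Lp := curve_deriveD L (curve_derive_cst (- p) t).
    have := curve_deriveD (curve_deriveZ c L) (curve_deriveZ (d / 2) (curve_deriveM Lp Lp)).
    by congr (curve_derive _ _ _); rewrite /A; field.
  by rewrite (cint_FTC ltr01 Ac' dG) line0 line1 !expr2.
rewrite -AE /seg -mulrBr modulusM mulrC ler_wpM2r ?modulus_ge0//.
have -> : cint 1 (fun t => f (line z w t)) - cint 1 A =
    cint 1 (fun t => f (line z w t) + - 1 * A t).
  by rewrite (cintD fc (@continuous_segZ _ _ (- 1) _ Ac)) (cintZ _ Ac) mulN1r.
have gM t : 0 <= t <= 1 -> modulus (f (line z w t) + - 1 * A t) <= M.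
  by move=> /fM; rewrite mulN1r.
have := cint_le ler01 (continuous_segD fc (@continuous_segZ _ _ (- 1) _ Ac)) gM.
by rewrite mulr1.
Qed.

End Goursat.

(** * Goursat's theorem for triangles and primitives on a disc *)

Section Primitive.
Variable R : realType.
Local Notation C := (Cplx R).
Local Notation re := (@complex.Re R).
Local Notation im := (@complex.Im R).

Lemma geometric_limit (x : nat -> R) (d : R) :
  (forall n, `|x n.+1 - x n| <= d / 2 ^+ n) ->
  exists l : R, forall n, `|x n - l| <= 2 * (d / 2 ^+ n).
Proof.
(* [u n] is the sum of the geometric bounds from index [n] on. Hence [x n - u n] increases and
   [x n + u n] decreases, and the supremum of the former lies below all of the latter. *)
move=> xd; pose u n := 2 * (d / 2 ^+ n).
have uS n : u n = u n.+1 + d / 2 ^+ n by rewrite /u exprS; field.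
pose y n := x n - u n; pose z n := x n + u n.
have d0 n : 0 <= d / 2 ^+ n by apply: le_trans (xd n).
have u0 n : 0 <= u n by rewrite mulr_ge0.
have yS n : y n <= y n.+1.
  by have := xd n; rewrite ler_norml /y (uS n) => /andP[]; lra.
have zS n : z n.+1 <= z n.
  by have := xd n; rewrite ler_norml /z (uS n) => /andP[]; lra.
have ynd m n : (m <= n)%N -> y m <= y n.
  by move=> mn; have /nondecreasing_seqP H := yS; exact: H.
have znd m n : (m <= n)%N -> z n <= z m.
  by move=> mn; have /nonincreasing_seqP H := zS; exact: H.
have yz m n : y m <= z n.
  apply: le_trans (ynd m (maxn m n) (leq_maxl _ _)) _.
  apply: le_trans (znd n (maxn m n) (leq_maxr _ _)).
  by rewrite /y /z lerD2l; have := u0 (maxn m n); lra.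
pose S := range y.
have hS : has_sup S by split; [exists (y 0%N), 0%N|exists (z 0%N) => _ [n _ <-]].
exists (sup S) => n.
have H1 : y n <= sup S by apply: (sup_upper_bound hS); exists n.
have H2 : sup S <= z n by apply: ge_sup; [exact: hS.1|move=> _ [m _ <-]].
by move: H1 H2; rewrite /y /z ler_norml -/(u n) => H1 H2; apply/andP; split; lra.
Qed.

Lemma geometric_limitC (x : nat -> C) (d : R) :
  (forall n, modulus (x n.+1 - x n) <= d / 2 ^+ n) ->
  exists l : C, forall n, modulus (x n - l) <= 4 * (d / 2 ^+ n).
Proof.
move=> xd.
have [n|l1 H1] := @geometric_limit (re \o x) d.
  by rewrite /= -reB; apply: le_trans (re_le _) _.
have [n|l2 H2] := @geometric_limit (im \o x) d.
  by rewrite /= -imB; apply: le_trans (im_le _) _.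
exists (l1 +i* l2) => n; apply: le_trans (modulus_le _) _.
rewrite reB imB /=; have := H1 n; have := H2 n; rewrite /=; lra.
Qed.

Definition disc_holomorphic (r : R) (f : C -> C) :=
  forall z, modulus z < r -> derivable f z 1.

Lemma disc_holomorphic_continuous r f :
  disc_holomorphic r f -> disc_continuous r f.
Proof. by move=> fh z /fh/derivable_continuous. Qed.

Definition tri (f : C -> C) (a b c : C) := seg f a b + seg f b c + seg f c a.

Lemma midE (z w : C) : mid z w = (z + w) / 2.
Proof. by rewrite /mid /line fmorphV rmorph_nat; field. Qed.

Lemma mid_lt (z w : C) r : modulus z < r -> modulus w < r -> modulus (mid z w) < r.
Proof. by move=> zr wr; apply: line_lt => //; exact: half01. Qed.

Lemma tri_split r f a b c : disc_continuous r f ->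
  modulus a < r -> modulus b < r -> modulus c < r ->
  tri f a b c = tri f a (mid a b) (mid c a) + tri f (mid a b) b (mid b c)
    + tri f (mid c a) (mid b c) c + tri f (mid a b) (mid b c) (mid c a).
Proof.
move=> fc ar br cr; rewrite /tri.
have mab := mid_lt ar br; have mbc := mid_lt br cr; have mca := mid_lt cr ar.
rewrite (seg_mid fc ar br) (seg_mid fc br cr) (seg_mid fc cr ar).
rewrite (seg_rev fc mab mbc) (seg_rev fc mbc mca) (seg_rev fc mca mab).
ring.
Qed.

(** [rho] keeps the vertices, hence the sides, inside the disc; [d] bounds the side lengths and is
    halved at each bisection. *)
Definition small_tri (rho d : R) (T : C * C * C) : Prop :=
  [/\ modulus T.1.1 <= rho, modulus T.1.2 <= rho & modulus T.2 <= rho] /\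
  [/\ modulus (T.1.2 - T.1.1) <= d, modulus (T.2 - T.1.2) <= d & modulus (T.1.1 - T.2) <= d].

Lemma half_le (z w : C) d : modulus (z - w) <= d -> modulus ((z - w) / 2) <= d / 2.
Proof.
move=> zw; rewrite modulusM modulusV.
have -> : modulus (2 : C) = 2.
  by rewrite -[2 : C](rmorph_nat (real_complex R)) modulusR ger0_norm.
by rewrite ler_wpM2r// invr_ge0.
Qed.

Lemma modulus_le_distC (z w : C) d : modulus (z - w) <= d -> modulus (w - z) <= d.
Proof. by rewrite modulus_distC. Qed.

(** The four midpoint triangles add up to the given one, so one of them carries at least a quarter
    of the integral. The bound on the displacement of the first vertex makes the first vertices
    converge. *)
Lemma tri_bisect r rho f d (T : C * C * C) : rho < r -> disc_continuous r f ->
  small_tri rho d T ->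
  exists T', [/\ small_tri rho (d / 2) T',
    modulus (tri f T.1.1 T.1.2 T.2) <= 4 * modulus (tri f T'.1.1 T'.1.2 T'.2) &
    modulus (T'.1.1 - T.1.1) <= d].
Proof.
case: T => -[a b] c rr fc [[/= ar br cr] [ab bc ca]].
have lt x : modulus x <= rho -> modulus x < r by move=> H; exact: le_lt_trans rr.
have d0 : 0 <= d := le_trans (modulus_ge0 _) ab.
have d2 : d / 2 <= d by lra.
have E := tri_split fc (lt _ ar) (lt _ br) (lt _ cr).
have mle x y : modulus x <= rho -> modulus y <= rho -> modulus (mid x y) <= rho.
  move=> xr yr; rewrite -[mid x y]subr0; apply: line_le; rewrite ?subr0//; exact: half01.
have mab := mle _ _ ar br; have mbc := mle _ _ br cr; have mca := mle _ _ cr ar.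
have hab := half_le ab; have hbc := half_le bc; have hca := half_le ca.
have hba := half_le (modulus_le_distC ab); have hcb := half_le (modulus_le_distC bc).
have hac := half_le (modulus_le_distC ca).
set t1 := tri f a (mid a b) (mid c a) in E.
set t2 := tri f (mid a b) b (mid b c) in E.
set t3 := tri f (mid c a) (mid b c) c in E.
set t4 := tri f (mid a b) (mid b c) (mid c a) in E.
have S : modulus (tri f a b c) <= modulus t1 + modulus t2 + modulus t3 + modulus t4.
  rewrite E; apply: le_trans (modulusD _ _) _; rewrite lerD2r.
  by apply: le_trans (modulusD _ _) _; rewrite lerD2r; exact: modulusD.
have [H|H1] := lerP (modulus (tri f a b c)) (4 * modulus t1).
  exists (a, mid a b, mid c a); split => //=; last first.
    by rewrite subrr modulus0.
  split; split => //=; rewrite !midE.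
  - by have -> : (a + b) / 2 - a = (b - a) / 2 by field.
  - by have -> : (c + a) / 2 - (a + b) / 2 = (c - b) / 2 by field.
  - by have -> : a - (c + a) / 2 = (a - c) / 2 by field.
have [H|H2] := lerP (modulus (tri f a b c)) (4 * modulus t2).
  exists (mid a b, b, mid b c); split => //=; last first.
    rewrite midE; have -> : (a + b) / 2 - a = (b - a) / 2 by field.
    exact: le_trans hab d2.
  split; split => //=; rewrite !midE.
  - by have -> : b - (a + b) / 2 = (b - a) / 2 by field.
  - by have -> : (b + c) / 2 - b = (c - b) / 2 by field.
  - by have -> : (a + b) / 2 - (b + c) / 2 = (a - c) / 2 by field.
have [H|H3] := lerP (modulus (tri f a b c)) (4 * modulus t3).
  exists (mid c a, mid b c, c); split => //=; last first.
    rewrite midE; have -> : (c + a) / 2 - a = (c - a) / 2 by field.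
    exact: le_trans hac d2.
  split; split => //=; rewrite !midE.
  - by have -> : (b + c) / 2 - (c + a) / 2 = (b - a) / 2 by field.
  - by have -> : c - (b + c) / 2 = (c - b) / 2 by field.
  - by have -> : (c + a) / 2 - c = (a - c) / 2 by field.
exists (mid a b, mid b c, mid c a); split => /=; last first.
- rewrite midE; have -> : (a + b) / 2 - a = (b - a) / 2 by field.
  exact: le_trans hab d2.
- by rewrite -/t4; lra.
split; split => //=; rewrite !midE.
- by have -> : (b + c) / 2 - (a + b) / 2 = (c - a) / 2 by field.
- by have -> : (c + a) / 2 - (b + c) / 2 = (a - b) / 2 by field.
- by have -> : (a + b) / 2 - (c + a) / 2 = (b - c) / 2 by field.
Qed.

(* Bisection: a nested sequence of triangles each carrying at least a quarter of
   the previous integral shrinks to a point p, where f is affine up to o(|z-p|). *)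
Lemma goursat r f a b c : disc_holomorphic r f ->
  modulus a < r -> modulus b < r -> modulus c < r -> tri f a b c = 0.
Proof.
move=> fh ar br cr; have fc := disc_holomorphic_continuous fh.
pose rho := Num.max (modulus a) (Num.max (modulus b) (modulus c)).
have rr : rho < r by rewrite /rho !gt_max ar br cr.
pose d := modulus (b - a) + modulus (c - b) + modulus (a - c).
have d0 : 0 <= d by rewrite !addr_ge0 ?modulus_ge0.
(* The condition on the triangle is put inside the existential, so that the choice function is total
   and can be iterated. *)
have [next nextP] : exists g : (C * C * C) * R -> C * C * C, forall x,
    small_tri rho x.2 x.1 -> [/\ small_tri rho (x.2 / 2) (g x),
      modulus (tri f x.1.1.1 x.1.1.2 x.1.2) <=
        4 * modulus (tri f (g x).1.1 (g x).1.2 (g x).2) &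
      modulus ((g x).1.1 - x.1.1.1) <= x.2].
  suff /choice[g Hg] : forall x : (C * C * C) * R, exists T',
      small_tri rho x.2 x.1 -> [/\ small_tri rho (x.2 / 2) T',
      modulus (tri f x.1.1.1 x.1.1.2 x.1.2) <= 4 * modulus (tri f T'.1.1 T'.1.2 T'.2) &
      modulus (T'.1.1 - x.1.1.1) <= x.2] by exists g.
  move=> [T e]; have [H|H] := pselect (small_tri rho e T); last by exists T.
  by have [T' HT] := tri_bisect rr fc H; exists T'.
pose T := fix T n := if n is n'.+1 then next (T n', d / 2 ^+ n') else (a, b, c).
have TP n : small_tri rho (d / 2 ^+ n) (T n).
  elim: n => [|n IH]; last first.
    have [H _ _] := nextP (T n, d / 2 ^+ n) IH.
    by have -> : d / 2 ^+ n.+1 = d / 2 ^+ n / 2 by rewrite exprS; field.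
  rewrite expr0 divr1; split; split => /=.
  - by rewrite /rho le_max lexx.
  - by rewrite /rho !le_max lexx orbT.
  - by rewrite /rho !le_max lexx !orbT.
  - by rewrite /d -addrA lerDl addr_ge0 ?modulus_ge0.
  - by rewrite /d addrAC lerDr addr_ge0 ?modulus_ge0.
  - by rewrite /d lerDr addr_ge0 ?modulus_ge0.
have Tm n : modulus (tri f a b c) <= 4 ^+ n *
    modulus (tri f (T n).1.1 (T n).1.2 (T n).2).
  elim: n => [|n IH]; first by rewrite expr0 mul1r.
  apply: le_trans IH _; rewrite exprSr -mulrA ler_wpM2l ?exprn_ge0//.
  by have [_ H _] := nextP (T n, d / 2 ^+ n) (TP n).
have [p Hp] : exists p, forall n, modulus ((T n).1.1 - p) <= 4 * (d / 2 ^+ n).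
  apply: (geometric_limitC (x := fun n => (T n).1.1)) => n.
  by have [_ _ H] := nextP (T n, d / 2 ^+ n) (TP n).
have small e : 0 < e -> exists n, d / 2 ^+ n < e.
  move=> e0; have := @cvg_geometric R d 2^-1.
  have -> : `|2^-1 : R| < 1 by rewrite ger0_norm; lra.
  move=> /(_ isT)/cvgrPdist_lt/(_ _ e0)[n _ /(_ n (leqnn n))].
  rewrite /geometric/= sub0r normrN exprVn ger0_norm; last first.
    by rewrite divr_ge0// exprn_ge0.
  by exists n.
(* The limit point stays in the open disc because the vertices have modulus at most [rho < r] and
   approach it. *)
have pr : modulus p < r.
  have [|n Hn] := small ((r - rho) / 4); first by rewrite divr_gt0// subr_gt0.
  rewrite -(subrK (T n).1.1 p); apply: le_lt_trans (modulusD _ _) _.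
  have := Hp n; rewrite modulus_distC; have [[+ _ _] _] := TP n; lra.
apply/eqP; rewrite -modulus_eq0; apply/eqP/le_anti; rewrite modulus_ge0 andbT.
apply/ler_addgt0Pl => e e0; rewrite addr0.
(* Each side contributes at most [2 * (e1 * (5 * dn)) * dn], the three sides [30 * e1 * dn ^+ 2],
   and [4 ^+ n * dn ^+ 2 = d ^+ 2]. The [+ 1] covers a triangle reduced to a point. *)
pose e1 := e / (30 * d ^+ 2 + 1).
have D0 : 0 < 30 * d ^+ 2 + 1 by rewrite ltr_wpDl// mulr_ge0// sqr_ge0.
have e10 : 0 < e1 by rewrite divr_gt0.
have /is_deriveC/(_ _ e10)/nbhs_modulusP[dl dl0 Hdl] := derivable_is_derive (fh _ pr).
(* The first vertex is within [4 * dn] of [p] and the others within [dn] of it, so the triangle lies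
   in the disc of radius [5 * dn] about [p]. *)
have [|n Hn] := small (dl / 5); first by rewrite divr_gt0.
set dn := d / 2 ^+ n in Hn.
have dn0 : 0 <= dn by rewrite divr_ge0// exprn_ge0.
have [[xr yr zr] [xy yz zx]] := TP n.
have xp := Hp n; rewrite -/dn in xp xy yz zx.
set x := (T n).1.1 in xr xy zx xp; set y := (T n).1.2 in yr xy yz.
set z := (T n).2 in zr yz zx.
have yp : modulus (y - p) <= 5 * dn.
  by rewrite -(subrK x y) -addrA; apply: le_trans (modulusD _ _) _; lra.
have zp : modulus (z - p) <= 5 * dn.
  rewrite -(subrK x z) -addrA; apply: le_trans (modulusD _ _) _.
  by rewrite modulus_distC; lra.
have {}xp : modulus (x - p) <= 5 * dn by lra.
have K (u v : C) : modulus u <= rho -> modulus v <= rho ->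
    modulus (u - p) <= 5 * dn -> modulus (v - p) <= 5 * dn -> modulus (v - u) <= dn ->
    exists2 k : C, modulus k <= 10 * e1 * dn ^+ 2 &
    seg f u v = (f p * v + derive1 f p / 2 * (v - p) ^+ 2)
      - (f p * u + derive1 f p / 2 * (u - p) ^+ 2) + k.
  move=> ur vr up vp uv.
  have ur' := le_lt_trans ur rr; have vr' := le_lt_trans vr rr.
  exists (seg f u v - ((f p * v + derive1 f p / 2 * (v - p) ^+ 2)
      - (f p * u + derive1 f p / 2 * (u - p) ^+ 2))); last by rewrite addrC subrK.
  have M t : 0 <= t <= 1 -> modulus (f (line u v t) -
      (f p + derive1 f p * (line u v t - p))) <= e1 * (5 * dn).
    move=> t01; have L := line_le t01 up vp.
    rewrite opprD addrA; apply: le_trans (Hdl _ _) _; first by lra.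
    by rewrite ler_pM2l.
  apply: le_trans (seg_near (disc_continuous_line fc ur' vr') M) _.
  have -> : 10 * e1 * dn ^+ 2 = 2 * (e1 * (5 * dn)) * dn by ring.
  by apply: ler_wpM2l => //; apply: mulr_ge0 => //; apply: mulr_ge0; [exact: ltW|exact: mulr_ge0].
have [k1 k1m E1] := K _ _ xr yr xp yp xy.
have [k2 k2m E2] := K _ _ yr zr yp zp yz.
have [k3 k3m E3] := K _ _ zr xr zp xp zx.
have E : tri f x y z = k1 + k2 + k3 by rewrite /tri E1 E2 E3; ring.
apply: le_trans (Tm n) _; rewrite -/x -/y -/z E.
have : modulus (k1 + k2 + k3) <= 30 * e1 * dn ^+ 2.
  apply: le_trans (modulusD _ _) _.
  have := modulusD k1 k2; lra.
have p4 : 0 <= (4 : R) ^+ n by rewrite exprn_ge0.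
move=> /(ler_wpM2l p4) /le_trans; apply.
have -> : 4 ^+ n * (30 * e1 * dn ^+ 2) = 30 * d ^+ 2 * e1.
  rewrite /dn expr_div_n -exprM mulnC exprM.
  have -> : (2 : R) ^+ 2 = 4 by ring.
  by field; rewrite expf_neq0.
rewrite /e1 mulrA ler_pdivrMr// mulrC ler_wpM2l ?(ltW e0)//; lra.
Qed.

(** Goursat's theorem for the triangle 0, z, w identifies the increment of [seg f 0] with the
    integral of [f] over [z, w]; continuity of [f] at z then gives the derivative. [seg_near] is
    used with [d = 0]. *)
Lemma primitive_derive r f z : disc_holomorphic r f -> modulus z < r ->
  is_derive z 1 (seg f 0) (f z).
Proof.
move=> fh zr; have fc := disc_holomorphic_continuous fh.
have r0 : modulus (0 : C) < r by rewrite modulus0; exact: le_lt_trans (modulus_ge0 z) zr.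
apply/is_deriveC => e e0.
have e2 : 0 < e / 2 by rewrite divr_gt0.
have /cvg_modulusP/(_ _ e2)/nbhs_modulusP[d d0 Hd] := fc _ zr.
apply/nbhs_modulusP; exists (Num.min d (r - modulus z)); first by rewrite lt_min d0 subr_gt0.
move=> w; rewrite lt_min => /andP[wd wr].
have {}wr : modulus w < r.
  rewrite -(subrK z w); apply: le_lt_trans (modulusD _ _) _; lra.
have := goursat fh r0 zr wr; rewrite /tri (seg_rev fc r0 wr) => E.
have -> : seg f 0 w - seg f 0 z = seg f z w.
  have -> : seg f z w = (seg f 0 z + seg f z w - seg f 0 w) + (seg f 0 w - seg f 0 z).
    by ring.
  by rewrite E add0r.
have M t : 0 <= t <= 1 -> modulus (f (line z w t) - (f z + 0 * (line z w t - 0))) <= e / 2.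
  move=> t01; rewrite mul0r addr0; apply/ltW/Hd.
  apply: le_lt_trans wd; apply: line_le => //.
  by rewrite subrr modulus0 modulus_ge0.
have := seg_near (disc_continuous_line fc zr wr) M.
have -> : 2 * (e / 2) = e by field.
by rewrite !mul0r !addr0 -mulrBr.
Qed.

End Primitive.

(** * Differentiation under the integral and integrals over circles *)

Section CauchySmooth.
Variable R : realType.
Local Notation C := (Cplx R).
Local Notation re := (@complex.Re R).
Local Notation im := (@complex.Im R).
Local Notation mu := (@lebesgue_measure R).

Lemma is_derive_Rintegral_under (b u v x M : R) (f df : R -> R -> R) :
  u < x < v -> 0 <= b ->
  (forall x, u < x < v -> continuous_seg b (f x)) ->
  (forall x t, u < x < v -> 0 <= t <= b -> is_derive x 1 (f ^~ t) (df x t)) ->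
  (forall x t, u < x < v -> 0 <= t <= b -> `|df x t| <= M) ->
  is_derive x 1 (fun x => \int[mu]_(t in `[0, b]) f x t)
    (\int[mu]_(t in `[0, b]) df x t).
Proof.
move=> xuv b0 fc dfE dfM.
have mB : measurable (`[0, b] : set (measurableTypeR R)) by exact: measurable_itv.
have Ia : (`]u, v[ : set R) x by rewrite /= in_itv.
have intf y : (`]u, v[ : set R) y -> mu.-integrable `[0, b] (EFin \o f y).
  by rewrite /= in_itv/= => /fc/continuous_seg_integrable.
have der y t : (`]u, v[ : set R) y -> (`[0, b] : set R) t -> derivable (f ^~ t) y 1.
  by rewrite /= !in_itv/= => yuv tb; have [] := dfE _ _ yuv tb.
have dE y t : u < y < v -> 0 <= t <= b -> partial1of2 f y t = df y t.
  by move=> yuv tb; rewrite partial1of2E; apply: derive_val; exact: dfE.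
have M0 : 0 <= M.
  by apply: le_trans (dfM x 0 xuv _) => //; rewrite lexx.
have G0 (t : R) : 0 <= (fun _ : R => M) t by [].
have iG : mu.-integrable `[0, b] (EFin \o (fun _ : R => M)).
  exact/continuous_seg_integrable/continuous_seg_cst.
have bnd y t : (`]u, v[ : set R) y -> (`[0, b] : set R) t ->
    `|partial1of2 f y t| <= (fun _ : R => M) t.
  by rewrite /= !in_itv/= => yuv tb; rewrite dE//; exact: dfM.
have D := derivable_under_integral mB Ia intf der G0 iG bnd.
have E := differentiation_under_integral mB Ia intf der G0 iG bnd.
apply: DeriveDef; first exact D.
rewrite -derive1E E; apply: eq_Rintegral => t; rewrite inE/= in_itv/= => tb.
exact: dE.
Qed.

Lemma curve_cint_under (b u v x M : R) (f df : R -> R -> C) :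
  u < x < v -> 0 <= b ->
  (forall x, u < x < v -> continuous_seg b (f x)) ->
  (forall x t, u < x < v -> 0 <= t <= b -> curve_derive (f ^~ t) x (df x t)) ->
  (forall x t, u < x < v -> 0 <= t <= b -> modulus (df x t) <= M) ->
  curve_derive (fun x => cint b (f x)) x (cint b (df x)).
Proof.
move=> xuv b0 fc dfE dfM; split.
  apply: (@is_derive_Rintegral_under b u v x M (fun x t => re (f x t))
    (fun x t => re (df x t))) => //.
  - by move=> y /fc/continuous_seg_re.
  - by move=> y t yuv tb; have [] := dfE _ _ yuv tb.
  - by move=> y t yuv tb; apply: le_trans (re_le _) (dfM _ _ yuv tb).
apply: (@is_derive_Rintegral_under b u v x M (fun x t => im (f x t))
  (fun x t => im (df x t))) => //.
- by move=> y /fc/continuous_seg_im.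
- by move=> y t yuv tb; have [] := dfE _ _ yuv tb.
- by move=> y t yuv tb; apply: le_trans (im_le _) (dfM _ _ yuv tb).
Qed.

(** The mean value theorem on each component; [u] and [v] leave room for two-sided derivatives at 0
    and 1. *)
Lemma curve_derive0_cst (H : R -> C) (u v : R) :
  u < 0 -> 1 < v -> (forall x, u < x < v -> curve_derive H x 0) -> H 1 = H 0.
Proof.
move=> u0 v1 dH.
have itv (x : R) : x \in `[0, 1]%R -> u < x < v.
  by rewrite in_itv/= => /andP[x0 x1]; rewrite (lt_le_trans u0 x0) (le_lt_trans x1 v1).
have Z (h : R -> R) : (forall x, u < x < v -> is_derive x 1 h 0) -> h 1 = h 0.
  move=> dh.
  have dh' (x : R) : x \in `]0, 1[%R -> is_derive x 1 h ((fun=> 0) x).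
    by move=> /subset_itv_oo_cc/itv/dh.
  have hc : {within `[0, 1], continuous h}.
    apply: continuous_in_subspaceT => x; rewrite inE => /itv/dh[+ _].
    by move=> /derivable1_diffP/differentiable_continuous.
  have [c _] := MVT_segment ler01 dh' hc.
  by rewrite mul0r => /eqP; rewrite subr_eq0 => /eqP.
have E1 := Z (re \o H) (fun x xuv => (dH x xuv).1).
have E2 := Z (im \o H) (fun x xuv => (dH x xuv).2).
by apply/eqP; rewrite eq_complex; apply/andP; split; apply/eqP; [exact: E1|exact: E2].
Qed.

Lemma closed_disc_compact (r : R) : compact [set z : C | modulus z <= r].
Proof.
pose Q := (fun x : R * R => (x.1 +i* x.2 : C)) @` (`[- r, r] `*` `[- r, r]).
apply: (@subclosed_compact _ _ Q).
- have -> : [set z : C | modulus z <= r] = (@modulus R) @^-1` `]-oo, r].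
    by apply/seteqP; split=> z; rewrite /= in_itv.
  apply: preimage_closed => [z _|]; first exact: continuous_modulus.
  exact: interval_closed.
- apply: continuous_compact; last by apply: compact_setX; exact: segment_compact.
  apply: continuous_subspaceT => x.
  by apply: cvg_complex; [exact: cvg_fst|exact: cvg_snd].
- move=> z /= zr; exists (re z, im z); last by case: z {zr}.
  by split; rewrite /= in_itv/= -ler_norml; apply: le_trans zr; [exact: re_le|exact: im_le].
Qed.

Lemma disc_bounded (f : C -> C) (rho r : R) : 0 <= rho -> rho < r -> disc_continuous r f ->
  exists2 M, 0 <= M & forall z, modulus z <= rho -> modulus (f z) <= M.
Proof.
move=> rho0 rr fc.
have ne : [set z : C | modulus z <= rho] !=set0.
  by exists (0 : C); change (modulus (0 : C) <= rho); rewrite modulus0.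
have fc' : {within [set z : C | modulus z <= rho], continuous (fun z => modulus (f z))}.
  apply: continuous_in_subspaceT => z; rewrite inE/= => zr.
  apply: continuous_comp; first by apply: fc; exact: le_lt_trans rr.
  exact: continuous_modulus.
have [c _ H] := compact_EVT_max ne (@closed_disc_compact rho) fc'.
exists (modulus (f c)); first exact: modulus_ge0.
by move=> z zr; apply: H; rewrite inE.
Qed.

Lemma twopi_gt0 : 0 < 2 * pi :> R.
Proof. by rewrite mulr_gt0// pi_gt0. Qed.

Lemma continuous_seg_circ b (r : R) : continuous_seg b (circ r).
Proof. by move=> t _; exact: curve_continuous (curve_derive_circ r t). Qed.

Lemma closed_curve_int (f d : C -> C) (g v : R -> C) :
  g 0 = g (2 * pi) ->
  (forall t : R, 0 <= t <= 2 * pi -> curve_derive g t (v t)) ->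
  (forall t : R, 0 <= t <= 2 * pi -> is_derive (g t) 1 f (d (g t))) ->
  continuous_seg (2 * pi) (fun t => d (g t) * v t) ->
  cint (2 * pi) (fun t => d (g t) * v t) = 0.
Proof.
move=> g0 dg df cd.
rewrite (cint_FTC twopi_gt0 cd (G := f \o g)) ?g0 ?subrr// /= ?g0 ?subrr// => t tb.
by apply: curve_derive_comp; [exact: df|exact: dg].
Qed.

Lemma is_derive_expr (n : nat) (z : C) :
  is_derive z 1 (fun x : C => x ^+ n) (n%:R * z ^+ n.-1).
Proof.
apply: DeriveDef; first exact: exprn_derivable.
by rewrite exp_derive -[_ *: 1]/(_ * 1) mulr1.
Qed.

Lemma is_derive_comp (f g : C -> C) (z a b : C) :
  is_derive (g z) 1 f a -> is_derive z 1 g b -> is_derive z 1 (f \o g) (a * b).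
Proof.
move=> df dg; have gc := is_derive_continuous dg.
move/is_deriveC : dg => dg; move/is_deriveC : df => df.
apply/is_deriveC => e e0.
pose M := modulus a + 1; pose e1 := e / 2 / M; pose e2 := e / 2 / (modulus b + 1).
have M0 : 0 < M by rewrite /M ltr_wpDl// modulus_ge0.
have v0 : 0 < modulus b + 1 by rewrite ltr_wpDl// modulus_ge0.
have e10 : 0 < e1 by rewrite !divr_gt0.
have e20 : 0 < e2 by rewrite !divr_gt0.
have H1 := dg _ e10; have H2 := gc _ (df _ e20); have H3 := dg _ (ltr01 : 0 < (1 : R)).
near=> s.
have A1 : modulus (g s - g z - b * (s - z)) <= e1 * modulus (s - z) by near: s.
have A2 : modulus (f (g s) - f (g z) - a * (g s - g z)) <= e2 * modulus (g s - g z).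
  by near: s; exact: H2.
have A3 : modulus (g s - g z - b * (s - z)) <= 1 * modulus (s - z) by near: s.
have A4 : modulus (g s - g z) <= (modulus b + 1) * modulus (s - z).
  rewrite mulrDl -(subrK (b * (s - z)) (g s - g z)) addrC.
  by apply: (le_trans (modulusD _ _)); rewrite lerD// modulusM.
have -> : (f \o g) s - (f \o g) z - a * b * (s - z) =
    (f (g s) - f (g z) - a * (g s - g z)) + a * (g s - g z - b * (s - z)).
  by rewrite /=; ring.
apply: (le_trans (modulusD _ _)); rewrite (splitr e) mulrDl lerD//.
  apply: (le_trans A2); rewrite /e2 -mulrA ler_wpM2l//.
    by rewrite divr_ge0 ?ltW.
  by rewrite mulrC ler_pdivrMr// mulrC.
rewrite modulusM; apply: le_trans (_ : M * (e1 * modulus (s - z)) <= _).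
  by rewrite ler_pM// ?modulus_ge0// /M lerDl.
by rewrite mulrA /e1 mulrCA mulfV ?mulr1// gt_eqF.
Unshelve. all: by end_near. Qed.

Lemma is_derive_inv (f : C -> C) (z d : C) : f z != 0 -> is_derive z 1 f d ->
  is_derive z 1 (fun x => (f x)^-1) (- (f z)^-1 ^+ 2 * d).
Proof.
move=> fz0 [df <-]; apply: DeriveDef; first exact: derivableV.
by rewrite deriveV// -[_ *: _]/(_ * _) exprVn.
Qed.

(** Up to the nonzero factor [n * 'i], the integrand is the derivative along the circle of
    [circ r t ^+ n] itself, which closes up. *)
Lemma cint_circX (r : R) n : (0 < n)%N -> cint (2 * pi) (fun t => circ r t ^+ n) = 0.
Proof.
case: n => // n _.
have c : continuous_seg (2 * pi) (circ r) by exact: continuous_seg_circ.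
have cn : continuous_seg (2 * pi) (fun t => circ r t ^+ n.+1) by exact: continuous_segX.
have := @closed_curve_int (fun z => z ^+ n.+1) (fun z => n.+1%:R * z ^+ n) (circ r)
   (fun t => 'i * circ r t) _ (fun t _ => curve_derive_circ r t) (fun t _ => is_derive_expr _ _) _.
rewrite circ0 circ2pi => /(_ erefl).
have -> : (fun t => n.+1%:R * circ r t ^+ n * ('i * circ r t)) =
    (fun t => (n.+1%:R * 'i : C) * circ r t ^+ n.+1).
  by apply/funext => t; rewrite exprS; ring.
move=> /(_ (continuous_segZ cn)); rewrite (cintZ _ cn) => /eqP.
rewrite !mulf_eq0 pnatr_eq0/= => /orP[|/eqP//].
by rewrite eq_complex/= oner_eq0 andbF.
Qed.

Lemma cint_circVX (r : R) n : 0 < r -> (0 < n)%N ->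
  cint (2 * pi) (fun t => (circ r t)^-1 ^+ n) = 0.
Proof.
move=> r0; case: n => // n _.
have c : continuous_seg (2 * pi) (circ r) by exact: continuous_seg_circ.
have c' : continuous_seg (2 * pi) (fun t => (circ r t)^-1).
  by apply: continuous_segV => // t _; exact: circ_neq0.
have cn : continuous_seg (2 * pi) (fun t => (circ r t)^-1 ^+ n.+1) by exact: continuous_segX.
have dE (z : C) : z != 0 -> is_derive z 1 (fun z => z^-1 ^+ n.+1)
    ((n.+1%:R * z^-1 ^+ n) * (- z^-1 ^+ 2 * 1)).
  move=> z0; apply: (is_derive_comp (f := fun x => x ^+ n.+1)).
    exact: is_derive_expr.
  exact: (is_derive_inv (f := fun x => x)).
have := @closed_curve_int (fun z => z^-1 ^+ n.+1)
   (fun z => (n.+1%:R * z^-1 ^+ n) * (- z^-1 ^+ 2 * 1)) (circ r)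
   (fun t => 'i * circ r t) _ (fun t _ => curve_derive_circ r t)
   (fun t _ => dE _ (circ_neq0 t r0)) _.
rewrite circ0 circ2pi => /(_ erefl).
have -> : (fun t => n.+1%:R * (circ r t)^-1 ^+ n * (- (circ r t)^-1 ^+ 2 * 1) * ('i * circ r t)) =
    (fun t => (- n.+1%:R * 'i : C) * (circ r t)^-1 ^+ n.+1).
  by apply/funext => t; rewrite [in RHS]exprS; field; exact: circ_neq0.
move=> /(_ (continuous_segZ cn)); rewrite (cintZ _ cn) => /eqP.
rewrite !mulf_eq0 oppr_eq0 pnatr_eq0/= => /orP[|/eqP//].
by rewrite eq_complex/= oner_eq0 andbF.
Qed.

End CauchySmooth.

(** * Cauchy's integral formula for C^1 functions *)

Section CauchyFormula.
Variable R : realType.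
Local Notation C := (Cplx R).
Local Notation re := (@complex.Re R).
Local Notation im := (@complex.Im R).
Local Notation mu := (@lebesgue_measure R).

Lemma circ_sub_neq0 (r t : R) (z : C) : modulus z < r -> circ r t - z != 0.
Proof.
move=> zr; apply/eqP => /eqP; rewrite subr_eq0 => /eqP E.
have := zr; rewrite -E modulus_circ ?ltxx//.
exact: ltW (le_lt_trans (modulus_ge0 z) zr).
Qed.

(** This is d zeta / (zeta - z) on the circle, divided by i dphi; the total mass is therefore 2 pi
    and not 2 pi i. *)
Definition cauchy_ker (r : R) (z : C) (t : R) : C := circ r t / (circ r t - z).

Lemma continuous_cauchy_ker b (r : R) (z : C) : modulus z < r -> continuous_seg b (cauchy_ker r z).
Proof.
move=> zr; apply: continuous_segM; first exact: continuous_seg_circ.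
apply: continuous_segV => [|t _]; last exact: circ_sub_neq0.
by apply: (continuous_segD _ (@continuous_seg_cst _ _ _ (- z))); exact: continuous_seg_circ.
Qed.

Lemma continuous_circV b (r : R) : 0 < r -> continuous_seg b (fun t => (circ r t)^-1).
Proof.
move=> r0; apply: continuous_segV => [|t _]; first exact: continuous_seg_circ.
exact: circ_neq0.
Qed.

Lemma cauchy_kerS (r : R) (z : C) t : modulus z < r ->
  cauchy_ker r z t = 1 + z * ((circ r t)^-1 * cauchy_ker r z t).
Proof.
move=> zr; have r0 : 0 < r := le_lt_trans (modulus_ge0 z) zr.
have n1 := circ_sub_neq0 t zr; have n2 := circ_neq0 t r0.
by rewrite /cauchy_ker; field; rewrite n1 n2.
Qed.

Lemma cauchy_ker_le (r : R) (z : C) t : modulus z < r ->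
  modulus (cauchy_ker r z t) <= r / (r - modulus z).
Proof.
move=> zr; have r0 : 0 < r := le_lt_trans (modulus_ge0 z) zr.
rewrite modulusM modulusV modulus_circ ?(ltW r0)// ler_wpM2l ?(ltW r0)//.
rewrite lef_pV2 ?posrE ?subr_gt0//; last by rewrite modulus_gt0 circ_sub_neq0.
rewrite -{1}(modulus_circ t (ltW r0)).
by rewrite lerBlDr; apply: le_trans (modulusD _ _); rewrite subrK.
Qed.

Lemma geometric_le0 (x M q : R) : 0 <= q < 1 -> 0 <= M ->
  (forall n, x <= M * q ^+ n) -> x <= 0.
Proof.
move=> /andP[q0 q1] M0 H; rewrite leNgt; apply/negP => x0.
have := @cvg_geometric R M q; rewrite ger0_norm// => /(_ q1)/cvgrPdist_lt/(_ _ x0).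
move=> [n _ /(_ n (leqnn n))]; rewrite /geometric/= sub0r normrN.
by rewrite ger0_norm ?mulr_ge0 ?exprn_ge0// ltNge H.
Qed.

(** Iterating [cauchy_kerS] expands the kernel in powers of z / zeta. All positive powers integrate
    to 0, and the remainder is of size (|z| / r)^n. *)
Lemma cint_cauchy_ker (r : R) (z : C) : modulus z < r ->
  cint (2 * pi) (cauchy_ker r z) = (2 * pi)%:C.
Proof.
move=> zr; have r0 : 0 < r := le_lt_trans (modulus_ge0 z) zr.
have Kc := @continuous_cauchy_ker (2 * pi) _ _ zr.
have Vc := @continuous_circV (2 * pi) _ r0.
have VKc n : continuous_seg (2 * pi) (fun t => (circ r t)^-1 ^+ n * cauchy_ker r z t).
  exact: (continuous_segM (continuous_segX Vc)).
have E n : cint (2 * pi) (cauchy_ker r z) = (2 * pi)%:C +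
    z ^+ n.+1 * cint (2 * pi) (fun t => (circ r t)^-1 ^+ n.+1 * cauchy_ker r z t).
  elim: n => [|n IH].
    rewrite expr1 -(cintZ _ (VKc 1%N)).
    rewrite (_ : cauchy_ker r z =
      (fun t => 1 + z * ((circ r t)^-1 ^+ 1 * cauchy_ker r z t))); last first.
      by apply/funext => t; rewrite expr1; exact: cauchy_kerS.
    rewrite (cintD (@continuous_seg_cst _ _ _ (1 : C)) (continuous_segZ (VKc 1%N))).
    rewrite (cint_cst _ (ltW (@twopi_gt0 R))) mul1r; congr (_ + _).
    by apply: eq_cint => t _; rewrite -cauchy_kerS.
  rewrite IH; congr (_ + _); rewrite [in RHS]exprSr -mulrA; congr (_ * _).
  rewrite -(cintZ _ (VKc n.+2)).
  have := cint_circVX r0 (ltn0Sn n) => H.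
  rewrite -[RHS]add0r -H -(cintD (continuous_segX Vc) (continuous_segZ (VKc n.+2))).
  apply: eq_cint => t _; rewrite [in LHS](cauchy_kerS t zr) (exprSr _ n.+1).
  by set V := _ ^+ n.+1; ring.
have r1 : 0 < r - modulus z by rewrite subr_gt0.
apply/eqP; rewrite -subr_eq0 -modulus_eq0; apply/eqP/le_anti; rewrite modulus_ge0 andbT.
apply: (@geometric_le0 _ (2 * (2 * pi) * (r / (r - modulus z))) (modulus z / r)).
- by rewrite divr_ge0 ?modulus_ge0 ?(ltW r0)//= ltr_pdivrMr// mul1r.
- by apply: mulr_ge0; [exact: mulr_ge0 (ltW (@twopi_gt0 R))|apply: divr_ge0; exact: ltW].
move=> n; apply: le_trans (_ : 2 * (2 * pi) * (r / (r - modulus z)) * (modulus z / r) ^+ n.+1 <= _).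
  rewrite (E n) addrC addKr modulusM modulusX expr_div_n.
  have M t : 0 <= t <= 2 * pi -> modulus ((circ r t)^-1 ^+ n.+1 * cauchy_ker r z t) <=
       r^-1 ^+ n.+1 * (r / (r - modulus z)).
    move=> _; rewrite modulusM modulusX modulusV modulus_circ ?(ltW r0)//.
    by rewrite ler_wpM2l ?cauchy_ker_le// exprn_ge0// invr_ge0 ltW.
  have := cint_le (ltW (@twopi_gt0 R)) (VKc n.+1) M => /(ler_wpM2l (exprn_ge0 n.+1 (modulus_ge0 z))).
  move=> /le_trans; apply; rewrite le_eqVlt; apply/orP; left; apply/eqP.
  by rewrite -exprVn; ring.
rewrite exprS mulrCA ler_piMl//.
  apply: mulr_ge0; last by rewrite exprn_ge0// divr_ge0 ?modulus_ge0 ?ltW.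
  by apply: mulr_ge0; [exact: mulr_ge0 (ltW (@twopi_gt0 R))|apply: divr_ge0; exact: ltW].
by rewrite ler_pdivrMr// mul1r ltW.
Qed.

(* The integral of F(z + x (zeta - z)) zeta / (zeta - z) over the circle does not
   depend on x in [0, 1]: its derivative integrates F'(z + x (zeta - z)) zeta, which
   is the derivative in phi of a closed curve, up to a factor i x. *)
Lemma cauchy_C1 (F : C -> C) (r r0 : R) (z : C) : r < r0 -> disc_holomorphic r0 F ->
  disc_continuous r0 (derive1 F) -> modulus z < r ->
  cint (2 * pi) (fun t => F (circ r t) * cauchy_ker r z t) = (2 * pi)%:C * F z.
Proof.
move=> rr0 Fh F'c zr; have rgt0 : 0 < r := le_lt_trans (modulus_ge0 z) zr.
have Fc := disc_holomorphic_continuous Fh.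
(* [eta] is how far the homotopy parameter may leave [0, 1]: there |1 - x| + |x| is at most 1 + 2
   eta, and [eta] is chosen so that (1 + 2 eta) r is the midpoint [rho] of [r] and [r0]. *)
pose rho := (r + r0) / 2; pose eta := (r0 - r) / (4 * r).
have eta0 : 0 < eta by rewrite divr_gt0 ?subr_gt0// mulr_gt0.
have etaE : r + 2 * (eta * r) = rho by rewrite /eta /rho; field; rewrite gt_eqF.
have rho0 : 0 <= rho by rewrite /rho; lra.
have rhor : rho < r0 by rewrite /rho; lra.
pose p (x t : R) : C := line z (circ r t) x.
have prho x t : - eta < x < 1 + eta -> modulus (p x t) <= rho.
  move=> /andP[x1 x2]; have -> : p x t = (1 - x)%:C * z + x%:C * circ r t.
    by rewrite /p /line (rmorphB (real_complex R)) rmorph1; ring.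
  apply: le_trans (modulusD _ _) _; rewrite !modulusM !modulusR modulus_circ ?(ltW rgt0)//.
  have m0 := modulus_ge0 z.
  have zr' : modulus z <= r := ltW zr.
  have H1 : `|1 - x| * modulus z <= `|1 - x| * r by rewrite ler_wpM2l.
  apply: le_trans (_ : (`|1 - x| + `|x|) * r <= _); first by rewrite mulrDl lerD2r.
  have -> : rho = (1 + 2 * eta) * r by rewrite -etaE; ring.
  rewrite ler_wpM2r ?(ltW rgt0)//.
  by have [x0|x0] := ger0P x; have [y0|y0] := ger0P (1 - x); lra.
have p_lt x t : - eta < x < 1 + eta -> modulus (p x t) < r0.
  by move=> H; apply: le_lt_trans (prho _ t H) rhor.
have [M M0 HM] := disc_bounded rho0 rhor F'c.
pose H x := cint (2 * pi) (fun t => F (p x t) * cauchy_ker r z t).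
pose dH x t := derive1 F (p x t) * circ r t.
have pc x : continuous_seg (2 * pi) (p x).
  apply: (continuous_segD (@continuous_seg_cst _ _ _ z)); apply: continuous_segZ.
  by apply: (continuous_segD _ (@continuous_seg_cst _ _ _ (- z))); exact: continuous_seg_circ.
have dHc x : - eta < x < 1 + eta -> continuous_seg (2 * pi) (dH x).
  move=> xe; apply: continuous_segM; last exact: continuous_seg_circ.
  by apply: continuous_seg_curve; [exact: pc|move=> t _; apply: F'c; exact: p_lt].
have D x : - eta < x < 1 + eta -> curve_derive H x (cint (2 * pi) (dH x)).
  move=> xe; apply: (@curve_cint_under R (2 * pi) (- eta) (1 + eta) x (M * r)
    (fun x t => F (p x t) * cauchy_ker r z t)).
  - exact: xe.
  - exact: ltW (@twopi_gt0 R).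
  - move=> y ye; apply: continuous_segM; last exact: continuous_cauchy_ker.
    by apply: continuous_seg_curve; [exact: pc|move=> t _; apply: Fc; exact: p_lt].
  - move=> y t ye _.
    have G : is_derive (line z (circ r t) y) 1 F (derive1 F (p y t)).
      exact: derivable_is_derive (Fh _ (p_lt _ t ye)).
    have := curve_deriveM (curve_derive_comp G (curve_derive_line z (circ r t) y))
      (curve_derive_cst (cauchy_ker r z t) y).
    congr (curve_derive _ _ _); rewrite /dH /cauchy_ker.
    have n1 := circ_sub_neq0 t zr.
    by field.
  - move=> y t ye _; rewrite modulusM modulus_circ ?(ltW rgt0)//.
    by rewrite ler_wpM2r ?(ltW rgt0)// HM// prho.
have dH0 x : - eta < x < 1 + eta -> cint (2 * pi) (dH x) = 0.
  (* The closed-curve argument divides by [x]. At [x = 0] the curve is constant, and the integrand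
     is a constant times zeta. *)
  move=> xe; have [x0|x0] := eqVneq x 0.
    have -> : dH x = (fun t => derive1 F z * circ r t).
      by apply/funext => t; rewrite /dH /p x0 line0.
    rewrite (cintZ _ (@continuous_seg_circ _ _ _)).
    by have := @cint_circX R r 1 isT; rewrite (_ : (fun t => _) = circ r) => [->|//]; rewrite mulr0.
  pose v t := x%:C * ('i * circ r t).
  have dv t : curve_derive (p x) t (v t).
    have := curve_deriveD (curve_derive_cst z t)
      (curve_deriveZ (x%:C) (curve_deriveD (curve_derive_circ r t) (curve_derive_cst (- z) t))).
    by rewrite addr0 add0r.
  have E : (fun t => derive1 F (p x t) * v t) = (fun t => (x%:C * 'i : C) * dH x t).
    by apply/funext => t; rewrite /v /dH; ring.
  have := @closed_curve_int R F (derive1 F) (p x) v _ (fun t _ => dv t)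
    (fun t _ => derivable_is_derive (Fh _ (p_lt _ t xe))) _.
  rewrite {1 2}/p circ0 circ2pi => /(_ erefl).
  rewrite E => /(_ (continuous_segZ (dHc _ xe))); rewrite (cintZ _ (dHc _ xe)) => /eqP.
  rewrite !mulf_eq0 => /orP[/orP[]|/eqP//].
    by rewrite eq_complex/= (negPf x0).
  by rewrite eq_complex/= oner_eq0 andbF.
have := @curve_derive0_cst R H (- eta) (1 + eta).
have -> : - eta < 0 by rewrite oppr_lt0.
have -> : 1 < 1 + eta by rewrite ltrDl.
move=> /(_ isT isT) HE.
have {HE} : H 1 = H 0 by apply: HE => x xe; rewrite -(dH0 _ xe); exact: D.
have -> : H 1 = cint (2 * pi) (fun t => F (circ r t) * cauchy_ker r z t).
  by apply: eq_cint => t _; rewrite /p line1.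
move=> ->; have -> : H 0 = cint (2 * pi) (fun t => F z * cauchy_ker r z t).
  by apply: eq_cint => t _; rewrite /p line0.
by rewrite (cintZ _ (@continuous_cauchy_ker _ _ _ zr)) cint_cauchy_ker// mulrC.
Qed.

End CauchyFormula.

(** * Integrals of Cauchy type and smoothness of holomorphic functions *)

Section CauchyType.
Variable R : realType.
Local Notation C := (Cplx R).

Lemma is_derive_scale (c : C) (f : C -> C) (z d : C) : is_derive z 1 f d ->
  is_derive z 1 (fun x => c * f x) (c * d).
Proof. by move=> df; exact: is_deriveZ. Qed.

Lemma continuous_scale (T : topologicalType) (a : C) (g : T -> C) (x : T) :
  {for x, continuous g} -> {for x, continuous (fun t => a * g t)}.
Proof. by move=> gc; apply: cvgM; [exact: cvg_cst|exact: gc]. Qed.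

Lemma near_derive1 (f g : C -> C) (z : C) : (\forall w \near z, f w = g w) ->
  derive1 f z = derive1 g z.
Proof. by move=> fg; rewrite !derive1E; exact: near_eq_derive. Qed.

Lemma near_continuous (f g : C -> C) (z : C) : (\forall w \near z, f w = g w) ->
  {for z, continuous f} -> {for z, continuous g}.
Proof.
move=> fg fc; rewrite /prop_for /continuous_at -(nbhs_singleton fg).
exact: cvg_trans (near_eq_cvg fg) fc.
Qed.

Lemma disc_near (r : R) (z : C) (P : C -> Prop) : modulus z < r ->
  (forall w, modulus w < r -> P w) -> \forall w \near z, P w.
Proof.
move=> zr H; apply/nbhs_modulusP; exists (r - modulus z); first by rewrite subr_gt0.
move=> w wz; apply: H; rewrite -(subrK z w).
by apply: le_lt_trans (modulusD _ _) _; rewrite -ltrBrDr.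
Qed.

(** Meant for u = 1 / (zeta - z), v = 1 / (zeta - w) and h = w - z: a second-order remainder uniform
    in zeta. The induction adds k + 1 to the constant, and k^2 + (k + 1) is at most (k + 1)^2. *)
Lemma inv_expr_taylor (u v h : C) (B : R) k : v - u = h * u * v ->
  modulus u <= B -> modulus v <= B ->
  modulus (v ^+ k - u ^+ k - h * (k%:R * u ^+ k.+1)) <=
    k%:R ^+ 2 * B ^+ k.+2 * modulus h ^+ 2.
Proof.
move=> uv uB vB; have B0 : 0 <= B := le_trans (modulus_ge0 u) uB.
elim: k => [|k IH].
  by rewrite !expr0 subrr sub0r mul0r mulr0 oppr0 modulus0 expr0n !mul0r.
have -> : v ^+ k.+1 - u ^+ k.+1 - h * (k.+1%:R * u ^+ k.+2) =
    v * (v ^+ k - u ^+ k - h * (k%:R * u ^+ k.+1)) +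
    k.+1%:R * (h ^+ 2 * (u ^+ k.+2 * v)).
  have D0 : v - u - h * u * v = 0 by rewrite uv subrr.
  rewrite (exprS v) (exprS u k.+1) (exprS u k) -natr1; set U := u ^+ k; set V := v ^+ k.
  apply/eqP; rewrite -subr_eq0; apply/eqP.
  (* The two sides agree only modulo the hypothesis on [v - u], so their difference is displayed as
     a multiple of it. *)
  transitivity ((U + (k%:R + 1) * h * u * U) * (v - u - h * u * v)); first by ring.
  by rewrite D0 mulr0.
apply: le_trans (modulusD _ _) _.
rewrite (modulusM v) (modulusM k.+1%:R) (modulusM (h ^+ 2)) (modulusM (u ^+ k.+2)).
have knn (m : nat) : modulus (m%:R : C) = m%:R.
  by rewrite -(rmorph_nat (real_complex R)) modulusR ger0_norm.
rewrite knn !modulusX.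
have h0 := modulus_ge0 h; have u0 := modulus_ge0 u; have v0 := modulus_ge0 v.
have H1 : modulus v * modulus (v ^+ k - u ^+ k - h * (k%:R * u ^+ k.+1)) <=
    B * (k%:R ^+ 2 * B ^+ k.+2 * modulus h ^+ 2) by rewrite ler_pM ?modulus_ge0.
have H2 : k.+1%:R * (modulus h ^+ 2 * (modulus u ^+ k.+2 * modulus v)) <=
    k.+1%:R * (modulus h ^+ 2 * B ^+ k.+3).
  rewrite ler_wpM2l// ler_wpM2l ?exprn_ge0// [in leRHS]exprSr.
  by rewrite ler_pM ?exprn_ge0// lerXn2r ?nnegrE.
apply: le_trans (lerD H1 H2) _.
have -> : B * (k%:R ^+ 2 * B ^+ k.+2 * modulus h ^+ 2) + k.+1%:R * (modulus h ^+ 2 * B ^+ k.+3)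
   = (k%:R ^+ 2 + k.+1%:R) * (B ^+ k.+3 * modulus h ^+ 2).
  by rewrite (exprS B k.+2); set b := B ^+ k.+2; ring.
rewrite -[leRHS]mulrA; apply: ler_wpM2r.
  by apply: mulr_ge0; apply: exprn_ge0.
have k0 : 0 <= k%:R :> R by [].
by rewrite -natr1; nra.
Qed.

(** The density [q] is left arbitrary: differentiation in [z] only raises [k], so one lemma gives
    derivatives of every order. *)
Definition cauchy_type (r : R) (q : R -> C) (k : nat) (z : C) : C :=
  cint (2 * pi) (fun t => q t * (circ r t - z)^-1 ^+ k).

Lemma continuous_cauchy_type (r : R) (q : R -> C) k (z : C) : modulus z < r ->
  continuous_seg (2 * pi) q ->
  continuous_seg (2 * pi) (fun t => q t * (circ r t - z)^-1 ^+ k).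
Proof.
move=> zr qc; apply: (continuous_segM qc); apply: continuous_segX.
apply: continuous_segV => [|t _]; last exact: circ_sub_neq0.
by apply: (continuous_segD _ (@continuous_seg_cst _ _ _ (- z))); exact: continuous_seg_circ.
Qed.

Lemma continuous_seg_bounded b (g : R -> C) : 0 <= b -> continuous_seg b g ->
  exists2 M : R, 0 <= M & forall t : R, 0 <= t <= b -> modulus (g t) <= M.
Proof.
move=> b0 gc.
have gc' : {within `[0, b], continuous (fun t => modulus (g t))}.
  apply: continuous_seg_within => t tb; apply: continuous_comp; first exact: gc.
  exact: continuous_modulus.
have [c _ H] := EVT_max b0 gc'.
exists (modulus (g c)); first exact: modulus_ge0.
by move=> t tb; apply: H; rewrite in_itv.
Qed.

Lemma is_derive_cauchy_type (r : R) (q : R -> C) k (z : C) : modulus z < r ->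
  continuous_seg (2 * pi) q ->
  is_derive z 1 (cauchy_type r q k) (k%:R * cauchy_type r q k.+1 z).
Proof.
move=> zr qc; apply/is_deriveC => e e0.
have p0 := ltW (@twopi_gt0 R).
have [M M0 HM] := continuous_seg_bounded p0 qc.
have dz : 0 < r - modulus z by rewrite subr_gt0.
(* Points within half the distance from [z] to the circle stay at least [(r - modulus z) / 2] away
   from it, so [B] bounds both inverses; [K] gathers this bound and the factor from [cint_le]. *)
pose B := 2 / (r - modulus z).
have B0 : 0 < B by rewrite divr_gt0.
pose K := 2 * (2 * pi) * (M * (k%:R ^+ 2 * B ^+ k.+2)).
have K0 : 0 <= K.
  apply: mulr_ge0; first exact: mulr_ge0.
  apply: mulr_ge0 => //; apply: mulr_ge0; apply: exprn_ge0 => //; exact: ltW.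
have K1 : 0 < K + 1 by rewrite ltr_wpDl.
apply/nbhs_modulusP; exists (Num.min ((r - modulus z) / 2) (e / (K + 1))).
  by rewrite lt_min !divr_gt0.
move=> w; rewrite lt_min => /andP[w1 w2].
have r0 : 0 < r := le_lt_trans (modulus_ge0 z) zr.
have bnd (x : C) : modulus (x - z) <= (r - modulus z) / 2 -> forall t,
    modulus (circ r t - x)^-1 <= B.
  move=> xz t; rewrite modulusV /B -[X in _ <= X]invrK invf_div lef_pV2 ?posrE ?divr_gt0//.
    have A1 := modulusD (circ r t - x) (x - z); have A2 := modulusD (circ r t - z) z.
    rewrite subrK modulus_circ ?(ltW r0)// in A2; rewrite addrA subrK in A1; lra.
  rewrite modulus_gt0; apply: circ_sub_neq0.
  by have A3 := modulusD (x - z) z; rewrite subrK in A3; lra.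
have zz : modulus (z - z) <= (r - modulus z) / 2 by rewrite subrr modulus0 ltW// divr_gt0.
have wr : modulus w < r by have A3 := modulusD (w - z) z; rewrite subrK in A3; lra.
pose E t := q t * ((circ r t - w)^-1 ^+ k - (circ r t - z)^-1 ^+ k
   - (w - z) * (k%:R * (circ r t - z)^-1 ^+ k.+1)).
have c1 := @continuous_cauchy_type _ _ k _ wr qc.
have c2 := @continuous_cauchy_type _ _ k _ zr qc.
have c3 := @continuous_cauchy_type _ _ k.+1 _ zr qc.
have Ec : continuous_seg (2 * pi) E.
  rewrite (_ : E = (fun t => q t * (circ r t - w)^-1 ^+ k +
    ((-1) * (q t * (circ r t - z)^-1 ^+ k) +
     (- ((w - z) * k%:R)) * (q t * (circ r t - z)^-1 ^+ k.+1)))).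
    exact: (continuous_segD c1 (continuous_segD (continuous_segZ c2) (continuous_segZ c3))).
  by apply/funext => t; rewrite /E; ring.
have -> : cauchy_type r q k w - cauchy_type r q k z -
    k%:R * cauchy_type r q k.+1 z * (w - z) = cint (2 * pi) E.
  transitivity (cint (2 * pi) (fun t => q t * (circ r t - w)^-1 ^+ k +
    ((-1) * (q t * (circ r t - z)^-1 ^+ k) +
     (- ((w - z) * k%:R)) * (q t * (circ r t - z)^-1 ^+ k.+1)))).
    rewrite (cintD c1 (continuous_segD (continuous_segZ c2) (continuous_segZ c3))).
    rewrite (cintD (continuous_segZ c2) (continuous_segZ c3)) (cintZ _ c2) (cintZ _ c3).
    rewrite -/(cauchy_type r q k w) -/(cauchy_type r q k z) -/(cauchy_type r q k.+1 z).
    move: (cauchy_type r q k w) (cauchy_type r q k z) (cauchy_type r q k.+1 z) => x1 x2 x3.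
    ring.
  by apply: eq_cint => t _; rewrite /E; ring.
have EM (t : R) : 0 <= t <= 2 * pi ->
    modulus (E t) <= M * (k%:R ^+ 2 * B ^+ k.+2) * modulus (w - z) ^+ 2.
  move=> tb; rewrite /E modulusM -mulrA ler_pM ?modulus_ge0 ?HM//.
  apply: inv_expr_taylor; [|exact: bnd|exact: bnd (ltW w1) t].
  by field; rewrite !circ_sub_neq0.
apply: le_trans (cint_le p0 Ec EM) _.
rewrite mulrA -/K expr2 mulrA ler_wpM2r ?modulus_ge0//.
move: w2; rewrite ltr_pdivlMr// => w2; have := modulus_ge0 (w - z); lra.
Qed.

Lemma continuous_on_circ (f : C -> C) (r r0 : R) : 0 <= r -> r < r0 -> disc_continuous r0 f ->
  continuous_seg (2 * pi) (fun t => f (circ r t)).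
Proof.
move=> r0' rr fc; apply: continuous_seg_curve; first exact: continuous_seg_circ.
by move=> t _; apply: fc; rewrite modulus_circ.
Qed.

Lemma cauchy_type_ker (f : C -> C) (r : R) (z : C) :
  cint (2 * pi) (fun t => f (circ r t) * cauchy_ker r z t) =
  cauchy_type r (fun t => f (circ r t) * circ r t) 1 z.
Proof. by apply: eq_cint => t _; rewrite expr1 /cauchy_ker; ring. Qed.

Lemma twopiC_neq0 : (2 * pi)%:C != 0 :> C.
Proof. by rewrite eq_complex/= gt_eqF// twopi_gt0. Qed.

(** On a smaller disc Cauchy's formula makes [F] an integral of Cauchy type of order 1. Its first
    two derivatives are then of orders 2 and 3, hence differentiable and continuous. *)
Lemma derivable_derive1_C1 (F : C -> C) (r0 : R) (z : C) : disc_holomorphic r0 F ->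
  disc_continuous r0 (derive1 F) -> modulus z < r0 ->
  derivable (derive1 F) z 1 /\ {for z, continuous (derive1 (derive1 F))}.
Proof.
move=> Fh F'c zr0; pose r := (modulus z + r0) / 2.
have zr : modulus z < r by rewrite /r; lra.
have rr0 : r < r0 by rewrite /r; lra.
have r0' : 0 <= r := le_trans (modulus_ge0 z) (ltW zr).
have Fc := continuous_on_circ r0' rr0 (disc_holomorphic_continuous Fh).
have qc : continuous_seg (2 * pi) (fun t => F (circ r t) * circ r t).
  exact: (continuous_segM Fc (@continuous_seg_circ _ _ _)).
set q := (fun t => F (circ r t) * circ r t) in qc.
pose c : C := ((2 * pi)%:C)^-1.
have dT k w : modulus w < r -> is_derive w 1 (fun w => c * cauchy_type r q k w)
    (c * (k%:R * cauchy_type r q k.+1 w)).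
  by move=> wr; exact (is_derive_scale c (is_derive_cauchy_type k wr qc)).
have FE w : modulus w < r -> F w = c * cauchy_type r q 1 w.
  move=> wr; rewrite -cauchy_type_ker (cauchy_C1 rr0 Fh F'c wr).
  by rewrite mulKf// twopiC_neq0.
have F2 w : modulus w < r -> c * cauchy_type r q 2 w = derive1 F w.
  move=> wr; rewrite (near_derive1 (disc_near wr FE)).
  by rewrite (is_derive_derive1 (dT 1%N w wr)) mul1r.
have F3 w : modulus w < r -> c * (2%:R * cauchy_type r q 3 w) = derive1 (derive1 F) w.
  move=> wr; rewrite -(near_derive1 (disc_near wr F2)).
  by rewrite (is_derive_derive1 (dT 2%N w wr)).
split; first by have [D _] := dT 2%N z zr; exact: near_eq_derivable (disc_near zr F2) D.
apply: near_continuous (disc_near zr F3) _.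
have cc := is_derive_continuous (is_derive_cauchy_type 3 zr qc).
by apply: continuous_scale; apply: continuous_scale.
Qed.

(** The C^1 result is used twice. For the primitive [F], whose derivative [f] is continuous, it
    shows that f' is continuous; it then applies to [f] itself. *)
Lemma disc_holomorphic_derive1 (f : C -> C) (r : R) :
  disc_holomorphic r f -> disc_holomorphic r (derive1 f).
Proof.
move=> fh; pose F := seg f 0.
have dF w : modulus w < r -> is_derive w 1 F (f w) by move=> wr; exact (primitive_derive fh wr).
have Fh : disc_holomorphic r F by move=> w /dF[].
have FE w : modulus w < r -> f w = derive1 F w by move=> /dF/is_derive_derive1.
have FE' w : modulus w < r -> derive1 F w = f w by move=> /FE.
have F'c : disc_continuous r (derive1 F).
  move=> z zr; apply: near_continuous (disc_near zr FE) _.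
  exact: derivable_continuous (fh _ zr).
have fc : disc_continuous r (derive1 f).
  move=> z zr; have [_] := derivable_derive1_C1 Fh F'c zr.
  apply: near_continuous; apply: (disc_near zr) => w wr.
  exact: near_derive1 (disc_near wr FE').
by move=> z zr; have [] := derivable_derive1_C1 fh fc zr.
Qed.

Lemma cauchy_formula (f : C -> C) (r r0 : R) (z : C) : r < r0 -> disc_holomorphic r0 f ->
  modulus z < r ->
  f z = ((2 * pi)%:C)^-1 * cauchy_type r (fun t => f (circ r t) * circ r t) 1 z.
Proof.
move=> rr0 fh zr; rewrite -cauchy_type_ker.
rewrite (cauchy_C1 rr0 fh (disc_holomorphic_continuous (disc_holomorphic_derive1 fh)) zr).
by rewrite mulKf// twopiC_neq0.
Qed.

Lemma cauchy_formula_derive1n (f : C -> C) (r r0 : R) (n : nat) (z : C) :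
  r < r0 -> disc_holomorphic r0 f -> modulus z < r ->
  derive1n n f z = ((2 * pi)%:C)^-1 * (n`!%:R *
    cauchy_type r (fun t => f (circ r t) * circ r t) n.+1 z).
Proof.
move=> rr0 fh; elim: n z => [|n IH] z zr.
  by rewrite derive1n0 fact0 mul1r; exact: cauchy_formula rr0 fh zr.
have r0' : 0 <= r := le_trans (modulus_ge0 z) (ltW zr).
have fc := continuous_on_circ r0' rr0 (disc_holomorphic_continuous fh).
have qc : continuous_seg (2 * pi) (fun t => f (circ r t) * circ r t).
  exact: (continuous_segM fc (@continuous_seg_circ _ _ _)).
rewrite derive1nS (near_derive1 (disc_near zr IH)).
apply: is_derive_derive1.
have := is_derive_scale ((2 * pi)%:C)^-1 (is_derive_scale n`!%:R
  (is_derive_cauchy_type n.+1 zr qc)).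
by congr (is_derive _ _ _ _); rewrite factS natrM; ring.
Qed.

Lemma cauchy_coef (f : C -> C) (r r0 : R) (n : nat) : 0 < r ->
  r < r0 -> disc_holomorphic r0 f ->
  cint (2 * pi) (fun t => f (circ r t) * (circ r t)^-1 ^+ n) =
  (2 * pi)%:C * ((n`!%:R)^-1 * derive1n n f 0).
Proof.
move=> rgt0 rr0 fh; have z0 : modulus (0 : C) < r by rewrite modulus0.
rewrite (cauchy_formula_derive1n n rr0 fh z0).
have nf : n`!%:R != 0 :> C by rewrite pnatr_eq0 -lt0n fact_gt0.
rewrite mulrCA mulVKf ?twopiC_neq0// mulKf//.
apply: eq_cint => t _; rewrite subr0 exprS; have := circ_neq0 t rgt0 => c0.
by rewrite -mulrA; congr (_ * _); rewrite mulVKf.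
Qed.

End CauchyType.

(** * Zeros, poles and the logarithm of the modulus *)

Section LocalStructure.
Variable R : realType.
Local Notation C := (Cplx R).

(* For f holomorphic: f z = sum_(j < m) c_j z^j + z^m * taylor_rem f r m z, with
   taylor_rem f r m 0 = c_m. *)
Definition taylor_rem (f : C -> C) (r : R) (m : nat) (z : C) : C :=
  ((2 * pi)%:C)^-1 *
  cauchy_type r (fun t => f (circ r t) * (circ r t)^-1 ^+ m * circ r t) 1 z.

Lemma taylor_rem_continuous (f : C -> C) (r r0 : R) m : 0 < r -> r < r0 ->
  disc_holomorphic r0 f ->
  continuous_seg (2 * pi) (fun t => f (circ r t) * (circ r t)^-1 ^+ m * circ r t).
Proof.
move=> rgt0 rr0 fh.
have fc := continuous_on_circ (ltW rgt0) rr0 (disc_holomorphic_continuous fh).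
apply: continuous_segM; last exact: continuous_seg_circ.
by apply: (continuous_segM fc); apply: continuous_segX; exact: continuous_circV.
Qed.

Lemma taylor_rem_holomorphic (f : C -> C) (r r0 : R) m : 0 < r -> r < r0 ->
  disc_holomorphic r0 f -> disc_holomorphic r (taylor_rem f r m).
Proof.
move=> rgt0 rr0 fh z zr; have qc := taylor_rem_continuous (m := m) rgt0 rr0 fh.
by have [] := is_derive_scale ((2 * pi)%:C)^-1 (is_derive_cauchy_type 1 zr qc).
Qed.

Lemma taylor_rem0 (f : C -> C) (r r0 : R) z : 0 < r -> r < r0 ->
  disc_holomorphic r0 f -> modulus z < r -> taylor_rem f r 0 z = f z.
Proof.
move=> rgt0 rr0 fh zr; rewrite (cauchy_formula rr0 fh zr) /taylor_rem; congr (_ * _).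
by apply: eq_cint => t _; rewrite expr0 mulr1.
Qed.

(** Integrated form of 1 / (zeta - z) = 1 / zeta + (z / zeta) / (zeta - z). *)
Lemma taylor_remS (f : C -> C) (r r0 : R) m z : 0 < r -> r < r0 ->
  disc_holomorphic r0 f -> modulus z < r ->
  taylor_rem f r m z = taylor_rem f r m 0 + z * taylor_rem f r m.+1 z.
Proof.
move=> rgt0 rr0 fh zr; have z0 : modulus (0 : C) < r by rewrite modulus0.
have c1 := continuous_cauchy_type (k := 1) zr (taylor_rem_continuous (m := m.+1) rgt0 rr0 fh).
have c2 := continuous_cauchy_type (k := 1) z0 (taylor_rem_continuous (m := m) rgt0 rr0 fh).
rewrite /taylor_rem mulrCA -mulrDr; congr (_ * _).
rewrite /cauchy_type -(cintZ z c1) -(cintD c2 (continuous_segZ c1)).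
apply: eq_cint => t _; rewrite !expr1 subr0 exprS.
have n1 := circ_sub_neq0 t zr; have n2 := circ_neq0 t rgt0.
by set V := _ ^+ m; field; rewrite n1 n2.
Qed.

Lemma taylor_rem_pow (f : C -> C) (r r0 : R) m z : 0 < r -> r < r0 ->
  disc_holomorphic r0 f -> (forall j, (j < m)%N -> taylor_rem f r j 0 = 0) ->
  modulus z < r -> f z = z ^+ m * taylor_rem f r m z.
Proof.
move=> rgt0 rr0 fh + zr; elim: m => [_|m IH H].
  by rewrite expr0 mul1r (taylor_rem0 rgt0 rr0 fh zr).
rewrite IH; last by move=> j jm; apply: H; exact: ltnW.
by rewrite (taylor_remS m rgt0 rr0 fh zr) H// add0r exprSr mulrA.
Qed.

(** If all coefficients vanish then f z = z^n times the n-th remainder for every n, and this is of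
    size (|z| / r)^n. *)
Lemma taylor_rem_zero (f : C -> C) (r r0 : R) z : 0 < r -> r < r0 ->
  disc_holomorphic r0 f -> (forall j, taylor_rem f r j 0 = 0) ->
  modulus z < r -> f z = 0.
Proof.
move=> rgt0 rr0 fh H zr.
have fc := continuous_on_circ (ltW rgt0) rr0 (disc_holomorphic_continuous fh).
have [M M0 HM] := continuous_seg_bounded (ltW (@twopi_gt0 R)) fc.
have p0 := ltW (@twopi_gt0 R).
apply/eqP; rewrite -modulus_eq0; apply/eqP/le_anti; rewrite modulus_ge0 andbT.
apply: (@geometric_le0 _ _ ((2 * pi)^-1 * (2 * (2 * pi) * (M * (r / (r - modulus z)))))
  (modulus z / r)).
- by rewrite divr_ge0 ?modulus_ge0 ?(ltW rgt0)//= ltr_pdivrMr// mul1r.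
- apply: mulr_ge0; first by rewrite invr_ge0.
  apply: mulr_ge0; first exact: mulr_ge0.
  by apply: mulr_ge0 => //; rewrite divr_ge0 ?(ltW rgt0)// subr_ge0 ltW.
move=> n; rewrite (taylor_rem_pow rgt0 rr0 fh (fun j (_ : (j < n)%N) => H j) zr).
have qM (t : R) : 0 <= t <= 2 * pi ->
    modulus (f (circ r t) * (circ r t)^-1 ^+ n * circ r t * (circ r t - z)^-1 ^+ 1) <=
    M * r^-1 ^+ n * (r / (r - modulus z)).
  move=> tb; rewrite expr1 -mulrA modulusM; apply: ler_pM; rewrite ?modulus_ge0//.
    rewrite modulusM modulusX modulusV modulus_circ ?(ltW rgt0)// ler_wpM2r ?HM//.
    by rewrite exprn_ge0// invr_ge0 ltW.
  exact: cauchy_ker_le.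
have := cint_le p0
  (continuous_cauchy_type (k := 1) zr (taylor_rem_continuous (m := n) rgt0 rr0 fh)) qM.
rewrite -/(cauchy_type _ _ _ _) => HI.
rewrite modulusM modulusX modulusM modulusV modulusR (ger0_norm p0).
have zp0 : 0 <= modulus z ^+ n * (2 * pi)^-1.
  by rewrite mulr_ge0 ?exprn_ge0 ?modulus_ge0 ?invr_ge0.
rewrite mulrA; apply: le_trans (ler_wpM2l zp0 HI) _.
rewrite le_eqVlt; apply/orP; left; apply/eqP.
by rewrite expr_div_n -exprVn; ring.
Qed.

Lemma disc_zero_order (f : C -> C) (r0 : R) : 0 < r0 -> disc_holomorphic r0 f ->
  (exists2 r, 0 < r & forall z, modulus z < r -> f z = 0) \/
  exists m r g, [/\ 0 < r, disc_holomorphic r g, g 0 != 0 &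
    forall z, modulus z < r -> f z = z ^+ m * g z].
Proof.
move=> r00 fh; pose r := r0 / 2.
have rgt0 : 0 < r by rewrite divr_gt0.
have rr0 : r < r0 by rewrite /r; lra.
have [H|/existsNP[n /eqP Hn]] := pselect (forall j, taylor_rem f r j 0 = 0).
  by left; exists r => // z; exact: taylor_rem_zero rgt0 rr0 fh H.
right; have ex : exists n, taylor_rem f r n 0 != 0 by exists n.
have [m m0 mmin] := ex_minnP ex.
exists m, r, (taylor_rem f r m); split => //.
  exact: taylor_rem_holomorphic rr0 fh.
move=> z; apply: (taylor_rem_pow rgt0 rr0 fh) => j jm.
by apply/eqP/negPn/negP => /mmin; rewrite leqNgt jm.
Qed.

Lemma is_derive_translate (f : C -> C) (a z d : C) :
  is_derive (a + z) 1 f d -> is_derive z 1 (fun w => f (a + w)) d.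
Proof.
move=> df; have dg : is_derive z 1 (fun w : C => a + w) 1.
  by have := is_deriveD (is_derive_cst a z 1) (is_derive_id z 1); rewrite add0r.
by have := is_derive_comp df dg; rewrite mulr1.
Qed.

Lemma derivable_translate (f : C -> C) (a z : C) :
  derivable f (a + z) 1 -> derivable (fun w => f (a + w)) z 1.
Proof. by move=> /derivable_is_derive/is_derive_translate[]. Qed.

Lemma holomorphic_at_disc (f : C -> C) a : holomorphic_at f a ->
  exists2 r : R, 0 < r & disc_holomorphic r (fun w => f (a + w)).
Proof.
move=> /nbhs_modulusP[r r0 H]; exists r => // z zr; apply: derivable_translate.
by apply: H; rewrite addrC addKr.
Qed.

Lemma disc_holomorphic_at (g : C -> C) (r : R) a : 0 < r -> disc_holomorphic r g ->
  holomorphic_at (fun z => g (z - a)) a.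
Proof.
move=> r0 gh; apply/nbhs_modulusP; exists r => // z zr.
have := @derivable_translate g (- a) z; rewrite addrC => /(_ (gh _ zr)).
by under eq_fun do rewrite addrC.
Qed.

Lemma holomorphic_zero_order (f : C -> C) a : holomorphic_at f a ->
  (\forall z \near a, f z = 0) \/ exists m, zero_of_order f a m.
Proof.
move=> /holomorphic_at_disc[r r0 /(disc_zero_order r0)[]].
  move=> [r1 r10 H]; left; apply/nbhs_modulusP; exists r1 => // z zr.
  by have := H _ zr; rewrite addrC subrK.
move=> [m [r1 [g [r10 gh g0 H]]]]; right; exists m, (fun z => g (z - a)); split.
- exact: disc_holomorphic_at gh.
- by rewrite subrr.
- apply/nbhs_modulusP; exists r1 => // z zr.
  by have := H _ zr; rewrite addrC subrK.
Qed.

End LocalStructure.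

(** * The logarithm of the modulus of a zero-free holomorphic function *)

Section LogModulus.
Variable R : realType.
Local Notation C := (Cplx R).
Local Notation re := (@complex.Re R).
Local Notation im := (@complex.Im R).
Local Notation mu := (@lebesgue_measure R).

Lemma modulus_sqr (z : C) : modulus z ^+ 2 = re z ^+ 2 + im z ^+ 2.
Proof. by case: z => a b; rewrite /modulus /= sqr_sqrtr// addr_ge0 ?sqr_ge0. Qed.

(** Half the logarithm of the squared modulus is differentiated, since the square is a polynomial in
    the two components and no square root intervenes. *)
Lemma is_derive_lnmodulus (h : R -> C) (x : R) (v : C) : h x != 0 ->
  curve_derive h x v -> is_derive x 1 (fun x => ln (modulus (h x) ^+ 2) / 2) (re (v / h x)).
Proof.
move=> hx [d1 d2].
pose g (y : R) : R := re (h y) * re (h y) + im (h y) * im (h y).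
have gE y : modulus (h y) ^+ 2 = g y by rewrite modulus_sqr !expr2.
have g0 : 0 < g x by rewrite -gE exprn_gt0// modulus_gt0.
have dg : is_derive x 1 g (re (h x) * re v + re (h x) * re v +
  (im (h x) * im v + im (h x) * im v)) := is_deriveD (is_deriveM d1 d1) (is_deriveM d2 d2).
have dl := @is_derive1_comp R (@ln R) g x _ _ (is_derive1_ln g0) dg.
have D2 := is_deriveM dl (is_derive_cst (2^-1 : R) x 1).
rewrite (_ : (fun x => _) = (@ln R \o g) * cst 2^-1); last first.
  by apply/funext => y; rewrite /= gE.
move: D2; congr (is_derive _ _ _ _); rewrite -![_ *: _]/(_ * _) mulr0 add0r.
have [a b] : re (h x)^-1 = re (h x) / g x /\ im (h x)^-1 = - (im (h x) / g x).
  by rewrite /g; case: (h x) => y1 y2; rewrite -!expr2.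
rewrite reM a b /=; field; rewrite gt_eqF//.
Qed.

(** Along the segment from 0 to z, log|H| and Re L have the same derivative, the real part of z H' /
    H. No branch of the logarithm of [H] has to be chosen. *)
Lemma ln_modulus_holomorphic (r : R) (H L : C -> C) (z : C) :
  disc_holomorphic r H -> (forall w, modulus w < r -> H w != 0) ->
  (forall w, modulus w < r -> is_derive w 1 L (derive1 H w / H w)) ->
  modulus z < r -> ln (modulus (H z)) = ln (modulus (H 0)) + re (L z) - re (L 0).
Proof.
move=> Hh H0 dL zr; have z0 := modulus_ge0 z.
pose eta := (r - modulus z) / (modulus z + 1).
have z1 : 0 < modulus z + 1 by rewrite ltr_wpDl.
have eta0 : 0 < eta by rewrite divr_gt0// subr_gt0.
have etaz : eta * modulus z < r - modulus z.
  have E : eta * (modulus z + 1) = r - modulus z by rewrite /eta divfK// gt_eqF.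
  by rewrite -E ltr_pM2l// ltrDl.
pose W (x : R) : C := (ln (modulus (H (line 0 z x)) ^+ 2) / 2 - re (L (line 0 z x)))%:C.
have lr x : - eta < x < 1 + eta -> modulus (line 0 z x) < r.
  move=> /andP[x1 x2]; rewrite /line add0r subr0 modulusM modulusR.
  apply: le_lt_trans (_ : (1 + eta) * modulus z < _); last by lra.
  by apply: ler_wpM2r => //; rewrite ler_norml; apply/andP; split; lra.
have dW x : - eta < x < 1 + eta -> curve_derive W x 0.
  move=> xe; split; last exact: is_derive_cst.
  have cl := curve_derive_line 0 z x.
  have dH := curve_derive_comp (derivable_is_derive (Hh _ (lr _ xe))) cl.
  have [dLx _] := curve_derive_comp (dL _ (lr _ xe)) cl.
  have dN := is_derive_lnmodulus (H0 _ (lr _ xe)) dH.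
  have := is_deriveB dN dLx; congr (is_derive _ _ _ _).
  by apply/eqP; rewrite subr_eq0; apply/eqP; congr re; rewrite mulrAC.
have := @curve_derive0_cst R W (- eta) (1 + eta).
have -> : - eta < 0 by rewrite oppr_lt0.
have -> : 1 < 1 + eta by rewrite ltrDl.
move=> /(_ isT isT dW); rewrite /W line0 line1 => -[].
have r0 : modulus (0 : C) < r by rewrite modulus0 (le_lt_trans z0).
rewrite !lnXn ?modulus_gt0 ?H0// -!(mulr_natr (ln _) 2) !mulfK//; lra.
Qed.

Lemma disc_derive1n (f g : C -> C) (r : R) n : (forall w, modulus w < r -> f w = g w) ->
  forall w, modulus w < r -> derive1n n f w = derive1n n g w.
Proof.
move=> fg; elim: n => [|n IH] w wr; first by rewrite !derive1n0 fg.
by rewrite !derive1nS; apply: near_derive1; exact: disc_near wr IH.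
Qed.

Lemma realCD (a b : R) : (a + b)%:C = a%:C + b%:C :> C.
Proof. exact: (rmorphD (real_complex R)). Qed.

Lemma realCM (a b : R) : (a * b)%:C = a%:C * b%:C :> C.
Proof. exact: (rmorphM (real_complex R)). Qed.

Lemma realC_nat n : (n%:R)%:C = n%:R :> C.
Proof. exact: (rmorph_nat (real_complex R)). Qed.

Definition cconj (z : C) : C := conjc z.

Lemma ReC_conj (z : C) : (re z)%:C = (z + cconj z) / 2.
Proof. by case: z => a b; rewrite /cconj; simpc; rewrite /=; simpc; congr (_ +i* _); field. Qed.

Lemma cconjM (z w : C) : cconj (z * w) = cconj z * cconj w.
Proof. exact: (rmorphM (@conjc R)). Qed.

Lemma cconjX (z : C) n : cconj (z ^+ n) = cconj z ^+ n.
Proof. exact: (rmorphXn (@conjc R)). Qed.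

Lemma cconj0 : cconj 0 = 0.
Proof. exact: (rmorph0 (@conjc R)). Qed.

Lemma modulus_cconj z : modulus (cconj z) = modulus z.
Proof. by case: z => a b; rewrite /modulus /= sqrrN. Qed.

Lemma mul_cconj (z : C) : z * cconj z = (modulus z ^+ 2)%:C.
Proof. by rewrite modulus_sqr /cconj; case: z => a b; simpc; congr (_ +i* _); ring. Qed.

Lemma cconj_circ (r t : R) : 0 < r -> cconj (circ r t) = (r ^+ 2)%:C * (circ r t)^-1.
Proof.
move=> r0; have c0 := circ_neq0 t r0.
by apply: (mulfI c0); rewrite mul_cconj modulus_circ ?ltW// mulrCA mulfV// mulr1.
Qed.

Lemma continuous_seg_cconj b (g : R -> C) : continuous_seg b g ->
  continuous_seg b (fun t => cconj (g t)).
Proof.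
move=> gc; rewrite (_ : (fun t => _) = (fun t => re (g t) +i* - im (g t) : C)); last first.
  by apply/funext => t; case: (g t).
move=> t tb; apply: cvg_complex; first exact: (continuous_seg_re gc).
by apply: cvgN; exact: (continuous_seg_im gc).
Qed.

Lemma cint_cconj b (g : R -> C) : continuous_seg b g ->
  cint b (fun t => cconj (g t)) = cconj (cint b g).
Proof.
move=> gc; rewrite /cint /cconj /=; congr (_ +i* _).
  by apply: eq_Rintegral => t _; case: (g t).
have := congr1 im (cintZ (-1) gc); rewrite mulN1r imN /= => <-.
by apply: eq_Rintegral => t _; rewrite mulN1r; case: (g t).
Qed.

Section Circle.
Variables (r r0 : R) (H : C -> C).
Hypotheses (rgt0 : 0 < r) (rr0 : r < r0).
Hypotheses (Hh : disc_holomorphic r0 H) (H0 : forall w, modulus w < r0 -> H w != 0).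

Let q := fun w => derive1 H w / H w.
(** A branch of log (H / H 0), normalised to vanish at 0. *)
Let L := seg q 0.

Lemma disc_holomorphic_logder : disc_holomorphic r0 q.
Proof.
move=> w wr; have dH := disc_holomorphic_derive1 Hh wr.
by apply: derivableM; [exact dH|apply: derivableV; [exact: H0|exact: Hh]].
Qed.

Let dL w : modulus w < r0 -> is_derive w 1 L (q w).
Proof. exact: primitive_derive disc_holomorphic_logder. Qed.

Let Lh : disc_holomorphic r0 L.
Proof. by move=> w /dL[]. Qed.

Let L0 : L 0 = 0.
Proof. by rewrite /L /seg subrr mul0r. Qed.

Let r00 : modulus (0 : C) < r0.
Proof. by rewrite modulus0 (lt_trans rgt0). Qed.

Let Lc : continuous_seg (2 * pi) (fun t => L (circ r t)).
Proof. exact: continuous_on_circ (ltW rgt0) rr0 (disc_holomorphic_continuous Lh). Qed.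

Let Vc := @continuous_circV R (2 * pi) r rgt0.
Let Cc := @continuous_seg_circ R (2 * pi) r.

Let lnE t : ln (modulus (H (circ r t))) = ln (modulus (H 0)) + re (L (circ r t)).
Proof.
have cr : modulus (circ r t) < r0 by rewrite modulus_circ ?ltW.
by rewrite (ln_modulus_holomorphic Hh H0 dL cr) L0 subr0.
Qed.

Lemma continuous_ln_modulus_circ :
  continuous_seg (2 * pi) (fun t => ln (modulus (H (circ r t)))).
Proof.
rewrite (_ : (fun t => _) = (fun t => ln (modulus (H 0)) + re (L (circ r t)))); last first.
  by apply/funext => t; exact: lnE.
by move=> t tb; apply: cvgD; [exact: cvg_cst|exact: (continuous_seg_re Lc)].
Qed.

Lemma jensen_nonvanishing :
  \int[mu]_(t in `[0, 2 * pi]) ln (modulus (H (circ r t))) = 2 * pi * ln (modulus (H 0)).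
Proof.
have E := cauchy_coef 0 rgt0 rr0 Lh.
rewrite derive1n0 L0 !mulr0 in E.
have c := continuous_segD (@continuous_seg_cst _ _ (2 * pi) ((ln (modulus (H 0)))%:C : C)) Lc.
transitivity (re (cint (2 * pi) (fun t => (ln (modulus (H 0)))%:C + L (circ r t)))).
  by apply: eq_Rintegral => t _; rewrite lnE reD.
rewrite (cintD (@continuous_seg_cst _ _ _ _) Lc) (cint_cst _ (ltW (@twopi_gt0 R))).
rewrite (_ : cint _ (fun t => L (circ r t)) = 0); last first.
  by rewrite -E; apply: eq_cint => t _; rewrite expr0 mulr1.
by rewrite addr0 reM/= mul0r subr0 mulrC.
Qed.

(** In log|H| = log|H(0)| + (L + conj L) / 2 the constant integrates to 0 against zeta^(-n-1). So
    does conj L, since conj zeta = r^2 / zeta makes that integral a multiple of the conjugate of the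
    integral of L zeta^(n+1), which is the mean value of a function vanishing at 0. *)
Lemma ln_modulus_coef n :
  cint (2 * pi) (fun t => (ln (modulus (H (circ r t))))%:C * (circ r t)^-1 ^+ n.+1) =
  pi%:C * ((n.+1`!%:R)^-1 * derive1n n q 0).
Proof.
pose V t : C := (circ r t)^-1 ^+ n.+1.
have Vc' : continuous_seg (2 * pi) V by exact: continuous_segX.
have LVc := continuous_segM Lc Vc'.
have E1 : cint (2 * pi) (fun t => L (circ r t) * V t) =
    (2 * pi)%:C * ((n.+1`!%:R)^-1 * derive1n n q 0).
  rewrite (cauchy_coef n.+1 rgt0 rr0 Lh) derive1Sn; congr (_ * (_ * _)).
  by apply: disc_derive1n r00 => w wr; exact: is_derive_derive1 (dL wr).
have Kh : disc_holomorphic r0 (fun w => L w * w ^+ n.+1).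
  by move=> w wr; apply: derivableM; [exact: Lh|exact: exprn_derivable].
have E2 : cint (2 * pi) (fun t => L (circ r t) * circ r t ^+ n.+1) = 0.
  have := cauchy_coef 0 rgt0 rr0 Kh.
  rewrite derive1n0 L0 mul0r !mulr0 => <-.
  by apply: eq_cint => t _; rewrite expr0 mulr1.
have LCc := continuous_segM Lc (continuous_segX (n := n.+1) Cc).
have cc := continuous_segM (continuous_seg_cconj Lc) Vc'.
have E3 : cint (2 * pi) (fun t => cconj (L (circ r t)) * V t) = 0.
  have E4 := cint_cconj LCc.
  rewrite [in RHS]E2 cconj0 in E4.
  have E5 : cint (2 * pi) (fun t => (r ^+ 2)%:C ^+ n.+1 * (cconj (L (circ r t)) * V t)) = 0.
    rewrite -[RHS]E4; apply: eq_cint => t _.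
    by rewrite cconjM cconjX cconj_circ// exprMn /V; ring.
  have r2 : (r ^+ 2)%:C ^+ n.+1 != 0 :> C.
    by rewrite expf_neq0// -modulus_eq0 modulusR normr_eq0 sqrf_eq0 gt_eqF.
  by apply: (mulfI r2); rewrite mulr0 -(cintZ _ cc).
transitivity (cint (2 * pi) (fun t => (ln (modulus (H 0)))%:C * V t +
   (2^-1 * (L (circ r t) * V t) + 2^-1 * (cconj (L (circ r t)) * V t)))).
  apply: eq_cint => t _; rewrite lnE realCD ReC_conj -/(V t).
  by field.
rewrite (cintD (continuous_segZ Vc') (continuous_segD (continuous_segZ LVc) (continuous_segZ cc))).
rewrite (cintD (continuous_segZ LVc) (continuous_segZ cc)).
rewrite (cintZ _ Vc') (cintZ _ LVc) (cintZ _ cc) (cint_circVX rgt0)// E1 E3.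
rewrite mulr0 mulr0 add0r addr0 mulrA; congr (_ * _).
by rewrite realCM realC_nat mulKf// pnatr_eq0.
Qed.

End Circle.
End LogModulus.

(** * Orders of zeros and poles *)

Section Orders.
Variable R : realType.
Local Notation C := (Cplx R).
Implicit Types (f g : C -> C) (a b : C).

Lemma holomorphic_at_derivable f a : holomorphic_at f a -> derivable f a 1.
Proof. exact: nbhs_singleton. Qed.

Lemma holomorphic_at_continuous f a : holomorphic_at f a -> {for a, continuous f}.
Proof. by move=> /holomorphic_at_derivable/derivable_continuous. Qed.

Lemma holomorphic_at_neq0 f a : holomorphic_at f a -> f a != 0 -> \forall z \near a, f z != 0.
Proof.
move=> /holomorphic_at_continuous fc fa0.
have m0 : 0 < modulus (f a) by rewrite modulus_gt0.
move/cvg_modulusP : fc => /(_ _ m0); apply: filterS => z.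
by apply: contraTneq => ->; rewrite sub0r modulusN ltxx.
Qed.

Lemma holomorphic_atM f g a : holomorphic_at f a -> holomorphic_at g a ->
  holomorphic_at (fun z => f z * g z) a.
Proof. by apply: filterS2 => z df dg; exact: derivableM. Qed.

Lemma holomorphic_at_cst c a : holomorphic_at (fun=> c) a.
Proof. by apply: filterE => z; exact: derivable_cst. Qed.

Lemma continuous_mul (T : topologicalType) (g1 g2 : T -> C) (x : T) :
  {for x, continuous g1} -> {for x, continuous g2} ->
  {for x, continuous (fun t => g1 t * g2 t)}.
Proof. by move=> c1 c2; apply: cvgM; [exact: c1|exact: c2]. Qed.

Lemma dnbhs_nbhs (P : C -> Prop) a : (\forall z \near a, P z) -> \forall z \near a^', P z.
Proof. exact: cvg_within. Qed.

Lemma dnbhs_neq a : \forall z \near a^', z != a.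
Proof. by apply/dnbhs_modulusP; exists 1. Qed.

Lemma dnbhs_near (P : C -> Prop) a : (\forall z \near a^', P z) ->
  \forall b \near a, \forall z \near b^', P z.
Proof.
move=> /dnbhs_modulusP[d d0 H]; apply/nbhs_modulusP; exists d => // b bd.
apply/dnbhs_modulusP; have [->|ba] := eqVneq b a; first by exists d.
have ba0 : 0 < modulus (b - a) by rewrite modulus_gt0 subr_eq0.
exists (Num.min (d - modulus (b - a)) (modulus (b - a))).
  by rewrite lt_min subr_gt0 bd.
move=> z; rewrite lt_min => /andP[z1 z2] _; apply: H.
  have := modulusD (z - b) (b - a); rewrite addrA subrK; lra.
by apply: contraTneq z2 => ->; rewrite modulus_distC ltxx.
Qed.

Lemma derivable_subX a z n : derivable (fun z : C => (z - a) ^+ n) z 1.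
Proof.
by have [] := @is_derive_comp R (fun x => x ^+ n) (fun x => x - a) z _ _
  (is_derive_expr n (z - a)) (is_derive_shift z 1 (- a)).
Qed.

Lemma dnbhs_neq0_absurd f a : (\forall z \near a^', f z != 0) ->
  (\forall z \near a^', f z = 0) -> False.
Proof. by move=> f1 f2; have [z [/eqP]] := filter_ex (filterI f1 f2). Qed.

Lemma meromorphic_isolated f a : meromorphic f ->
  (\forall z \near a^', f z = 0) \/ (\forall z \near a^', f z != 0).
Proof.
move=> /(_ a)[/holomorphic_zero_order[/dnbhs_nbhs|[m [g [gh ga0 fE]]]]|[m [m0 [g [gh ga0 fE]]]]].
- by left.
- right; move: (dnbhs_nbhs (holomorphic_at_neq0 gh ga0)) (dnbhs_nbhs fE) (dnbhs_neq a).
  by apply: filterS3 => z gz -> za; rewrite mulf_neq0// expf_neq0// subr_eq0.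
- right; move: (dnbhs_nbhs (holomorphic_at_neq0 gh ga0)) fE (dnbhs_neq a).
  by apply: filterS3 => z gz -> za; rewrite mulf_neq0// invr_neq0// expf_neq0// subr_eq0.
Qed.

(* On the segment from 0 to a, the points near which f vanishes form a clopen set. *)
Lemma meromorphic_not_zero f a : meromorphic f -> holomorphic_at f 0 -> f 0 != 0 ->
  \forall z \near a^', f z != 0.
Proof.
move=> fm fh f0.
have [fa|//] := meromorphic_isolated a fm.
pose B := [set x : R | \forall z \near (line 0 a x)^', f z = 0].
have lc (P : C -> Prop) (x : R) : (\forall b \near line 0 a x, P b) ->
    \forall y \near x, P (line 0 a y).
  by move=> /(curve_continuous (curve_derive_line 0 a x)).
have Bo : open B by rewrite openE => x /dnbhs_near/lc.
have Bc : closed B.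
  rewrite -[B]setCK; apply: open_closedC; rewrite openE => x Bx.
  have [fx0|/dnbhs_near/lc fx] := meromorphic_isolated (line 0 a x) fm; first by case: (Bx fx0).
  move: fx; apply: filterS => y yn Cy.
  exact: dnbhs_neq0_absurd yn Cy.
have B1 : B 1 by rewrite /B /= line1.
have conn : connected [set: R] by apply/connected_intervalP => x y _ _ z _.
have BT : B = setT.
  apply: conn; first by exists 1.
  - by exists B => //; rewrite setTI.
  - by exists B => //; rewrite setTI.
have : B 0 by rewrite BT.
rewrite /B /= line0 => f0'.
have f0n := dnbhs_nbhs (holomorphic_at_neq0 fh f0).
by have [] := dnbhs_neq0_absurd f0n f0'.
Qed.

(* The order of f at a is p - q. *)
Definition local_order f a (p q : nat) : Prop :=
  exists g : C -> C, [/\ holomorphic_at g a, g a != 0 &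
    \forall z \near a^', f z * (z - a) ^+ q = (z - a) ^+ p * g z].

Lemma zero_of_order_local f a m : zero_of_order f a m -> local_order f a m 0.
Proof.
move=> [g [gh ga fE]]; exists g; split => //; move: (dnbhs_nbhs fE).
by apply: filterS => z ->; rewrite expr0 mulr1.
Qed.

Lemma pole_of_order_local f a m : pole_of_order f a m -> local_order f a 0 m.
Proof.
move=> [_ [g [gh ga fE]]]; exists g; split => //; move: fE (dnbhs_neq a).
apply: filterS2 => z -> za; rewrite expr0 mul1r divfK// expf_neq0// subr_eq0//.
Qed.

Lemma local_orderM f g a p q p' q' : local_order f a p q -> local_order g a p' q' ->
  local_order (fun z => f z * g z) a (p + p') (q + q').
Proof.
move=> [f1 [f1h f1a fE]] [g1 [g1h g1a gE]].
exists (fun z => f1 z * g1 z); split.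
- exact: holomorphic_atM.
- exact: mulf_neq0.
- move: fE gE; apply: filterS2 => z E1 E2.
  by rewrite !exprD mulrACA E1 E2 mulrACA.
Qed.

Lemma continuous_dnbhs_eq f g a : {for a, continuous f} -> {for a, continuous g} ->
  (\forall z \near a^', f z = g z) -> f a = g a.
Proof.
move=> fc gc fg; apply/eqP; rewrite -subr_eq0 -modulus_eq0; apply/eqP.
apply/le_anti; rewrite modulus_ge0 andbT; apply/ler_addgt0Pl => e e0; rewrite addr0.
have e2 : 0 < e / 2 by rewrite divr_gt0.
have /cvg_modulusP/(_ _ e2)/dnbhs_nbhs f1 := fc.
have /cvg_modulusP/(_ _ e2)/dnbhs_nbhs g1 := gc.
have [z [[fz gz] E]] := filter_ex (filterI (filterI f1 g1) fg).
have := modulusD (f a - f z) (g z - g a); rewrite E addrA subrK.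
by move: fz gz; rewrite /= (modulus_distC (f z)) E; lra.
Qed.

(** If both orders held, the nonvanishing factor [h] would agree off [a] with (z - a)^(p + q) times
    [g], hence vanish at [a] by continuity. *)
Lemma local_order_unique f a p : local_order f a p 0 -> forall q, (0 < q)%N ->
  ~ local_order f a 0 q.
Proof.
move=> [g [gh ga gE]] q q0 [h [hh ha hE]].
have E : \forall z \near a^', (z - a) ^+ p * g z * (z - a) ^+ q = h z.
  by move: gE hE; apply: filterS2 => z <-; rewrite expr0 mulr1 mul1r.
have powc n : {for a, continuous (fun z : C => (z - a) ^+ n)}.
  apply: holomorphic_at_continuous; apply: filterE => z.
  exact: derivable_subX.
have hc := holomorphic_at_continuous hh.
have gc := holomorphic_at_continuous gh.
have /continuous_dnbhs_eq : {for a, continuous (fun z => (z - a) ^+ p * g z * (z - a) ^+ q)}.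
  exact: continuous_mul (continuous_mul (powc p) gc) (powc q).
move=> /(_ _ hc E); rewrite subrr (expr0n _ q) eqn0Ngt q0 mulr0 => /esym/eqP.
by rewrite (negPf ha).
Qed.

(** Shows that the default 0 of [xget] is harmless. A regular nonzero point has zero order 0 and
    falls under the first case; a point with no zero order must be a pole, as [f] vanishes
    identically near no point. *)
Lemma meromorphic_local_order f a : meromorphic f -> holomorphic_at f 0 -> f 0 != 0 ->
  local_order f a (zero_mult f a) (pole_mult f a).
Proof.
move=> fm fh f0; have fa := meromorphic_not_zero a fm fh f0.
have [[m Hm]|nz] := pselect (exists m, zero_of_order f a m).
  have Z : zero_of_order f a (zero_mult f a) :=
    xgetPex 0%N (ex_intro [set m | zero_of_order f a m] m Hm).
  have -> : pole_mult f a = 0%N.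
    rewrite /pole_mult xgetPN// => k /= Hk; have [k0 _] := Hk.
    exact: (local_order_unique (zero_of_order_local Hm) k0 (pole_of_order_local Hk)).
  exact: zero_of_order_local.
have -> : zero_mult f a = 0%N by rewrite /zero_mult xgetPN// => k /= Hk; apply: nz; exists k.
have [fa'|[m Hm]] := fm a.
  have [/dnbhs_nbhs f0'|//] := holomorphic_zero_order fa'.
  by have [] := dnbhs_neq0_absurd fa f0'.
apply: pole_of_order_local.
exact: (xgetPex 0%N (ex_intro [set m | pole_of_order f a m] m Hm)).
Qed.

End Orders.

(** * Blaschke factors and the formula on a disc *)

Section Removable.
Variable R : realType.
Local Notation C := (Cplx R).
Implicit Types (f g : C -> C) (a b s : C).

Lemma removable (h : C -> C) (r0 : R) :
  (forall a, modulus a < r0 -> local_order h a 0 0) ->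
  exists H : C -> C, [/\ disc_holomorphic r0 H, forall a, modulus a < r0 -> H a != 0 &
    forall a, modulus a < r0 -> {for a, continuous h} -> H a = h a].
Proof.
move=> hl.
have [G HG] : exists G : C -> C -> C, forall a, modulus a < r0 ->
    [/\ holomorphic_at (G a) a, G a a != 0 & \forall z \near a^', h z = G a z].
  suff /choice[G HG] : forall a, exists g, modulus a < r0 ->
    [/\ holomorphic_at g a, g a != 0 & \forall z \near a^', h z = g z] by exists G.
  move=> a; have [ar|ar] := pselect (modulus a < r0); last by exists h.
  have [g [gh ga gE]] := hl a ar; exists g => _; split => //.
  by move: gE; apply: filterS => z; rewrite !expr0 mulr1 mul1r.
(* The diagonal of the local extensions: for [z] near [a], both [G z] and [G a] extend [h]
   continuously at [z], so [G z z = G a z], and the diagonal coincides with the holomorphic [G a]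
   near [a]. *)
exists (fun a => G a a); split.
- move=> a ar; have [gh ga gE] := HG a ar.
  apply: (near_eq_derivable (f := G a)); last exact: holomorphic_at_derivable.
  have ra : \forall z \near a, modulus z < r0 by exact: disc_near ar _.
  move: ra gh (dnbhs_near gE); apply: filterS3 => z zr gz hE.
  have [g1 _ hE1] := HG z zr.
  apply: continuous_dnbhs_eq.
  + exact: derivable_continuous.
  + exact: holomorphic_at_continuous.
  + by move: hE hE1; apply: filterS2 => w -> ->.
- by move=> a /HG[].
- move=> a /HG[gh _ gE] hc.
  apply: (continuous_dnbhs_eq (holomorphic_at_continuous gh) hc).
  by move: gE; apply: filterS => z ->.
Qed.

Lemma local_orderV f a p q : local_order f a p q -> local_order (fun z => (f z)^-1) a q p.
Proof.
move=> [g [gh ga gE]]; have gn := holomorphic_at_neq0 gh ga.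
exists (fun z => (g z)^-1); split; last first.
- move: gE (dnbhs_nbhs gn) (dnbhs_neq a); apply: filterS3 => z fz gz za.
  have za0 : z - a != 0 by rewrite subr_eq0.
  have pn n : (z - a) ^+ n != 0 by rewrite expf_neq0.
  have fE : f z = (z - a) ^+ p * g z / (z - a) ^+ q by rewrite -fz mulfK.
  rewrite fE; move: (pn p) (pn q); set P := _ ^+ p; set Q := _ ^+ q => P0 Q0.
  by field; rewrite P0 Q0 gz.
- by rewrite invr_neq0.
- by move: gh gn; apply: filterS2 => z dg gz; exact: derivableV.
Qed.

Lemma local_order_holomorphic f a : holomorphic_at f a -> f a != 0 -> local_order f a 0 0.
Proof.
by move=> fh fa; exists f; split => //; apply: filterE => z; rewrite !expr0 mulr1 mul1r.
Qed.

Lemma local_order_cancel f a p : local_order f a p p -> local_order f a 0 0.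
Proof.
move=> [g [gh ga gE]]; exists g; split => //; move: gE (dnbhs_neq a).
apply: filterS2 => z E za; rewrite !expr0 mulr1 mul1r.
have pn : (z - a) ^+ p != 0 by rewrite expf_neq0// subr_eq0.
by apply: (mulIf pn); rewrite E mulrC.
Qed.

Lemma local_order_prod (I : eqType) (l : seq I) (b : I -> C -> C) a (q : I -> nat) :
  (forall i, i \in l -> local_order (b i) a 0 (q i)) ->
  local_order (fun z => \prod_(i <- l) b i z) a 0 (\sum_(i <- l) q i).
Proof.
elim: l => [|i l IH] H.
  rewrite big_nil; have -> : (fun z => \prod_(i <- [::]) b i z) = (fun=> 1).
    by apply/funext => z; rewrite big_nil.
  by apply: local_order_holomorphic; [exact: holomorphic_at_cst|exact: oner_neq0].
rewrite big_cons; have -> : (fun z => \prod_(j <- i :: l) b j z) =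
    (fun z => b i z * \prod_(j <- l) b j z).
  by apply/funext => z; rewrite big_cons.
apply: (@local_orderM _ _ _ a 0 (q i) 0); first by apply: H; rewrite mem_head.
by apply: IH => j jl; apply: H; rewrite in_cons jl orbT.
Qed.

Definition reflect_pt (r : R) (s : C) : C := (r ^+ 2)%:C / cconj s.

(* The inverse of the Blaschke factor of |z| < r at s, so a simple pole at s. *)
Definition blaschke (r : R) (s z : C) : C :=
  cconj s / r%:C * ((reflect_pt r s - z) / (s - z)).

Lemma cconj_eq0 s : (cconj s == 0) = (s == 0).
Proof. by rewrite -modulus_eq0 modulus_cconj modulus_eq0. Qed.

Lemma realC_neq0 (r : R) : 0 < r -> r%:C != 0 :> C.
Proof. by move=> r0; rewrite -modulus_eq0 modulusR normr_eq0 gt_eqF. Qed.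

Lemma modulus_reflect_pt (r : R) s : modulus (reflect_pt r s) = r ^+ 2 / modulus s.
Proof. by rewrite modulusM modulusV modulus_cconj modulusR ger0_norm// sqr_ge0. Qed.

(** On the circle z conj z = r^2, so conj s times the reflected numerator equals z conj (z - s),
    whose modulus is r times that of the denominator. *)
Lemma modulus_blaschke_circ (r : R) s (t : R) : 0 < r -> s != 0 -> modulus s < r ->
  modulus (blaschke r s (circ r t)) = 1.
Proof.
move=> r0 s0 sr; set z := circ r t.
have zs : s - z != 0 by rewrite -oppr_eq0 opprB circ_sub_neq0.
have z0 : z != 0 by exact: circ_neq0.
have E : cconj s * (reflect_pt r s - z) = z * cconj (z - s).
  rewrite mulrBr /reflect_pt mulrC divfK ?cconj_eq0//.
  have -> : cconj (z - s) = cconj z - cconj s by exact: (rmorphB (@conjc R)).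
  by rewrite mulrBr mul_cconj modulus_circ ?ltW//; ring.
rewrite /blaschke mulrACA mulrA E -mulrA -invfM.
rewrite !modulusM modulusV modulusM modulus_cconj modulusR ger0_norm ?ltW//.
rewrite modulus_circ ?ltW// modulus_distC mulfV// mulf_neq0 ?gt_eqF//.
by rewrite modulus_gt0.
Qed.

Lemma blaschke0 (r : R) s : 0 < r -> s != 0 -> modulus (blaschke r s 0) = r / modulus s.
Proof.
move=> r0 s0; rewrite /blaschke !subr0 modulusM (modulusM (reflect_pt r s)).
rewrite modulus_reflect_pt modulusM !modulusV modulus_cconj modulusR ger0_norm ?ltW//.
have s1 : modulus s != 0 by rewrite modulus_eq0.
by field; rewrite s1 gt_eqF.
Qed.

Lemma is_derive_subl a (z : C) : is_derive z 1 (fun w : C => a - w) (- 1).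
Proof.
by have := is_deriveD (is_derive_cst a z 1) (is_deriveN (is_derive_id z (1 : C)));
  rewrite add0r.
Qed.

Lemma derivable_subl a (z : C) : derivable (fun w : C => a - w) z 1.
Proof. by have [] := is_derive_subl a z. Qed.

Lemma is_derive_blaschke (r : R) s (z : C) : 0 < r -> s != 0 -> z != s -> z != reflect_pt r s ->
  is_derive z 1 (blaschke r s)
    (blaschke r s z * ((s - z)^-1 - (reflect_pt r s - z)^-1)).
Proof.
move=> r0 s0 zs zs'.
have n1 : s - z != 0 by rewrite subr_eq0 eq_sym.
have n2 : reflect_pt r s - z != 0 by rewrite subr_eq0 eq_sym.
have := is_derive_scale (cconj s / r%:C) (is_deriveM (is_derive_subl (reflect_pt r s) z)
  (@is_derive_inv R (fun w => s - w) z _ n1 (is_derive_subl s z))).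
congr (is_derive _ _ _ _); rewrite -![_ *: _]/(_ * _) /blaschke.
move: (realC_neq0 r0); set c := r%:C => c0.
by field; rewrite n1 n2 c0.
Qed.

Lemma blaschke_neq0 (r : R) s z : 0 < r -> s != 0 -> z != s -> z != reflect_pt r s ->
  blaschke r s z != 0.
Proof.
move=> r0 s0 zs zs'; rewrite /blaschke !mulf_neq0 ?invr_neq0 ?cconj_eq0 ?realC_neq0//.
  by rewrite subr_eq0 eq_sym.
by rewrite subr_eq0 eq_sym.
Qed.

Lemma near_neq a b : a != b -> \forall z \near a, z != b.
Proof.
rewrite -subr_eq0 -modulus_gt0 => ab; apply/nbhs_modulusP; exists (modulus (a - b)) => // z.
by apply: contraTneq => ->; rewrite modulus_distC ltxx.
Qed.

Lemma holomorphic_at_blaschke (r : R) s a : 0 < r -> s != 0 -> a != s ->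
  a != reflect_pt r s -> holomorphic_at (blaschke r s) a.
Proof.
move=> r0 s0 /near_neq as1 /near_neq as2; move: as1 as2.
by apply: filterS2 => z z1 z2; have [] := is_derive_blaschke r0 s0 z1 z2.
Qed.

(** The pole order is the boolean [s == a] read as a number, so that summing it over a list gives
    [count_mem]. *)
Lemma local_order_blaschke (r : R) s a : 0 < r -> s != 0 -> a != reflect_pt r s ->
  local_order (blaschke r s) a 0 (s == a).
Proof.
move=> r0 s0 as'; have [sa|sa] := eqVneq s a; last first.
  have as1 : a != s by rewrite eq_sym.
  apply: local_order_holomorphic; first exact: holomorphic_at_blaschke.
  exact: blaschke_neq0.
subst a; exists (fun z => - (cconj s / r%:C) * (reflect_pt r s - z)); split.
- apply: filterE => z.
  have [D _] := is_derive_scale (- (cconj s / r%:C)) (is_derive_subl (reflect_pt r s) z).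
  exact D.
- apply: mulf_neq0; last by rewrite subr_eq0 eq_sym.
  by rewrite oppr_eq0 mulf_neq0 ?invr_neq0 ?cconj_eq0 ?realC_neq0.
- move: (dnbhs_neq s); apply: filterS => z zs.
  have n1 : s - z != 0 by rewrite subr_eq0 eq_sym.
  move: (realC_neq0 r0); rewrite /blaschke; set c := r%:C => c0.
  by rewrite expr0 expr1; field; rewrite n1 c0.
Qed.

End Removable.

(** * Taylor coefficients at 0 *)

Section TaylorCoef.
Variable R : realType.
Local Notation C := (Cplx R).
Implicit Types (f g : C -> C) (a b s : C).

Definition taylor_coef (n : nat) (f : C -> C) : C := (n`!%:R)^-1 * derive1n n f 0.

Lemma eq_taylor_coef n f g (r : R) : 0 < r -> (forall w, modulus w < r -> f w = g w) ->
  taylor_coef n f = taylor_coef n g.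
Proof.
by move=> r0 fg; rewrite /taylor_coef (disc_derive1n n fg)// modulus0.
Qed.

Lemma taylor_coef_circ n f (r r0 : R) : 0 < r -> r < r0 -> disc_holomorphic r0 f ->
  taylor_coef n f = ((2 * pi)%:C)^-1 * cint (2 * pi) (fun t => f (circ r t) * (circ r t)^-1 ^+ n).
Proof. by move=> r0' rr fh; rewrite (cauchy_coef n r0' rr fh) mulKf// twopiC_neq0. Qed.

Lemma continuous_circ_coef n f (r r0 : R) : 0 < r -> r < r0 -> disc_holomorphic r0 f ->
  continuous_seg (2 * pi) (fun t => f (circ r t) * (circ r t)^-1 ^+ n).
Proof.
move=> rgt0 rr fh; apply: continuous_segM.
  exact: continuous_on_circ (ltW rgt0) rr (disc_holomorphic_continuous fh).
by apply: continuous_segX; exact: continuous_circV.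
Qed.

Lemma disc_holomorphicD (r : R) f g : disc_holomorphic r f -> disc_holomorphic r g ->
  disc_holomorphic r (fun z => f z + g z).
Proof. by move=> fh gh z zr; apply: derivableD; [exact: fh|exact: gh]. Qed.

Lemma disc_holomorphicN (r : R) f : disc_holomorphic r f ->
  disc_holomorphic r (fun z => - f z).
Proof. by move=> fh z zr; apply: derivableN; exact: fh. Qed.

(** Read off from linearity of the integral representation on a smaller circle, instead of iterating
    the rule for derivatives of sums. *)
Lemma taylor_coefD n f g (r : R) : 0 < r -> disc_holomorphic r f -> disc_holomorphic r g ->
  taylor_coef n (fun z => f z + g z) = taylor_coef n f + taylor_coef n g.
Proof.
move=> r0 fh gh; have r2 : 0 < r / 2 by rewrite divr_gt0.
have rr : r / 2 < r by lra.
rewrite (taylor_coef_circ n r2 rr fh) (taylor_coef_circ n r2 rr gh).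
rewrite (taylor_coef_circ n r2 rr (disc_holomorphicD fh gh)) -mulrDr; congr (_ * _).
rewrite -(cintD (continuous_circ_coef r2 rr fh) (continuous_circ_coef r2 rr gh)).
by apply: eq_cint => t _; rewrite mulrDl.
Qed.

Lemma taylor_coefN n f (r : R) : 0 < r -> disc_holomorphic r f ->
  taylor_coef n (fun z => - f z) = - taylor_coef n f.
Proof.
move=> r0 fh; have r2 : 0 < r / 2 by rewrite divr_gt0.
have rr : r / 2 < r by lra.
rewrite (taylor_coef_circ n r2 rr fh) (taylor_coef_circ n r2 rr (disc_holomorphicN fh)).
rewrite -mulrN; congr (_ * _); rewrite -mulN1r -(cintZ _ (continuous_circ_coef r2 rr fh)).
by apply: eq_cint => t _; rewrite mulNr mulN1r.
Qed.

(** Induction through zeta^(-1) / (a - zeta) = a^(-1) (zeta^(-1) + 1 / (a - zeta)): the pure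
    negative powers integrate to 0. *)
Lemma taylor_coef_inv n (a : C) : a != 0 -> taylor_coef n (fun z => (a - z)^-1) = a^-1 ^+ n.+1.
Proof.
move=> a0; have ma : 0 < modulus a by rewrite modulus_gt0.
have nz z : modulus z < modulus a -> a - z != 0.
  by rewrite subr_eq0; apply: contraTneq => <-; rewrite ltxx.
have fh : disc_holomorphic (modulus a) (fun z => (a - z)^-1).
  by move=> z za; apply: derivableV; [exact: nz|exact: derivable_subl].
pose r := modulus a / 2; have rgt0 : 0 < r by rewrite divr_gt0.
have rr : r < modulus a by rewrite /r; lra.
have c m := continuous_circ_coef (n := m) rgt0 rr fh.
have Vc m : continuous_seg (2 * pi) (fun t => (circ r t)^-1 ^+ m).
  by apply: continuous_segX; exact: continuous_circV.
elim: n => [|n IH]; first by rewrite /taylor_coef fact0 invr1 mul1r derive1n0 subr0 expr1.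
rewrite exprS -IH !(taylor_coef_circ _ rgt0 rr fh) mulrCA; congr (_ * _).
rewrite -(cintZ _ (c n)) -[RHS]add0r -(mulr0 a^-1) -(cint_circVX rgt0 (ltn0Sn n)).
rewrite -(cintZ _ (Vc n.+1)) -(cintD (continuous_segZ (Vc n.+1)) (continuous_segZ (c n))).
apply: eq_cint => t _; rewrite exprS; set V := _ ^+ n.
have n1 : a - circ r t != 0 by apply: nz; rewrite modulus_circ ?ltW.
have n2 := circ_neq0 t rgt0.
by field; rewrite n1 n2 a0.
Qed.

End TaylorCoef.

(** * The formula on a disc of finite radius *)

Section FiniteFormula.
Variable R : realType.
Local Notation C := (Cplx R).
Local Notation mu := (@lebesgue_measure R).
Implicit Types (f g : C -> C) (a b s : C).

Definition logder f (z : C) : C := derive1 f z / f z.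

Lemma logderM f g (z : C) : derivable f z 1 -> derivable g z 1 -> f z != 0 -> g z != 0 ->
  logder (fun w => f w * g w) z = logder f z + logder g z.
Proof.
move=> /derivable_is_derive df /derivable_is_derive dg fz gz; rewrite /logder.
rewrite (is_derive_derive1 (is_deriveM df dg)) -![_ *: _]/(_ * _).
move: (derive1 f z) (derive1 g z) fz gz => d1 d2; move: (f z) (g z) => x y x0 y0.
by field; rewrite x0 y0.
Qed.

Lemma logderV f (z : C) : derivable f z 1 -> f z != 0 ->
  logder (fun w => (f w)^-1) z = - logder f z.
Proof.
move=> /derivable_is_derive df fz; rewrite /logder (is_derive_derive1 (is_derive_inv fz df)).
by field.
Qed.

(** The logarithmic derivative of [blaschke r s]. *)
Definition blaschke_term (r : R) s (z : C) : C := (s - z)^-1 - (reflect_pt r s - z)^-1.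

Definition blaschke_prod (r : R) (l : seq C) (z : C) : C := \prod_(s <- l) blaschke r s z.

Lemma blaschke_prodP (r : R) (l : seq C) (z : C) : 0 < r ->
  (forall s, s \in l -> [/\ s != 0, z != s & z != reflect_pt r s]) ->
  [/\ derivable (blaschke_prod r l) z 1, blaschke_prod r l z != 0 &
    logder (blaschke_prod r l) z = \sum_(s <- l) blaschke_term r s z].
Proof.
move=> r0; elim: l => [|s l IH] H.
  have -> : blaschke_prod r [::] = (fun=> 1).
    by apply/funext => w; rewrite /blaschke_prod big_nil.
  by rewrite big_nil /logder derive1_cst mul0r.
have [s0 zs zs'] := H s (mem_head _ _).
have [|d1 n1 l1] := IH; first by move=> x xl; apply: H; rewrite in_cons xl orbT.
have -> : blaschke_prod r (s :: l) = (fun w => blaschke r s w * blaschke_prod r l w).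
  by apply/funext => w; rewrite /blaschke_prod big_cons.
have D := is_derive_blaschke r0 s0 zs zs'; have [D1 _] := D.
have n2 := blaschke_neq0 r0 s0 zs zs'.
split.
- by apply: derivableM; [exact D1|exact d1].
- exact: mulf_neq0.
- by rewrite (logderM D1 d1 n2 n1) big_cons l1 /logder (is_derive_derive1 D) mulrAC mulfV// mul1r.
Qed.

Lemma modulus_blaschke_prod_circ (r : R) (l : seq C) (t : R) : 0 < r ->
  (forall s, s \in l -> s != 0 /\ modulus s < r) ->
  modulus (blaschke_prod r l (circ r t)) = 1.
Proof.
move=> r0; rewrite /blaschke_prod; elim: l => [|s l IH] H; first by rewrite big_nil modulus1.
have [s0 sr] := H s (mem_head _ _).
rewrite big_cons modulusM modulus_blaschke_circ// IH ?mul1r// => x xl.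
by apply: H; rewrite in_cons xl orbT.
Qed.

Lemma ln_blaschke_prod0 (r : R) (l : seq C) : 0 < r -> (forall s, s \in l -> s != 0) ->
  ln (modulus (blaschke_prod r l 0)) = \sum_(s <- l) ln (r / modulus s) /\
  0 < modulus (blaschke_prod r l 0).
Proof.
move=> r0; rewrite /blaschke_prod; elim: l => [|s l IH] H.
  by rewrite !big_nil modulus1 ln1.
have s0 := H s (mem_head _ _).
have Hl x : x \in l -> x != 0 by move=> xl; apply: H; rewrite in_cons xl orbT.
have [E1 E2] := IH Hl.
have p : 0 < r / modulus s by rewrite divr_gt0// modulus_gt0.
rewrite !big_cons modulusM blaschke0//; split; last by rewrite mulr_gt0.
by rewrite lnM ?posrE// E1.
Qed.

Lemma sum_seq_disc_holomorphic (r : R) (l : seq C) (F : C -> C -> C) :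
  (forall s, s \in l -> disc_holomorphic r (F s)) ->
  disc_holomorphic r (fun z => \sum_(s <- l) F s z).
Proof.
elim: l => [|s l IH] H.
  under eq_fun do rewrite big_nil.
  by move=> z _; exact: derivable_cst.
under eq_fun do rewrite big_cons.
apply: disc_holomorphicD; first by apply: H; rewrite mem_head.
by apply: IH => x xl; apply: H; rewrite in_cons xl orbT.
Qed.

Lemma taylor_coef_sum n (r : R) (l : seq C) (F : C -> C -> C) : 0 < r ->
  (forall s, s \in l -> disc_holomorphic r (F s)) ->
  taylor_coef n (fun z => \sum_(s <- l) F s z) = \sum_(s <- l) taylor_coef n (F s).
Proof.
move=> r0; elim: l => [|s l IH] H.
  under [in LHS]eq_fun do rewrite big_nil.
  rewrite big_nil /taylor_coef.
  suff -> : derive1n n (fun=> 0 : C) (0 : C) = 0 by rewrite mulr0.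
  elim: n => [|n E]; first by rewrite derive1n0.
  rewrite derive1Sn; have -> : derive1 (fun=> 0 : C) = (fun=> 0 : C).
    by apply/funext => z; exact: derive1_cst.
  exact: E.
under [in LHS]eq_fun do rewrite big_cons.
have Hl x : x \in l -> disc_holomorphic r (F x).
  by move=> xl; apply: H; rewrite in_cons xl orbT.
rewrite (taylor_coefD n r0 (H s (mem_head _ _)) (sum_seq_disc_holomorphic Hl)).
by rewrite big_cons (IH Hl).
Qed.

Lemma blaschke_term_holomorphic (r d : R) s : d <= modulus s -> d <= modulus (reflect_pt r s) ->
  disc_holomorphic d (blaschke_term r s).
Proof.
move=> ds ds' z zd.
have nz a : d <= modulus a -> a - z != 0.
  by rewrite subr_eq0 => da; apply: contraTneq zd => <-; rewrite -leNgt.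
by apply: derivableB; apply: derivableV;
  [exact: nz|exact: derivable_subl|exact: nz|exact: derivable_subl].
Qed.

Lemma taylor_coef_blaschke_term n (r : R) s : 0 < r -> s != 0 ->
  taylor_coef n (blaschke_term r s) = s^-1 ^+ n.+1 - (reflect_pt r s)^-1 ^+ n.+1.
Proof.
move=> r0 s0; have s0' : reflect_pt r s != 0.
  by rewrite mulf_neq0 ?invr_neq0 ?cconj_eq0 ?realC_neq0 ?exprn_gt0.
pose d := Num.min (modulus s) (modulus (reflect_pt r s)).
have d0 : 0 < d by rewrite lt_min !modulus_gt0 s0.
have H a : d <= modulus a -> disc_holomorphic d (fun z => (a - z)^-1).
  move=> da z zd; apply: derivableV; last exact: derivable_subl.
  by rewrite subr_eq0; apply: contraTneq zd => <-; rewrite -leNgt.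
have ds : d <= modulus s by rewrite ge_min lexx.
have ds' : d <= modulus (reflect_pt r s) by rewrite ge_min lexx orbT.
rewrite /blaschke_term (taylor_coefD n d0 (H _ ds) (disc_holomorphicN (H _ ds'))).
by rewrite (taylor_coefN n d0 (H _ ds')) !taylor_coef_inv.
Qed.

Lemma holomorphic_at_pole_mult f a : meromorphic f -> pole_mult f a = 0%N -> holomorphic_at f a.
Proof.
move=> /(_ a)[//|[m Hm]] p0; have := xgetPex 0%N (ex_intro [set m | pole_of_order f a m] m Hm).
by rewrite -/(pole_mult f a) p0 => -[].
Qed.

Section Formula.
Variables (f : C -> C) (r r0 : R) (S T : seq C).
Hypotheses (fm : meromorphic f) (fh : holomorphic_at f 0) (f0 : f 0 != 0).
Hypotheses (rgt0 : 0 < r) (rr0 : r < r0).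
(** The last bound puts every reflected point outside |z| < r0. Together with [Sz] and [Tp], which
    hold up to [r0], it leaves no zero or pole of [f] in the annulus r <= |z| < r0. *)
Hypothesis ST : forall s, s \in S ++ T -> [/\ s != 0, modulus s < r & r0 <= r ^+ 2 / modulus s].
Hypothesis Sz : forall a, modulus a < r0 -> count_mem a S = zero_mult f a.
Hypothesis Tp : forall a, modulus a < r0 -> count_mem a T = pole_mult f a.

Let SP s : s \in S -> [/\ s != 0, modulus s < r & r0 <= r ^+ 2 / modulus s].
Proof. by move=> sS; apply: ST; rewrite mem_cat sS. Qed.

Let TP s : s \in T -> [/\ s != 0, modulus s < r & r0 <= r ^+ 2 / modulus s].
Proof. by move=> sS; apply: ST; rewrite mem_cat sS orbT. Qed.

Let h z := f z * (blaschke_prod r S z * (blaschke_prod r T z)^-1).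

Let reflect_neq a s : modulus a < r0 -> r0 <= r ^+ 2 / modulus s -> a != reflect_pt r s.
Proof.
move=> ar; rewrite -modulus_reflect_pt => rs; apply: contraTneq ar => ->.
by rewrite -leNgt.
Qed.

Let local_blaschke_prod a l : modulus a < r0 ->
  (forall s, s \in l -> [/\ s != 0, modulus s < r & r0 <= r ^+ 2 / modulus s]) ->
  local_order (blaschke_prod r l) a 0 (count_mem a l).
Proof.
move=> ar H; rewrite -sum1_count big_mkcond /=.
apply: local_order_prod => s sl; have [s0 _ rs] := H s sl.
have := local_order_blaschke rgt0 s0 (reflect_neq ar rs).
by rewrite /=; case: (s == a).
Qed.

Let h_order a : modulus a < r0 -> local_order h a 0 0.
Proof.
move=> ar; have Lf := meromorphic_local_order a fm fh f0.
have LS := local_blaschke_prod ar SP; have LT := local_blaschke_prod ar TP.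
rewrite (Sz ar) in LS; rewrite (Tp ar) in LT.
have := local_orderM Lf (local_orderM LS (local_orderV LT)).
by rewrite add0n addn0 (addnC (pole_mult f a)) => /local_order_cancel.
Qed.

Let prodP z l : (forall s, s \in l -> [/\ s != 0, modulus s < r & r0 <= r ^+ 2 / modulus s]) ->
  modulus z < r0 -> z \notin l ->
  [/\ derivable (blaschke_prod r l) z 1, blaschke_prod r l z != 0 &
    logder (blaschke_prod r l) z = \sum_(s <- l) blaschke_term r s z].
Proof.
move=> H zr zl; apply: blaschke_prodP => // s sl; have [s0 _ rs] := H s sl.
split => //; last exact: reflect_neq.
by apply: contraNneq zl => ->.
Qed.

Let h_derivable z : modulus z < r0 -> z \notin S -> z \notin T -> f z != 0 ->
  [/\ holomorphic_at f z, derivable h z 1, h z != 0 & logder h z = logder f z +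
    (\sum_(s <- S) blaschke_term r s z + - (\sum_(t <- T) blaschke_term r t z))].
Proof.
move=> zr zS zT fz.
have fz' : holomorphic_at f z.
  by apply: holomorphic_at_pole_mult => //; rewrite -Tp//; apply/count_memPn.
have [dS nS lS] := prodP SP zr zS; have [dT nT lT] := prodP TP zr zT.
have df := holomorphic_at_derivable fz'.
have dTV : derivable (fun z => (blaschke_prod r T z)^-1) z 1 := derivableV nT dT.
have nTV : (blaschke_prod r T z)^-1 != 0 by rewrite invr_neq0.
have dP : derivable (fun z => blaschke_prod r S z * (blaschke_prod r T z)^-1) z 1 :=
  derivableM dS dTV.
have nP := mulf_neq0 nS nTV.
split.
- exact: fz'.
- exact (derivableM df dP).
- exact (mulf_neq0 fz nP).
- by rewrite /h (logderM df dP fz nP) (logderM dS dTV nS nTV) (logderV dT nT) lS lT.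
Qed.

Lemma f_neq0_outside_zeros_poles z : modulus z < r0 -> z \notin S -> z \notin T -> f z != 0.
Proof.
move=> zr zS zT; have fz : holomorphic_at f z.
  by apply: holomorphic_at_pole_mult => //; rewrite -Tp//; apply/count_memPn.
have [g [gh gz gE]] := meromorphic_local_order z fm fh f0.
rewrite -Sz// -Tp// in gE; rewrite (count_memPn zS) (count_memPn zT) in gE.
rewrite (continuous_dnbhs_eq (g := g) (holomorphic_at_continuous fz)
  (holomorphic_at_continuous gh))//.
by move: gE; apply: filterS => w; rewrite !expr0 mulr1 mul1r.
Qed.

Let circ_notin t : (circ r t \notin S) /\ (circ r t \notin T).
Proof.
by split; apply/negP => /[dup] H; [move/SP|move/TP] => -[_ + _]; rewrite modulus_circ ?ltW// ltxx.
Qed.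

Let circ_lt t : modulus (circ r t) < r0.
Proof. by rewrite modulus_circ// ltW. Qed.

Lemma f_circ_neq0 t : f (circ r t) != 0.
Proof. by have [a b] := circ_notin t; exact: f_neq0_outside_zeros_poles. Qed.

Lemma finite_formula n :
  [/\ continuous_seg (2 * pi) (fun t => ln (modulus (f (circ r t)))),
   \int[mu]_(t in `[0, 2 * pi]) ln (modulus (f (circ r t))) =
    2 * pi * (ln (modulus (f 0)) + \sum_(s <- S) ln (r / modulus s) -
      \sum_(t <- T) ln (r / modulus t)) &
   cint (2 * pi) (fun t => (ln (modulus (f (circ r t))))%:C * (circ r t)^-1 ^+ n.+1) =
    pi%:C * (n.+1%:R^-1 * (taylor_coef n (logder f) +
     (\sum_(s <- S) (s^-1 ^+ n.+1 - (reflect_pt r s)^-1 ^+ n.+1) -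
      \sum_(t <- T) (t^-1 ^+ n.+1 - (reflect_pt r t)^-1 ^+ n.+1))))].
Proof.
have [H [Hh H0 HE]] := removable h_order.
have Hc t : modulus (H (circ r t)) = modulus (f (circ r t)).
  have [a b] := circ_notin t.
  have [_ dh _ _] := h_derivable (circ_lt t) a b (f_circ_neq0 t).
  rewrite (HE _ (circ_lt t) (derivable_continuous dh)) /h !modulusM modulusV.
  rewrite !modulus_blaschke_prod_circ// ?invr1 ?mulr1//.
  - by move=> s /TP[].
  - by move=> s /SP[].
have Hln : (fun t => ln (modulus (f (circ r t)))) = (fun t => ln (modulus (H (circ r t)))).
  by apply/funext => t; rewrite Hc.
have r00 : modulus (0 : C) < r0 by rewrite modulus0 (lt_trans rgt0).
have S0 : (0 : C) \notin S by apply/negP => /SP[]; rewrite eqxx.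
have T0 : (0 : C) \notin T by apply/negP => /TP[]; rewrite eqxx.
have H0E : H 0 = h 0.
  have [_ dh _ _] := h_derivable r00 S0 T0 f0.
  exact: HE (derivable_continuous dh).
split.
- by rewrite Hln; exact: continuous_ln_modulus_circ rgt0 rr0 Hh H0.
- transitivity (\int[mu]_(t in `[0, 2 * pi]) ln (modulus (H (circ r t)))).
    by apply: eq_Rintegral => t _; rewrite Hc.
  rewrite (jensen_nonvanishing rgt0 rr0 Hh H0) H0E /h !modulusM modulusV.
  have [|S1 S2] := @ln_blaschke_prod0 r S rgt0; first by move=> s /SP[].
  have [|T1 T2] := @ln_blaschke_prod0 r T rgt0; first by move=> s /TP[].
  rewrite lnM ?posrE ?modulus_gt0//; last by rewrite divr_gt0.
  by rewrite ln_div ?posrE// S1 T1 addrA.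
- have := ln_modulus_coef rgt0 rr0 Hh H0 n.
  have -> : (fun t => (ln (modulus (H (circ r t))))%:C * (circ r t)^-1 ^+ n.+1) =
     (fun t => (ln (modulus (f (circ r t))))%:C * (circ r t)^-1 ^+ n.+1).
    by apply/funext => t; rewrite Hc.
  move=> ->; congr (_ * _).
  (* [ln_modulus_coef] divides by (n + 1)! and [taylor_coef] by n!; the quotient is the factor 1 /
     (n + 1). *)
  rewrite factS natrM invfM -mulrA; congr (_ * _).
  rewrite -/(logder H) -/(taylor_coef n (logder H)).
  (* The logarithmic derivative of [h] splits only away from zeros and poles, but Taylor
     coefficients at 0 depend only on a small disc, here chosen free of them. *)
  have [d d0 Hd] : exists2 d : R, 0 < d & forall z, modulus z < d ->
    [/\ modulus z < r0, z \notin S, z \notin T, derivable f z 1 & f z != 0].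
    have nin (l : seq C) : (0 : C) \notin l -> \forall z \near (0 : C), z \notin l.
      elim: l => [|s l IH]; first by move=> _; apply: filterE.
      rewrite in_cons negb_or => /andP[/near_neq s0 /IH l0]; move: s0 l0.
      by apply: filterS2 => z zs zl; rewrite in_cons negb_or zs.
    have rn : \forall z \near (0 : C), modulus z < r0 by exact: disc_near r00 _.
    have /nbhs_modulusP[d d0 Hd] : \forall z \near (0 : C),
        (modulus z < r0 /\ (z \notin S /\ z \notin T)) /\ (derivable f z 1 /\ f z != 0).
      exact: (filterI (filterI rn (filterI (nin S S0) (nin T T0)))
        (filterI fh (holomorphic_at_neq0 fh f0))).
    exists d => // z; rewrite -{1}[z]subr0 => /Hd.
    by move=> [[z1 [z2 z3]] [z4 z5]].
  have bd (l : seq C) :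
      (forall s, s \in l -> [/\ s != 0, modulus s < r & r0 <= r ^+ 2 / modulus s]) ->
      (forall z, modulus z < d -> z \notin l) -> forall s, s \in l ->
      disc_holomorphic d (blaschke_term r s).
    move=> HP Hl s sl; have [s0 _ rs] := HP s sl.
    have ds : d <= modulus s by rewrite leNgt; apply/negP => /Hl; rewrite sl.
    apply: blaschke_term_holomorphic => //; rewrite modulus_reflect_pt; apply: le_trans rs.
    (* This proves [d <= r0]: otherwise the point [r0] itself would lie in the disc of radius [d],
       where [Hd] gives modulus below [r0]. *)
    rewrite leNgt; apply/negP => rd.
    have /Hd[] : modulus (r0%:C : C) < d.
      by rewrite modulusR ger0_norm// ltW// (lt_trans rgt0).
    by rewrite modulusR ger0_norm ?ltxx// ltW// (lt_trans rgt0).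
  have bS := bd S SP (fun z zd => let: And5 _ b _ _ _ := Hd z zd in b).
  have bT := bd T TP (fun z zd => let: And5 _ _ c _ _ := Hd z zd in c).
  have hS := sum_seq_disc_holomorphic bS; have hT := sum_seq_disc_holomorphic bT.
  have lf : disc_holomorphic d (logder f).
    apply: disc_holomorphic_logder.
    + by move=> z /Hd[].
    + by move=> z /Hd[].
  have -> : taylor_coef n (logder H) = taylor_coef n (fun z => logder f z +
      (\sum_(s <- S) blaschke_term r s z + - (\sum_(t <- T) blaschke_term r t z))).
    apply: (eq_taylor_coef n d0) => z zd.
    have [z1 z2 z3 z4 z5] := Hd z zd; have [_ _ _ <-] := h_derivable z1 z2 z3 z5.
    have E w : modulus w < d -> H w = h w.
      move=> wd; have [w1 w2 w3 w4 w5] := Hd w wd; have [_ dh _ _] := h_derivable w1 w2 w3 w5.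
      exact: HE (derivable_continuous dh).
    by rewrite /logder (near_derive1 (disc_near zd E)) E.
  rewrite (taylor_coefD n d0 lf (disc_holomorphicD hS (disc_holomorphicN hT))).
  rewrite (taylor_coefD n d0 hS (disc_holomorphicN hT)) (taylor_coefN n d0 hT).
  rewrite (taylor_coef_sum n d0 bS) (taylor_coef_sum n d0 bT).
  congr (_ + (_ - _)).
  + by apply: eq_big_seq => s /SP[s0 _ _]; exact: taylor_coef_blaschke_term.
  + by apply: eq_big_seq => s /TP[s0 _ _]; exact: taylor_coef_blaschke_term.
Qed.

End Formula.
End FiniteFormula.

(** * Letting the radius tend to infinity *)

Section Families.
Variable R : realType.
Local Notation C := (Cplx R).
Local Notation re := (@complex.Re R).
Local Notation im := (@complex.Im R).

Lemma esum_ge_seq (T : choiceType) (I : set T) (a : T -> R) (l : seq T) :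
  uniq l -> (forall x, x \in l -> I x) ->
  ((\sum_(x <- l) a x)%:E <= \esum_(x in I) (a x)%:E)%E.
Proof.
move=> ul lI; apply: esum_ge; exists [set` l].
  by split; [exact: finite_seq|move=> x /= /lI].
by rewrite -fsbig_seq// sumEFin.
Qed.

(** Each point of the list that falls inside the current interval becomes its new right end. *)
Lemma interval_avoiding_seq (L : seq R) (a b : R) : a < b ->
  exists p q, [/\ a <= p, p < q, q <= b & forall x, x \in L -> x <= p \/ q <= x].
Proof.
move=> ab; elim: L => [|x L [p [q [ap pq qb H]]]]; first by exists a, b; split.
have [xp|px] := lerP x p.
  by exists p, q; split=> // y; rewrite in_cons => /predU1P[->|/H]; [left|].
have [qx|xq] := lerP q x.
  by exists p, q; split=> // y; rewrite in_cons => /predU1P[->|/H]; [right|].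
exists p, x; split=> //; first by rewrite (le_trans (ltW xq)).
move=> y; rewrite in_cons => /predU1P[->|/H]; first by right.
by case=> [yp|qy]; [left|right; rewrite (le_trans (ltW xq))].
Qed.

Section Family.
Variables (D : set nat) (u : nat -> C) (k : nat).
Hypothesis k0 : (0 < k)%N.
Hypothesis u0 : forall n, D n -> u n != 0.
Hypothesis su : (\esum_(n in D) ((modulus (u n) ^+ k)^-1)%:E < +oo)%E.

Let w n : C := if n \in D then (u n ^+ k)^-1 else 0.
Let c n : R := if n \in D then (modulus (u n) ^+ k)^-1 else 0.

Let c0 n : 0 <= c n.
Proof. by rewrite /c; case: ifP => // _; rewrite invr_ge0 exprn_ge0// modulus_ge0. Qed.

Let wc n : modulus (w n) = c n.
Proof. by rewrite /w /c; case: ifP => _; rewrite ?modulus0// modulusV modulusX. Qed.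

Let c_bounded : exists B, forall m, \sum_(0 <= n < m) c n <= B.
Proof.
exists (fine (\esum_(n in D) ((modulus (u n) ^+ k)^-1)%:E)) => m.
have f : \esum_(n in D) ((modulus (u n) ^+ k)^-1)%:E \is a fin_num.
  rewrite ge0_fin_numE// esum_ge0// => x _.
  by rewrite lee_fin invr_ge0 exprn_ge0// modulus_ge0.
rewrite -lee_fin fineK// /c -big_mkcond/= -big_filter.
apply: esum_ge_seq; first by rewrite filter_uniq// iota_uniq.
by move=> x; rewrite mem_filter => /andP[/set_mem].
Qed.

Let c_cvg : cvgn (series c).
Proof.
have [B HB] := c_bounded; apply: nondecreasing_is_cvgn.
  apply/nondecreasing_seqP => n; rewrite /series /=.
  by rewrite (big_nat_recr n)//= lerDl.
by exists B => _ [n _ <-]; exact: HB.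
Qed.

Lemma family_tail e : 0 < e -> exists M, forall m, (M <= m)%N -> \sum_(M <= n < m) c n <= e.
Proof.
move=> e0; have nd : nondecreasing_seq (series c).
  by apply/nondecreasing_seqP => n; rewrite /series /= (big_nat_recr n)//= lerDl.
have /cvgrPdist_lt/(_ _ e0)[M _ HM] : series c @ \oo --> limn (series c) by exact: c_cvg.
exists M => m Mm; have := HM M (leqnn M).
have := nondecreasing_cvgn_le nd c_cvg m; rewrite {1}/series /= (big_cat_nat (n := M))//=.
rewrite /series/= => H1 H2; have := ler_norm (limn (series c) - \sum_(0 <= k < M) c k).
by rewrite /series/= in H1 H2 *; lra.
Qed.

Lemma family_sum_cvg : series w @ \oo --> family_sum D (fun n => (u n ^+ k)^-1).
Proof.
have cvg_part (v : nat -> R) : (forall n, `|v n| <= c n) -> cvgn (series v).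
  move=> vc; apply: normed_cvg; apply: series_le_cvg c_cvg => //.
  by move=> n; rewrite normr_ge0.
have cr : cvgn (series (re \o w)) by apply: cvg_part => n; rewrite -wc re_le.
have ci : cvgn (series (im \o w)) by apply: cvg_part => n; rewrite -wc im_le.
have E : series w = (fun n => series (re \o w) n +i* series (im \o w) n : C).
  apply/funext => n; rewrite /series /=; elim: n => [|n IH]; first by rewrite !big_nil.
  by rewrite !(big_nat_recr n)//= {}IH; case: (w n).
have cw : series w @ \oo --> (limn (series (re \o w)) +i* limn (series (im \o w)) : C).
  by rewrite E; exact: cvg_complex cr ci.
suff -> : family_sum D (fun n => (u n ^+ k)^-1) =
    (limn (series (re \o w)) +i* limn (series (im \o w))) by [].
by apply: cvg_lim => //; exact: norm_hausdorff.
Qed.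

Lemma family_sum_near e : 0 < e -> exists M, forall m, (M <= m)%N ->
  modulus (family_sum D (fun n => (u n ^+ k)^-1) - \sum_(0 <= n < m) w n) <= e.
Proof.
move=> e0; have /cvg_modulusP/(_ _ e0)[M _ HM] := family_sum_cvg.
by exists M => m Mm; rewrite modulus_distC; apply: ltW; exact: HM.
Qed.

(** Convergence forces the moduli to infinity: a term with |u n| < rho contributes at least
    rho^(-k), while the tail is at most half of that. *)
Lemma family_bounded_index (rho : R) : exists M, forall n, D n -> modulus (u n) < rho -> (n < M)%N.
Proof.
have [rho0|rho0] := lerP rho 0.
  by exists 0%N => n _; rewrite ltNge (le_trans rho0)// modulus_ge0.
have e0 : 0 < rho ^- k / 2 by rewrite divr_gt0// invr_gt0 exprn_gt0.
have [M HM] := family_tail e0; exists M => n Dn nr; rewrite ltnNge; apply/negP => Mn.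
have := HM n.+1 (leqW Mn); rewrite big_nat_recr//=.
have : 0 <= \sum_(M <= i < n) c i by apply: sumr_ge0.
have -> : c n = (modulus (u n) ^+ k)^-1 by rewrite /c mem_set.
have : rho ^- k <= (modulus (u n) ^+ k)^-1.
  rewrite lef_pV2 ?posrE ?exprn_gt0// ?modulus_gt0 ?u0//.
  by rewrite lerXn2r ?nnegrE ?modulus_ge0// ltW.
by lra.
Qed.

(** Only indices below [m] are searched; callers provide an [m] beyond every index whose term lies
    in the disc, so the list is complete. *)
Definition family_disc (m : nat) (r : R) : seq C :=
  [seq u n | n <- iota 0 m & (n \in D) && (modulus (u n) < r)].

(** Dominated convergence by hand. The head, of fixed length [M], lies in the disc for large r and
    its reflected terms tend to 0; the tail is dominated by the convergent series, since |x| / r^2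
    <= 1 / |x| when |x| < r. *)
Lemma family_disc_near e : 0 < e -> exists rho, forall r m, rho < r -> 1 <= r ->
  (forall n, D n -> modulus (u n) < r -> (n < m)%N) ->
  modulus (family_sum D (fun n => (u n ^+ k)^-1) - \sum_(x <- family_disc m r) x^-1 ^+ k) <= e
  /\ \sum_(x <- family_disc m r) (modulus x / r ^+ 2) ^+ k <= e.
Proof.
move=> e0; have e2 : 0 < e / 2 by rewrite divr_gt0.
have [M1 HM1] := family_tail e2; have [M2 HM2] := family_sum_near e2.
pose M := maxn M1 M2.
pose B := \sum_(0 <= n < M) (if n \in D then modulus (u n) ^+ k else 0).
have B0 : 0 <= B.
  by apply: sumr_ge0 => n _; case: ifP => // _; rewrite exprn_ge0// modulus_ge0.
pose A := \sum_(0 <= n < M) modulus (u n).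
have uA n : (n < M)%N -> modulus (u n) <= A.
  move=> nM; rewrite /A big_mkord (bigD1 (Ordinal nM))//= lerDl.
  by apply: sumr_ge0 => i _; exact: modulus_ge0.
(* Beyond [A] all head terms lie in the disc; beyond [B / (e / 2)] the reflected head sum, at most
   [B / r], is below [e / 2]. *)
exists (A + B / (e / 2)) => r m rho r1 Hm.
have Be0 : 0 <= B / (e / 2) by rewrite divr_ge0// ltW.
have A0 : 0 <= A by apply: sumr_ge0 => n _; exact: modulus_ge0.
have r0 : 0 < r by lra.
(* Both sums are extended to a common range reaching [M]; by [Hm] the indices past [m] contribute
   0. *)
pose m' := maxn m M.
have Mm' : (M <= m')%N by exact: leq_maxr.
have big_disc (V : nmodType) (F : C -> V) : \sum_(x <- family_disc m r) F x =
    \sum_(0 <= n < m') (if (n \in D) && (modulus (u n) < r) then F (u n) else 0).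
  rewrite /family_disc big_map big_filter big_mkcond/= -/(index_iota 0 m).
  rewrite [RHS](big_cat_nat (n := m)) ?leq_maxl//=.
  rewrite [X in _ = _ + X]big1_seq ?addr0; first by rewrite /index_iota subn0.
  move=> n /=; rewrite mem_index_iota => /andP[mn _]; case: ifP => // /andP[].
  by rewrite inE => Dn /(Hm _ Dn); rewrite ltnNge mn.
have tail : \sum_(M <= n < m') c n <= e / 2.
  have M1m : (M1 <= m')%N by rewrite (leq_trans _ Mm')// leq_maxl.
  apply: le_trans (HM1 _ M1m); rewrite [leRHS](big_cat_nat (n := M))// ?leq_maxl//=.
  by rewrite lerDr sumr_ge0.
split.
- rewrite big_disc.
  have E : \sum_(0 <= n < m') (if (n \in D) && (modulus (u n) < r) then (u n)^-1 ^+ k else 0) =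
    \sum_(0 <= n < M) w n +
    \sum_(M <= n < m') (if (n \in D) && (modulus (u n) < r) then (u n)^-1 ^+ k else 0).
    rewrite (big_cat_nat (n := M))//=; congr (_ + _); apply: eq_big_nat => n /andP[_ nM].
    have -> : modulus (u n) < r by have := uA n nM; lra.
    by rewrite andbT /w exprVn.
  rewrite E opprD addrA; apply: le_trans (modulusD _ _) _; rewrite (splitr e) lerD//.
    by apply: HM2; exact: leq_maxr.
  rewrite modulusN; apply: le_trans (modulus_sum _ _ _) _; apply: le_trans tail.
  apply: ler_sum => n _; rewrite -wc /w; case: ifP => [/andP[-> _]|_].
    by rewrite exprVn.
  by rewrite modulus0 modulus_ge0.
- rewrite big_disc (big_cat_nat (n := M))//= (splitr e) lerD//.
    apply: le_trans (_ : B / r <= _).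
      rewrite /B mulr_suml; apply: ler_sum => n _.
      have rk : r <= (r ^+ 2) ^+ k.
        rewrite -exprM -[leLHS]expr1 ler_weXn2l//.
        by rewrite (leq_trans (_ : 1 <= 2)%N)// leq_pmulr.
      case: (n \in D) => /=; last by rewrite mul0r.
      have uk : 0 <= modulus (u n) ^+ k by rewrite exprn_ge0// modulus_ge0.
      case: ifP => _; last by rewrite divr_ge0// ltW.
      by rewrite expr_div_n ler_wpM2l// lef_pV2 ?posrE ?exprn_gt0.
    by rewrite ler_pdivrMr// -ler_pdivrMl// mulrC; lra.
  apply: le_trans tail; apply: ler_sum => n _; rewrite /c.
  case: ifP => [/andP[nD ur]|_]; last exact: c0.
  rewrite nD; have Dn := set_mem nD.
  have un : 0 < modulus (u n) by rewrite modulus_gt0 u0.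
  rewrite -[leRHS]exprVn; apply: lerXn2r.
  + by rewrite nnegrE divr_ge0 ?modulus_ge0 ?sqr_ge0.
  + by rewrite nnegrE invr_ge0 modulus_ge0.
  + rewrite ler_pdivrMr ?exprn_gt0// ler_pdivlMl// -expr2.
    by apply: lerXn2r; rewrite ?nnegrE; exact: ltW.
Qed.

End Family.

Lemma lists_with_mult_neq0 (D : set nat) (u : nat -> C) (mult : C -> nat) n :
  lists_with_mult D u mult -> mult 0 = 0%N -> D n -> u n != 0.
Proof.
move=> /(_ 0) + m0 Dn; rewrite m0 II0 card_eq0 => /eqP E; apply/eqP => un.
by have : [set n | D n /\ u n = 0] n by []; rewrite E.
Qed.

(** The multiplicity of [a] is the cardinality of its set of indices, which the filtered list [l]
    enumerates without repetition. The gap between [r] and [r0] ensures that no occurrence of [a] is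
    missed. *)
Lemma count_family_disc (D : set nat) (u : nat -> C) (mult : C -> nat) m (r r0 : R) a :
  lists_with_mult D u mult ->
  (forall n, D n -> modulus (u n) < r -> (n < m)%N) ->
  (forall n, D n -> modulus (u n) < r \/ r0 <= modulus (u n)) ->
  modulus a < r0 -> count_mem a (family_disc D u m r) = mult a.
Proof.
move=> /(_ a) lm Hm gapr ar.
pose l := [seq n <- iota 0 m | [&& n \in D, modulus (u n) < r & u n == a]].
have ul : uniq l by rewrite filter_uniq// iota_uniq.
have E : [set n | D n /\ u n = a] = nth 0%N l @` `I_(size l).
  apply/seteqP; split=> n /=.
    move=> [Dn un]; have nl : n \in l.
      rewrite mem_filter mem_iota /= add0n mem_set//= un eqxx andbT.
      have [ur|] := gapr n Dn; last by rewrite un leNgt ar.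
      by rewrite -un ur/= Hm.
    by exists (index n l); rewrite ?nth_index//= index_mem.
  move=> [i il <-]; have := mem_nth 0%N il; rewrite mem_filter.
  by move=> /andP[/and3P[/set_mem Dn _ /eqP un] _].
have inj : {in `I_(size l) &, injective (nth 0%N l)}.
  by move=> i j /set_mem il /set_mem jl /eqP; rewrite nth_uniq// => /eqP.
have := card_eq_trans (card_esym (inj_card_eq inj)) (eq_ind _ (fun A => A #= _)%card lm _ E).
move=> /card_eq_II <-; rewrite /l size_filter /family_disc count_map count_filter.
by apply: eq_count => n /=; rewrite andbC -andbA.
Qed.

End Families.

(** * Integral bounds and the characteristic *)

Section Limit.
Variable R : realType.
Local Notation C := (Cplx R).
Local Notation re := (@complex.Re R).
Local Notation im := (@complex.Im R).
Local Notation mu := (@lebesgue_measure R).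

Lemma limf_esup0_small (g : R -> \bar R) : limf_esup g (pinfty_nbhs R) = 0%E ->
  forall e : R, 0 < e -> exists rho, forall r, rho < r -> (g r <= e%:E)%E.
Proof.
move=> g0 e e0; have : (limf_esup g (pinfty_nbhs R) < e%:E)%E by rewrite g0 lte_fin.
rewrite limf_esupE => /ereal_inf_lt[_ [V [M [_ MV]] <-] /ltW sV].
exists M => r Mr; apply: le_trans sV; apply: ereal_sup_ubound.
by exists r => //; exact: MV.
Qed.

Lemma continuous_seg_norm b (u : R -> R) : continuous_seg b u ->
  continuous_seg b (fun t => `|u t|).
Proof. by move=> uc t tb; apply: cvg_norm; exact: uc. Qed.

Lemma continuous_seg_max0 b (u : R -> R) : continuous_seg b u ->
  continuous_seg b (fun t => Num.max 0 (u t)).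
Proof.
move=> uc t tb; apply: (@continuous_max _ _ (fun=> 0) u); first exact: cst_continuous.
exact: uc.
Qed.

(** Pointwise |u| = 2 max(0, u) - u; this lets the proximity function and Jensen's formula together
    bound the integral of |log|f||. *)
Lemma Rintegral_norm b (u : R -> R) : continuous_seg b u ->
  \int[mu]_(t in `[0, b]) `|u t| =
  2 * (\int[mu]_(t in `[0, b]) Num.max 0 (u t)) - \int[mu]_(t in `[0, b]) u t.
Proof.
move=> uc; have mI : measurable (`[0, b] : set (measurableTypeR R)) by exact: measurable_itv.
have i1 := continuous_seg_integrable uc.
have i2 := continuous_seg_integrable (continuous_seg_max0 uc).
have E : \int[mu]_(t in `[0, b]) (2 * Num.max 0 (u t)) =
    2 * (\int[mu]_(t in `[0, b]) Num.max 0 (u t)) by exact: (RintegralZl 2 mI i2).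
rewrite -E; have i3 : mu.-integrable `[0, b] (EFin \o (fun t => 2 * Num.max 0 (u t))).
  exact: (@integrableZl _ _ _ mu _ mI 2 _ i2).
rewrite -(RintegralB mI i3 i1); apply: eq_Rintegral => t _ /=.
by have [ut|ut] := lerP 0 (u t); [rewrite ger0_norm|rewrite ltr0_norm]; lra.
Qed.

Lemma Rintegral_mul_le b (u v : R -> R) (V : R) : continuous_seg b u -> continuous_seg b v ->
  (forall t, `|v t| <= V) ->
  `|\int[mu]_(t in `[0, b]) (u t * v t)| <= V * \int[mu]_(t in `[0, b]) `|u t|.
Proof.
move=> uc vc vV; have mI : measurable (`[0, b] : set (measurableTypeR R)) by exact: measurable_itv.
have uvc : continuous_seg b (fun t => u t * v t).
  by move=> t tb; apply: cvgM; [exact: uc|exact: vc].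
have i1 := continuous_seg_integrable uvc.
have i2 := continuous_seg_integrable (continuous_seg_norm uvc).
have i3 := continuous_seg_integrable (continuous_seg_norm uc).
have i4 : mu.-integrable `[0, b] (EFin \o (fun t => V * `|u t|)).
  exact: (@integrableZl _ _ _ mu _ mI V _ i3).
have E : \int[mu]_(t in `[0, b]) (V * `|u t|) = V * \int[mu]_(t in `[0, b]) `|u t|.
  exact: (RintegralZl V mI i3).
apply: le_trans (le_normr_Rintegral mI i1) _; rewrite -E.
apply: (le_Rintegral mI i2 i4) => t _ /=.
by rewrite normrM mulrC ler_wpM2r.
Qed.

Lemma cint_mul_le b (u : R -> R) (v : R -> C) (V : R) : continuous_seg b u ->
  continuous_seg b v -> (forall t, modulus (v t) <= V) ->
  modulus (cint b (fun t => (u t)%:C * v t)) <= 2 * V * \int[mu]_(t in `[0, b]) `|u t|.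
Proof.
move=> uc vc vV; apply: le_trans (modulus_le _) _.
have -> : re (cint b (fun t => (u t)%:C * v t)) = \int[mu]_(t in `[0, b]) (u t * re (v t)).
  by apply: eq_Rintegral => t _; rewrite reM /= mul0r subr0.
have -> : im (cint b (fun t => (u t)%:C * v t)) = \int[mu]_(t in `[0, b]) (u t * im (v t)).
  by apply: eq_Rintegral => t _; rewrite imM /= mul0r addr0.
rewrite -mulrA mulr_natl mulr2n; apply: lerD; apply: Rintegral_mul_le => //.
- exact: (continuous_seg_re vc).
- by move=> t; apply: le_trans (re_le _) (vV t).
- exact: (continuous_seg_im vc).
- by move=> t; apply: le_trans (im_le _) (vV t).
Qed.

Lemma proximityE (f : C -> C) (r : R) :
  continuous_seg (2 * pi) (fun t => ln (modulus (f (circ r t)))) ->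
  proximity f r =
  ((2 * pi)^-1 * \int[mu]_(t in `[0, (2 * pi)%R]) Num.max 0 (ln (modulus (f (circ r t)))))%:E.
Proof.
move=> uc; have mI : measurable (`[0, (2 * pi)%R] : set (measurableTypeR R)).
  exact: measurable_itv.
have i := continuous_seg_integrable (continuous_seg_max0 uc).
rewrite EFinM /proximity /Rintegral fineK//.
exact: (integrable_fin_num mI i).
Qed.

(** Grouping [T] by distinct values makes its sum a finite part of the sum defining the counting
    function, whose terms are indexed by points weighted with multiplicity. *)
Lemma counting_ge (f : C -> C) (r : R) (T : seq C) :
  (forall t, t \in T -> modulus t < r) ->
  (forall t, t \in T -> count_mem t T = pole_mult f t) ->
  ((\sum_(t <- T) ln (r / modulus t))%:E <= Defs.counting f r)%E.
Proof.
move=> Tr Tp; rewrite -big_undup_iterop_count.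
have -> : \sum_(i <- undup T) iterop (count_mem i T) +%R (ln (r / modulus i)) 0 =
    \sum_(i <- undup T) (pole_mult f i)%:R * ln (r / modulus i).
  apply: eq_big_seq => i; rewrite mem_undup => /Tp <-.
  by rewrite mulr_natl.
by apply: esum_ge_seq; [exact: undup_uniq|move=> x; rewrite mem_undup => /Tr].
Qed.

End Limit.

(** * Choice of the radius and passage to the limit *)

Section Main.
Variable R : realType.
Local Notation C := (Cplx R).
Local Notation mu := (@lebesgue_measure R).
Variables (N : nat) (f : C -> C) (Dt Ds : set nat) (t s : nat -> C).
Hypotheses (fm : meromorphic f) (fh : holomorphic_at f 0) (f0 : f 0 != 0).
Hypotheses (tl : lists_with_mult Dt t (pole_mult f)) (sl : lists_with_mult Ds s (zero_mult f)).
Hypothesis st : (\esum_(n in Dt) ((modulus (t n) ^+ N.+1)^-1)%:E < +oo)%E.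
Hypothesis ss : (\esum_(n in Ds) ((modulus (s n) ^+ N.+1)^-1)%:E < +oo)%E.
Hypothesis lim0 : limf_esup (fun r : R => (characteristic f r * ((r ^+ N.+1)^-1)%:E)%E)
    (pinfty_nbhs R) = 0%E.

Let mult0 : pole_mult f 0 = 0%N /\ zero_mult f 0 = 0%N.
Proof.
have L0 := local_order_holomorphic fh f0.
split.
  rewrite /pole_mult xgetPN// => k /= Hk; have [k0 _] := Hk.
  exact: (local_order_unique L0 k0 (pole_of_order_local Hk)).
rewrite /zero_mult; case: xgetP => // m _ [g [_ _ fE]].
have := nbhs_singleton fE; case: m {fE} => // m.
by rewrite subrr expr0n mul0r => /eqP; rewrite (negPf f0).
Qed.

Let t0 n : Dt n -> t n != 0 := lists_with_mult_neq0 tl mult0.1.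
Let s0 n : Ds n -> s n != 0 := lists_with_mult_neq0 sl mult0.2.

(** Only finitely many zeros and poles have modulus below [a + 1], so their moduli leave a gap
    between some [p] and [q] beyond [a]; [r] is its midpoint. *)
Lemma generic_radius (a : R) : 0 < a -> exists r r0 ms mt,
  [/\ a < r, r < r0,
   (forall n, Ds n -> modulus (s n) < r -> (n < ms)%N) /\
   (forall n, Dt n -> modulus (t n) < r -> (n < mt)%N),
   (forall n, Ds n -> modulus (s n) < r \/ r0 <= modulus (s n)) /\
   (forall n, Dt n -> modulus (t n) < r \/ r0 <= modulus (t n)) &
   forall x, x \in family_disc Ds s ms r ++ family_disc Dt t mt r ->
     [/\ x != 0, modulus x < r & r0 <= r ^+ 2 / modulus x]].
Proof.
move=> a0; pose b := a + 1.
have [ms Hs] := family_bounded_index s0 ss b.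
have [mt Ht] := family_bounded_index t0 st b.
have ab : a < b by rewrite ltrDl.
have [p [q [ap pq qb H]]] := interval_avoiding_seq
  [seq modulus x | x <- family_disc Ds s ms b ++ family_disc Dt t mt b] ab.
have p0 : 0 < p := lt_le_trans a0 ap.
pose r := (p + q) / 2; have pr : p < r by rewrite /r; lra.
have rq : r < q by rewrite /r; lra.
have r0 : 0 < r := lt_trans p0 pr.
(* Terms outside the circle have modulus at least [q], terms inside at most [p], which sends their
   reflections to modulus at least [r ^+ 2 / p]; this exceeds [r] because [p < r]. *)
pose r1 := Num.min q (r ^+ 2 / p).
have disc (D : set nat) (u : nat -> C) m n : (n < m)%N -> D n -> modulus (u n) < b ->
    u n \in family_disc D u m b.
  move=> nm Dn nb; apply/mapP; exists n => //.
  by rewrite mem_filter mem_iota mem_set// nb.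
have Ss n : Ds n -> modulus (s n) <= p \/ q <= modulus (s n).
  move=> Dn; have [nb|bn] := ltrP (modulus (s n)) b; last by right; exact: le_trans bn.
  by apply: H; apply: map_f; rewrite mem_cat disc// Hs.
have St n : Dt n -> modulus (t n) <= p \/ q <= modulus (t n).
  move=> Dn; have [nb|bn] := ltrP (modulus (t n)) b; last by right; exact: le_trans bn.
  by apply: H; apply: map_f; rewrite mem_cat (disc Dt) ?orbT// Ht.
have gp x : modulus x <= p \/ q <= modulus x -> modulus x < r \/ r1 <= modulus x.
  case=> [xp|qx]; [left; exact: le_lt_trans pr|right; apply: le_trans qx].
  by rewrite ge_min lexx.
have good x : x != 0 -> modulus x < r -> modulus x <= p \/ q <= modulus x ->
    [/\ x != 0, modulus x < r & r1 <= r ^+ 2 / modulus x].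
  move=> x0 xr [xp|qx]; last by have := lt_trans xr rq; rewrite ltNge qx.
  split=> //; apply: le_trans (_ : r ^+ 2 / p <= _); first by rewrite ge_min lexx orbT.
  by rewrite ler_wpM2l ?sqr_ge0// lef_pV2 ?posrE ?modulus_gt0.
exists r, r1, ms, mt; split.
- exact: le_lt_trans pr.
- by rewrite lt_min rq/= ltr_pdivlMr// expr2 ltr_pM2l.
- split=> n Dn nr; [apply: Hs|apply: Ht] => //;
  exact: lt_le_trans nr (le_trans (ltW rq) qb).
- by split=> n Dn; apply: gp; [exact: Ss|exact: St].
- move=> x; rewrite mem_cat => /orP[] /mapP[n]; rewrite mem_filter
    => /andP[/andP[/set_mem Dn nr] _] ->; apply: good => //.
  + exact: s0.
  + exact: Ss.
  + exact: t0.
  + exact: St.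
Qed.

(** With P the integral of the positive part and E = e r^(N+1), the characteristic gives P + 2 pi NT
    <= 2 pi E. By Jensen the integral of |log|f|| is 2 P - 2 pi (log|f(0)| + NS - NT), at most 2 (P
    + 2 pi NT) + 2 pi E, hence 6 pi E. *)
Lemma log_integral_le (r e : R) (S T : seq C) : 0 < r -> 0 <= e ->
  `|ln (modulus (f 0))| <= e * r ^+ N.+1 ->
  continuous_seg (2 * pi) (fun t => ln (modulus (f (circ r t)))) ->
  \int[mu]_(t in `[0, 2 * pi]) ln (modulus (f (circ r t))) =
    2 * pi * (ln (modulus (f 0)) + \sum_(s <- S) ln (r / modulus s) -
      \sum_(t <- T) ln (r / modulus t)) ->
  (forall x, x \in S ++ T -> x != 0 /\ modulus x < r) ->
  (forall x, x \in T -> count_mem x T = pole_mult f x) ->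
  (characteristic f r * ((r ^+ N.+1)^-1)%:E <= e%:E)%E ->
  \int[mu]_(t in `[0, 2 * pi]) `|ln (modulus (f (circ r t)))| <= 6 * pi * (e * r ^+ N.+1).
Proof.
move=> r0 e0 l0 uc J STr Tp Tr; rewrite Rintegral_norm//.
set I := \int[mu]_(t in _) ln _ in J *; set P := \int[mu]_(t in _) Num.max _ _.
set NS := \sum_(s <- S) _ in J; set NT := \sum_(t <- T) _ in J.
have rk : 0 < r ^+ N.+1 by rewrite exprn_gt0.
have ln_pos x : x \in S ++ T -> 0 <= ln (r / modulus x).
  move=> /STr[x0 xr]; apply: ln_ge0; rewrite ler_pdivlMr ?modulus_gt0// mul1r.
  exact: ltW.
have NS0 : 0 <= NS.
  by rewrite /NS big_seq; apply: sumr_ge0 => x xS; apply: ln_pos; rewrite mem_cat xS.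
have NT0 : 0 <= NT.
  by rewrite /NT big_seq; apply: sumr_ge0 => x xT; apply: ln_pos; rewrite mem_cat xT orbT.
have P0 : 0 <= P by apply: Rintegral_ge0 => x _; rewrite le_max lexx.
have H : (((2 * pi)^-1 * P + NT)%:E <= characteristic f r)%E.
  rewrite /characteristic EFinD leeD//; first by rewrite proximityE.
  by apply: counting_ge => // x xT; have [] := STr x; rewrite ?mem_cat ?xT ?orbT.
have {H} H : (2 * pi)^-1 * P + NT <= e * r ^+ N.+1.
  rewrite -ler_pdivrMr// -lee_fin EFinM; apply: le_trans Tr.
  by apply: lee_wpmul2r => //; rewrite lee_fin invr_ge0 ltW.
have pi0 : 0 < pi :> R by exact: pi_gt0.
set E := e * r ^+ N.+1 in l0 H *.
have {H} H : P + 2 * pi * NT <= 2 * pi * E.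
  have p2 := @twopi_gt0 R; have := ler_wpM2l (ltW p2) H.
  by rewrite mulrDr mulVKf// gt_eqF.
have l1 : - E <= ln (modulus (f 0)) by rewrite lerNl (le_trans _ l0)// -normrN ler_norm.
have l2 : 2 * pi * - E <= 2 * pi * ln (modulus (f 0)).
  by rewrite ler_wpM2l// mulr_ge0// ltW.
have n1 : 0 <= 2 * pi * NS by rewrite !mulr_ge0// ltW.
have n2 : 0 <= 2 * pi * NT by rewrite !mulr_ge0// ltW.
rewrite J; lra.
Qed.

(** Four errors of size [e] come from the two truncated sums and the two reflected sums. The
    integral is at most 2 r^(-k) times 6 pi e r^k with k = N + 1, and the factor k / pi turns it
    into 12 k e. *)
Lemma family_sum_defect_le e : 0 < e ->
  modulus (family_sum Ds (fun n => (s n ^+ N.+1)^-1) -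
    family_sum Dt (fun n => (t n ^+ N.+1)^-1) + taylor_coef N (logder f)) <=
  (4 + 12 * N.+1%:R) * e.
Proof.
move=> e0; set FS := family_sum Ds _; set FT := family_sum Dt _; set tau := taylor_coef _ _.
have [rS HS] := family_disc_near (ltn0Sn N) s0 ss e0.
have [rT HT] := family_disc_near (ltn0Sn N) t0 st e0.
have [rho Hrho] := limf_esup0_small lim0 e0.
pose l0 := ln (modulus (f 0)).
(* Any radius above [a] meets all the thresholds; the last summand gives |log|f(0)|| <= e r, and [r]
   is at least 1, so e r <= e r^(N+1). *)
pose a := 1 + `|rS| + `|rT| + `|rho| + `|l0| / e.
have le0 : 0 <= `|l0| / e by rewrite divr_ge0// ltW.
have a0 : 0 < a.
  by have := normr_ge0 rS; have := normr_ge0 rT; have := normr_ge0 rho; rewrite /a; lra.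
have [r [r0 [ms [mt [ar rr0 [Hms Hmt] [gs gt] ST]]]]] := generic_radius a0.
have [r1 rrS rrT rrho rl] : [/\ 1 <= r, rS < r, rT < r, rho < r & `|l0| / e <= r].
  have := ler_norm rS; have := ler_norm rT; have := ler_norm rho.
  have := normr_ge0 rS; have := normr_ge0 rT; have := normr_ge0 rho.
  by move: ar; rewrite /a => *; split; lra.
have rgt0 : 0 < r := lt_le_trans ltr01 r1.
set S := family_disc Ds s ms r in ST; set T := family_disc Dt t mt r in ST.
have Sz x : modulus x < r0 -> count_mem x S = zero_mult f x.
  by move=> xr; apply: count_family_disc sl Hms gs xr.
have Tp x : modulus x < r0 -> count_mem x T = pole_mult f x.
  by move=> xr; apply: count_family_disc tl Hmt gt xr.
have [uc J coef] := finite_formula fm fh f0 rgt0 rr0 ST Sz Tp N.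
have [nearS smallS] := HS r ms rrS r1 Hms.
have [nearT smallT] := HT r mt rrT r1 Hmt.
rewrite -/S -/FS in nearS smallS; rewrite -/T -/FT in nearT smallT.
have rk : 0 < r ^+ N.+1 by rewrite exprn_gt0.
have l0r : `|ln (modulus (f 0))| <= e * r ^+ N.+1.
  move: rl; rewrite ler_pdivrMr// mulrC => /le_trans; apply.
  by rewrite ler_wpM2l ?(ltW e0)// -[leLHS]expr1 ler_weXn2l.
have STr x : x \in S ++ T -> x != 0 /\ modulus x < r by move=> /ST[].
have Tc x : x \in T -> count_mem x T = pole_mult f x.
  by move=> xT; apply: Tp; apply: lt_trans rr0; have [] := STr x; rewrite ?mem_cat ?xT ?orbT.
have intu := log_integral_le rgt0 (ltW e0) l0r uc J STr Tc (Hrho r rrho).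
pose v x : C := (circ r x)^-1 ^+ N.+1.
have vc : continuous_seg (2 * pi) v by apply: continuous_segX; exact: continuous_circV.
have vE x : modulus (v x) <= (r ^+ N.+1)^-1.
  by rewrite modulusX modulusV modulus_circ ?(ltW rgt0)// exprVn.
set I := cint _ _ in coef.
have I12 : modulus I <= 12 * pi * e.
  apply: le_trans (cint_mul_le uc vc vE) _.
  have rk' : 0 <= 2 * (r ^+ N.+1)^-1 by rewrite mulr_ge0// invr_ge0 ltW.
  apply: le_trans (ler_wpM2l rk' intu) _.
  by rewrite le_eqVlt; apply/orP; left; apply/eqP; field; rewrite gt_eqF.
pose refl (l : seq C) := \sum_(x <- l) (reflect_pt r x)^-1 ^+ N.+1.
pose inv (l : seq C) := \sum_(x <- l) x^-1 ^+ N.+1.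
have refl_le l : \sum_(x <- l) (modulus x / r ^+ 2) ^+ N.+1 <= e -> modulus (refl l) <= e.
  apply: le_trans; apply: le_trans (modulus_sum _ _ _) _; apply: ler_sum => x _.
  by rewrite modulusX modulusV modulus_reflect_pt invf_div.
have k0 : N.+1%:R != 0 :> C by rewrite pnatr_eq0.
have pi0 : pi%:C != 0 :> C by rewrite realC_neq0// pi_gt0.
have tauE : tau + (inv S - inv T) = N.+1%:R / pi%:C * I + (refl S - refl T).
  rewrite coef -/tau !sumrB -/(inv S) -/(inv T) -/(refl S) -/(refl T).
  move: (inv S) (inv T) (refl S) (refl T) => x1 x2 x3 x4.
  move: (N.+1%:R : C) (pi%:C : C) k0 pi0 => y1 y2 k0 pi0.
  by field; rewrite k0 pi0.
have -> : FS - FT + tau = (FS - inv S) - (FT - inv T) +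
    (N.+1%:R / pi%:C * I + (refl S - refl T)) by rewrite -tauE; ring.
have kI : modulus (N.+1%:R / pi%:C * I) <= 12 * N.+1%:R * e.
  rewrite !modulusM modulusV -(realC_nat R) !modulusR !ger0_norm ?pi_ge0//.
  rewrite -mulrA (mulrC _ (modulus I)) mulrA ler_pdivrMr ?pi_gt0//.
  apply: le_trans (_ : N.+1%:R * (12 * pi * e) <= _); first by rewrite ler_wpM2l.
  by rewrite le_eqVlt; apply/orP; left; apply/eqP; ring.
apply: le_trans (modulusD _ _) _.
have M1 := modulusD (FS - inv S) (- (FT - inv T)); rewrite modulusN in M1.
have M2 := modulusD (N.+1%:R / pi%:C * I) (refl S - refl T).
have M3 := modulusD (refl S) (- refl T); rewrite modulusN in M3.
have M4 := refl_le S smallS; have M5 := refl_le T smallT.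
rewrite -/(inv S) in nearS; rewrite -/(inv T) in nearT.
by rewrite mulrDl; lra.
Qed.

Lemma family_sum_zeros_poles :
  family_sum Ds (fun n => (s n ^+ N.+1)^-1) =
    family_sum Dt (fun n => (t n ^+ N.+1)^-1) - taylor_coef N (logder f).
Proof.
apply/eqP; rewrite -subr_eq0 opprB addrCA addrC addrAC -modulus_eq0; apply/eqP/le_anti.
rewrite modulus_ge0 andbT; apply/ler_addgt0Pl => e e0; rewrite addr0.
have K0 : 0 < 4 + 12 * N.+1%:R :> R by rewrite ltr_pwDl// mulr_ge0.
have := family_sum_defect_le (divr_gt0 e0 K0); rewrite mulrCA mulfV ?gt_eqF// mulr1.
by rewrite addrAC.
Qed.

End Main.

Theorem theorem5 (R : realType) (N : nat) (f : Cplx R -> Cplx R)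
    (Dt Ds : set nat) (t s : nat -> Cplx R) :
  meromorphic f ->
  holomorphic_at f 0 ->
  f 0 != 0 ->
  lists_with_mult Dt t (pole_mult f) ->
  lists_with_mult Ds s (zero_mult f) ->
  (\esum_(n in Dt) ((modulus (t n) ^+ N.+1)^-1)%:E < +oo)%E ->
  (\esum_(n in Ds) ((modulus (s n) ^+ N.+1)^-1)%:E < +oo)%E ->
  limf_esup (fun r : R => (characteristic f r * ((r ^+ N.+1)^-1)%:E)%E)
    (pinfty_nbhs R) = 0%E ->
  family_sum Ds (fun n => (s n ^+ N.+1)^-1) =
    family_sum Dt (fun n => (t n ^+ N.+1)^-1)
    - (N`!%:R)^-1 * derive1n N (fun z => derive1 f z / f z) 0.
Proof. exact: family_sum_zeros_poles. Qed.
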